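(* For $1\le k\le n-1$, orthogonally in $L^2\Lambda^k(\Omega)$, $$\mathcal{P}_0\Lambda^k(\mathcal{G}_h)=\mathcal{R}(d^{k-1}_h,\mathbf{W}^{\rm nc}_h\Lambda^{k-1})\oplus^\perp\mathfrak{H}^*_{h0}\Lambda^k\oplus^\perp\mathcal{R}(\delta_{k+1},\mathbf{W}^*_{h0}\Lambda^{k+1}),\qquad \mathfrak{H}^*_{h0}\Lambda^k=\mathfrak{H}^{\rm nc}_h\Lambda^k,$$ and $$\mathcal{P}_0\Lambda^k(\mathcal{G}_h)=\mathcal{R}(d^{k-1}_h,\mathbf{W}^{\rm nc}_{h0}\Lambda^{k-1})\oplus^\perp\mathfrak{H}^{\rm nc}_{h0}\Lambda^k\oplus^\perp\mathcal{R}(\delta_{k+1},\mathbf{W}^*_h\Lambda^{k+1}),\qquad \mathfrak{H}^{\rm nc}_{h0}\Lambda^k=\mathfrak{H}^*_h\Lambda^k.$$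
   Context: Let $n\ge 1$, let $\Omega\subset\mathbb{R}^n$ be a bounded polyhedral domain and $\mathcal{G}_h$ a simplicial subdivision of $\Omega$. $\mathcal{N}(T,D)=\{v\in D:Tv=0\}$, $\mathcal{R}(T,D)=\{Tv:v\in D\}$, $\oplus^\perp$ is the orthogonal direct sum, and for $A\subset B$, $B\ominus^\perp A$ is the $L^2$-orthogonal complement of $A$ in $B$. Forms. $d^k$ is the exterior derivative on $k$-forms, $\star$ the Hodge star, $\langle\cdot,\cdot\rangle_{L^2\Lambda^k}$ the $L^2(\Omega)$ inner product, and $\delta_k$ the codifferential on $k$-forms, i.e. the formal adjoint of $d^{k-1}$: $\langle d^{k-1}\mu,\eta\rangle_{L^2\Lambda^k}=\langle\mu,\delta_k\eta\rangle_{L^2\Lambda^{k-1}}$ whenever one of the smooth forms $\mu,\eta$ has compact support (thus $\delta_k=\pm\star d^{n-k}\star$). For $1\le k\le n$, $H^*\Lambda^k(\Omega)=\{\mu\in L^2\Lambda^k(\Omega):\delta_k\mu\in L^2\Lambda^{k-1}(\Omega)\}$ with the graph norm, and $H^*_0\Lambda^k(\Omega)$ is the closure in it of smooth compactly supported forms. Whitney forms. $\mathcal{P}_0\Lambda^k$ denotes constant-coefficient $k$-forms. The Koszul operator is $\kappa(dx^{\alpha_1}\wedge\dots\wedge dx^{\alpha_k})=\sum_{j=1}^k(-1)^{j+1}x^{\alpha_j}dx^{\alpha_1}\wedge\dots\wedge\widehat{dx^{\alpha_j}}\wedge\dots\wedge dx^{\alpha_k}$; $\mathcal{P}_1^-\Lambda^k=\mathcal{P}_0\Lambda^k+\kappa(\mathcal{P}_0\Lambda^{k+1})$,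 $\mathcal{P}_1^{*,-}\Lambda^k=\star(\mathcal{P}_1^-\Lambda^{n-k})$. $\mathcal{P}_0\Lambda^k(\mathcal{G}_h)$, $\mathcal{P}_1^-\Lambda^k(\mathcal{G}_h)$, $\mathcal{P}_1^{*,-}\Lambda^k(\mathcal{G}_h)$ are the corresponding piecewise spaces (no inter-element continuity). $d^k_h$ is $d^k$ applied cell by cell. Spaces. $\mathbf{W}^*_h\Lambda^k=\mathcal{P}_1^{*,-}\Lambda^k(\mathcal{G}_h)\cap H^*\Lambda^k(\Omega)$, $\mathbf{W}^*_{h0}\Lambda^k=\mathcal{P}_1^{*,-}\Lambda^k(\mathcal{G}_h)\cap H^*_0\Lambda^k(\Omega)$. For $0\le k\le n-1$, $\mathbf{W}^{\rm nc}_h\Lambda^k=\{\omega_h\in\mathcal{P}_1^-\Lambda^k(\mathcal{G}_h):\langle\omega_h,\delta_{k+1}\eta_h\rangle_{L^2\Lambda^k}-\langle d^k_h\omega_h,\eta_h\rangle_{L^2\Lambda^{k+1}}=0\ \forall\,\eta_h\in\mathbf{W}^*_{h0}\Lambda^{k+1}\}$, and $\mathbf{W}^{\rm nc}_{h0}\Lambda^k$ is defined in the same way but with the condition for all $\eta_h\in\mathbf{W}^*_h\Lambda^{k+1}$. Discrete harmonic forms: $\mathfrak{H}^*_h\Lambda^k=\mathcal{N}(\delta_k,\mathbf{W}^*_h\Lambda^k)\ominus^\perp\mathcal{R}(\delta_{k+1},\mathbf{W}^*_h\Lambda^{k+1})$, $\mathfrak{H}^*_{h0}\Lambda^k=\mathcal{N}(\delta_k,\mathbf{W}^*_{h0}\Lambda^k)\ominus^\perp\mathcal{R}(\delta_{k+1},\mathbf{W}^*_{h0}\Lambda^{k+1})$,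 $\mathfrak{H}^{\rm nc}_h\Lambda^k=\mathcal{N}(d^k_h,\mathbf{W}^{\rm nc}_h\Lambda^k)\ominus^\perp\mathcal{R}(d^{k-1}_h,\mathbf{W}^{\rm nc}_h\Lambda^{k-1})$, $\mathfrak{H}^{\rm nc}_{h0}\Lambda^k=\mathcal{N}(d^k_h,\mathbf{W}^{\rm nc}_{h0}\Lambda^k)\ominus^\perp\mathcal{R}(d^{k-1}_h,\mathbf{W}^{\rm nc}_{h0}\Lambda^{k-1})$. *)

(* Defs.v *)
From HB Require Import structures.
From mathcomp Require Import all_boot all_order all_algebra.
From mathcomp Require Import all_classical all_reals all_analysis.

Set Implicit Arguments.
Unset Strict Implicit.
Unset Printing Implicit Defensive.

Import Order.TTheory GRing.Theory Num.Theory.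
Import numFieldNormedType.Exports.

Local Open Scope classical_set_scope.
Local Open Scope ring_scope.

Definition rV_display : measure_display -> measure_display.
Proof. exact. Qed.

Section rV_measurable.
Context (R : realType) (n : nat).

Let coord (i : 'I_n) (x : 'rV[R]_n) : R := x ord0 i.

Let rV_set0 : g_sigma_preimage coord set0.
Proof. exact: sigma_algebra0. Qed.

Let rV_setC A : g_sigma_preimage coord A -> g_sigma_preimage coord (~` A).
Proof. exact: sigma_algebraC. Qed.

Let rV_bigcup (F : (set 'rV[R]_n)^nat) :
  (forall i, g_sigma_preimage coord (F i)) ->
  g_sigma_preimage coord (\bigcup_i F i).
Proof. exact: sigma_algebra_bigcup. Qed.

(* The product sigma-algebra of n copies of the Borel sigma-algebra of R. *)
HB.instance Definition _ :=
  @isMeasurable.Build (rV_display default_measure_display)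
    'rV[R]_n (g_sigma_preimage coord) rV_set0 rV_setC rV_bigcup.

End rV_measurable.

Section lebesgue_rV.
Context (R : realType).

(* R^n is identified with R^(n-1) x R by appending the new coordinate in
   front. *)
Definition rV_cons (n : nat) (p : 'rV[R]_n * measurableTypeR R) : 'rV[R]_n.+1 :=
  row_mx (const_mx p.2 : 'rV[R]_1) p.1.

(* The n-fold product of the Lebesgue measure of R. *)
Fixpoint lebesgue_rV (n : nat) : set 'rV[R]_n -> \bar R :=
  match n with
  | 0 => \d_(0 : 'rV[R]_0)
  | m.+1 => pushforward (@lebesgue_rV m \x @lebesgue_measure R)%E (@rV_cons m)
  end.

Lemma measurable_coord (n : nat) (i : 'I_n) :
  measurable_fun setT (fun x : 'rV[R]_n => x ord0 i : measurableTypeR R).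
Proof.
case: n i => [[]//|n i] _ A mA; apply: sub_sigma_algebra.
by rewrite -bigcup_mkord_ord; exists i; rewrite /= ?ltn_ord// inord_val; exists A.
Qed.

Lemma measurable_to_rV d (T : measurableType d) (n : nat) (f : T -> 'rV[R]_n) :
  (forall i, measurable_fun setT (fun x => f x ord0 i : measurableTypeR R)) ->
  measurable_fun setT f.
Proof.
move=> mf; apply: (@measurability _ _ _ _ _ _
  (\big[setU/set0]_(i < n) preimage_set_system setT
     (fun x : 'rV[R]_n => x ord0 i) measurable)) => //.
move=> _ [A HA <-]; elim/big_ind: _ HA => //.
- by move=> B C HB HC [/HB|/HC].
- move=> i _ [B mB <-]; rewrite !setTI.
  by have := mf i measurableT B mB; rewrite setTI.
Qed.

Lemma measurable_rV_cons (n : nat) : measurable_fun setT (@rV_cons n).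
Proof.
apply: measurable_to_rV => i; rewrite /rV_cons.
case: (@split_ordP 1 n i) => j ->.
- apply: (eq_measurable_fun snd); last exact: measurable_snd.
  by move=> x _; rewrite (row_mxEl (const_mx x.2 : 'rV_1)) mxE.
- apply: (eq_measurable_fun ((fun x : 'rV[R]_n => x ord0 j) \o fst)).
    by move=> x _; rewrite (row_mxEr (const_mx x.2 : 'rV_1)).
  by apply: measurableT_comp; [exact: measurable_coord|exact: measurable_fst].
Qed.

Lemma lebesgue_rV_is_measure (n : nat) :
  exists m : {measure set 'rV[R]_n -> \bar R}, @lebesgue_rV n = m.
Proof.
elim: n => [|n [m IH]]; first by exists (\d_(0 : 'rV[R]_0)).
pose pm : {measure set _ -> \bar R} := (m \x @lebesgue_measure R)%E.
exists (measure_function_pushforward__canonical__measure_function_Measure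
          pm (@measurable_rV_cons n)).
by rewrite /= IH.
Qed.

Let lebesgue_rV0 (n : nat) : @lebesgue_rV n set0 = 0%E.
Proof. by have [m ->] := lebesgue_rV_is_measure n; exact: measure0. Qed.

Let lebesgue_rV_ge0 (n : nat) (A : set 'rV[R]_n) : (0 <= @lebesgue_rV n A)%E.
Proof. by have [m ->] := lebesgue_rV_is_measure n; exact: measure_ge0. Qed.

Let lebesgue_rV_sigma_additive (n : nat) : semi_sigma_additive (@lebesgue_rV n).
Proof.
by have [m ->] := lebesgue_rV_is_measure n; exact: measure_semi_sigma_additive.
Qed.

HB.instance Definition _ (n : nat) := isMeasure.Build _ _ _ (@lebesgue_rV n)
  (@lebesgue_rV0 n) (@lebesgue_rV_ge0 n) (@lebesgue_rV_sigma_additive n).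

End lebesgue_rV.
Arguments lebesgue_rV {R} n.

Section geometry.
Context (R : realType) (n : nat).

Definition aff_indep (m : nat) (p : 'I_m -> 'rV[R]_n) : Prop :=
  forall t : 'I_m -> R,
    \sum_i t i = 0 -> \sum_i t i *: p i = 0 -> forall i, t i = 0.

Definition hull (m : nat) (p : 'I_m -> 'rV[R]_n) (A : pred 'I_m) :
    set 'rV[R]_n :=
  [set x | exists t : 'I_m -> R,
     [/\ forall i, 0 <= t i, forall i, ~~ A i -> t i = 0,
         \sum_i t i = 1 & x = \sum_i t i *: p i]].

(* The boundary of a polyhedral domain is a finite union of (n-1)-simplices;
   two-sided boundary pieces (cracks) are not excluded. *)
Definition polyhedral_domain (Omega : set 'rV[R]_n) : Prop :=
  [/\ Omega !=set0, open Omega, connected Omega, bounded_set Omega &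
      exists (m : nat) (F : 'I_m -> 'I_n -> 'rV[R]_n),
        (forall j, aff_indep (F j)) /\
        closure Omega `\` Omega = \bigcup_j hull (F j) predT].

(* V j lists the n+1 vertices of the j-th simplex.  As faces may be empty, the
   last clause says that two cells are disjoint or share a common face. *)
Definition simplicial_subdivision (Omega : set 'rV[R]_n) (N : nat)
    (V : 'I_N -> 'I_n.+1 -> 'rV[R]_n) : Prop :=
  [/\ forall j, aff_indep (V j),
      closure Omega = \bigcup_j hull (V j) predT,
      forall j, interior (hull (V j) predT) `<=` Omega,
      injective (fun j => hull (V j) predT) &
      forall i j, exists A B : pred 'I_n.+1,
        hull (V i) predT `&` hull (V j) predT = hull (V i) A /\
        hull (V i) A = hull (V j) B].

End geometry.

Section forms.
Context (R : realType) (n : nat).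

(* An element of the exterior algebra of (R^n)^*, by its coordinates on the
   basis dx^S := dx^(s_1) /\ ... /\ dx^(s_k), S = {s_1 < ... < s_k}. *)
Definition covector := {ffun {set 'I_n} -> R}.

Definition form := 'rV[R]_n -> covector.

Definition of_degree (k : nat) (w : covector) : Prop :=
  forall S : {set 'I_n}, #|S| != k -> w S = 0.

Definition dx (S : {set 'I_n}) : covector := [ffun T => (T == S)%:R].

(* For i not in S, dx^i /\ dx^S = pos_sign i S * dx^(S U {i}); for i in S, i is
   the j-th element of S with (-1)^(j+1) = pos_sign i S. *)
Definition pos_sign (i : 'I_n) (S : {set 'I_n}) : R :=
  (-1) ^+ #|[pred j in S | (j < i)%N]|.

Definition koszul (x : 'rV[R]_n) (w : covector) : covector :=
  \sum_(S : {set 'I_n}) \sum_(i in S)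
    (w S * pos_sign i S * x ord0 i) *: dx (S :\ i)%SET.

(* dx^S /\ dx^(~S) = star_sign S * dx^1 /\ ... /\ dx^n *)
Definition star_sign (S : {set 'I_n}) : R := \prod_(i in S) pos_sign i (~: S)%SET.

Definition hodge_star (w : covector) : covector :=
  \sum_(S : {set 'I_n}) (w S * star_sign S) *: dx (~: S)%SET.

Definition basis_vec (i : 'I_n) : 'rV[R]_n := delta_mx ord0 i.

Definition ext_d (omega : form) : form := fun x =>
  \sum_(S : {set 'I_n}) \sum_(i | i \notin S)
    ('D_(basis_vec i) (fun y => omega y S) x * pos_sign i S) *: dx (i |: S)%SET.

Fixpoint Cn (m : nat) (f : 'rV[R]_n -> R) : Prop :=
  match m with
  | 0 => continuous f
  | m'.+1 => continuous f /\ forall i,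
      (forall x, derivable f x (basis_vec i)) /\ Cn m' ('D_(basis_vec i) f)
  end.

Definition smooth (f : 'rV[R]_n -> R) : Prop := forall m, Cn m f.

End forms.

(* Square-integrable forms are represented by functions on R^n, of which only the
   values almost everywhere in Omega matter; all the sets of forms below are
   closed under modification on a null subset of Omega that preserves
   measurability.  An unbounded or piecewise operator T is represented by its
   graph: T v w means that v is in the domain of T and T v = w almost everywhere
   in Omega. *)

Section spaces.
Context (R : realType) (n : nat) (Omega : set 'rV[R]_n).
Local Notation form := (form R n).
Local Notation mu := (@lebesgue_rV R n).

Definition L2form (k : nat) : set form :=
  [set omega | (forall x, of_degree k (omega x)) /\
     forall S : {set 'I_n}, measurable_fun Omega (fun x => omega x S) /\
       mu.-integrable Omega (fun x => (omega x S ^+ 2)%:E)].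

Definition L2ip (omega eta : form) : R :=
  \int[mu]_(x in Omega) \sum_(S : {set 'I_n}) omega x S * eta x S.

Definition orthogonal (A B : set form) : Prop :=
  forall a b, A a -> B b -> L2ip a b = 0.

Definition ominus (B A : set form) : set form :=
  [set b | B b /\ forall a, A a -> L2ip b a = 0].

(* Orthogonality makes the decomposition unique up to null sets. *)
Definition orth_sum3 (D A B C : set form) : Prop :=
  [/\ D = [set omega | exists a b c,
             [/\ A a, B b, C c & omega = (fun x => a x + b x + c x)]],
      orthogonal A B, orthogonal A C & orthogonal B C].

Definition kernel_in (T : form -> form -> Prop) (D : set form) : set form :=
  [set v | D v /\ T v (fun=> 0)].

Definition range_in (T : form -> form -> Prop) (D : set form) : set form :=
  [set w | exists2 v, D v & T v w].

Definition test_form (k : nat) : set form :=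
  [set phi | [/\ forall x, of_degree k (phi x),
     forall S : {set 'I_n}, smooth (fun x => phi x S) &
     exists K, [/\ compact K, K `<=` Omega & forall x, ~ K x -> phi x = 0]]].

(* Graph of delta_k on L2 k-forms, for k > 0, in the sense of distributions. *)
Definition codiff (k : nat) (eta sigma : form) : Prop :=
  [/\ L2form k eta, L2form k.-1 sigma &
      forall phi, test_form k.-1 phi -> L2ip (ext_d phi) eta = L2ip phi sigma].

Definition Hstar (k : nat) : set form :=
  [set eta | exists sigma, codiff k eta sigma].

(* Closure of the test forms in Hstar k for the graph norm. *)
Definition Hstar0 (k : nat) : set form :=
  [set eta | exists2 sigma, codiff k eta sigma &
     forall e : R, 0 < e -> exists phi tau,
       [/\ test_form k phi, codiff k phi tau &
           Num.sqrt (L2ip (fun x => eta x - phi x) (fun x => eta x - phi x) +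
                     L2ip (fun x => sigma x - tau x) (fun x => sigma x - tau x))
           < e]].

Definition P0 (k : nat) : set form :=
  [set p | exists2 c : covector R n, of_degree k c & p = (fun=> c)].

Definition P1m (k : nat) : set form :=
  [set p | exists c c' : covector R n,
     [/\ of_degree k c, of_degree k.+1 c' & p = (fun x => c + koszul x c')]].

Definition P1sm (k : nat) : set form :=
  [set q | exists2 p, P1m (n - k) p & q = (fun x => hodge_star (p x))].

Context (N : nat) (V : 'I_N -> 'I_n.+1 -> 'rV[R]_n).
Local Notation cell j := (hull (V j) predT).

Definition piecewise (k : nat) (P : set form) : set form :=
  [set omega | L2form k omega /\
     forall j, exists2 p, P p & ae_eq mu (cell j) omega p].

(* Graph of d_h^k on the piecewise P1m k forms. *)
Definition d_h (k : nat) (omega theta : form) : Prop :=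
  [/\ L2form k omega, L2form k.+1 theta &
      forall j, exists p, [/\ P1m k p, ae_eq mu (cell j) omega p &
                              ae_eq mu (cell j) theta (ext_d p)]].

Definition P0h (k : nat) : set form := piecewise k (P0 k).

Definition Wstar (k : nat) : set form := piecewise k (P1sm k) `&` Hstar k.

Definition Wstar0 (k : nat) : set form := piecewise k (P1sm k) `&` Hstar0 k.

Definition Wnc_against (k : nat) (D : set form) : set form :=
  [set omega | piecewise k (P1m k) omega /\
     forall eta sigma theta, D eta -> codiff k.+1 eta sigma ->
       d_h k omega theta -> L2ip omega sigma - L2ip theta eta = 0].

Definition Wnc (k : nat) : set form := Wnc_against k (Wstar0 k.+1).

Definition Wnc0 (k : nat) : set form := Wnc_against k (Wstar k.+1).

(* As for codiff, the degree k.-1 makes the definitions below meaningful only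
   for k > 0. *)

Definition harm_star (k : nat) : set form :=
  ominus (kernel_in (codiff k) (Wstar k))
         (range_in (codiff k.+1) (Wstar k.+1)).

Definition harm_star0 (k : nat) : set form :=
  ominus (kernel_in (codiff k) (Wstar0 k))
         (range_in (codiff k.+1) (Wstar0 k.+1)).

Definition harm_nc (k : nat) : set form :=
  ominus (kernel_in (d_h k) (Wnc k)) (range_in (d_h k.-1) (Wnc k.-1)).

Definition harm_nc0 (k : nat) : set form :=
  ominus (kernel_in (d_h k) (Wnc0 k)) (range_in (d_h k.-1) (Wnc0 k.-1)).

End spaces.

(* Main.v *)
(** On a cell K the Whitney forms are P_1^- = {c + kappa c'} and P_1^{*,-} = {e + (x wedge
a)}, with c, c', e, a constant; there d (c + kappa c') is a nonzero multiple of c',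
and delta (e + x wedge a) a nonzero multiple of a. Hence a piecewise form with
vanishing d_h, or with vanishing delta, is piecewise constant, and every piecewise
constant form is a d_h.

Let D be W*_h or W*_h0 in degree k. If a piecewise constant c is orthogonal to R(d_h,
W^nc) then omega |-> <d_h omega, c> vanishes wherever all the functionals omega |->
<omega, delta eta> - <d_h omega, eta>, eta in D, vanish. By duality in finite
dimension it is one of them: <omega, delta eta> = <d_h omega, eta + c> for all
piecewise Whitney forms omega. Piecewise constant omega give delta eta = 0, so that
eta is piecewise constant; the remaining omega give c = - eta. Thus P_0 = R(d_h, W^nc)
+ N(delta, D), an orthogonal sum, and the theorem follows from delta delta = 0 and
from the definition of W^nc in degree k.

The codifferential of a member of H* is only a distribution. That it is the cellwise
one almost everywhere needs Green's formula for compactly supported smooth functions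
on R^n, and the fact that test forms separate L^2 forms. *)
From HB Require Import structures.
Require Import Defs.
From mathcomp Require Import all_boot all_order all_algebra.
From mathcomp Require Import all_classical all_reals all_analysis.
From mathcomp Require Import measurable_realfun ring lra zify.

Set Implicit Arguments.
Unset Strict Implicit.
Unset Printing Implicit Defensive.

Import Order.TTheory GRing.Theory Num.Theory.
Import numFieldNormedType.Exports.

Local Open Scope classical_set_scope.
Local Open Scope ring_scope.

(** * Lebesgue measure on R^n *)

(** Forms are genuine functions of which only the values almost everywhere in [Omega] count, so
    [codiff] and [d_h] are relations, single-valued up to null sets ([codiff_unique], [d_h_unique]).
    The sets in [orth_sum3] are nevertheless compared exactly: remainders are formed pointwise, as
    omega = a + (omega - a), and equality almost everywhere is used only where membership is stable
    under it. Instead of a positive measure for each cell, the proof uses a dichotomy: either the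
    cell is null, and every claim almost everywhere on it is trivial, or the coefficient in question
    vanishes. The relation delta delta = 0 is the transpose of d d = 0 on test forms; this is where
    the symmetry of second derivatives enters. Both boundary conditions are treated at once: the
    only link between the two degrees is that delta maps the space in degree k+2 into the one in
    degree k+1. Orthogonal projections take place among piecewise constant forms, which up to null
    sets form a Euclidean space of finite dimension. *)

Section cons.
Context (R : realType) (n : nat).
Implicit Types (p : 'rV[R]_n * measurableTypeR R) (x : 'rV[R]_n.+1).

Lemma rV_cons_ord0 p : rV_cons p ord0 ord0 = p.2.
Proof.
rewrite /rV_cons (_ : ord0 = lshift n (ord0 : 'I_1)); last exact/val_inj.
by rewrite (row_mxEl (const_mx p.2 : 'rV_1)) mxE.
Qed.

Lemma rV_cons_lift p j : rV_cons p ord0 (lift ord0 j) = p.1 ord0 j.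
Proof.
rewrite /rV_cons (_ : lift ord0 j = rshift 1 j); last exact/val_inj.
by rewrite (row_mxEr (const_mx p.2 : 'rV_1)).
Qed.

Lemma rV_consP (y : 'rV[R]_n) (t : R) x :
  (x ord0 ord0 = t) -> (forall j, x ord0 (lift ord0 j) = y ord0 j) ->
  rV_cons (y, t) = x.
Proof.
move=> xt xy; apply/rowP => i; have [j|] := unliftP ord0 i.
  by move=> ->; rewrite rV_cons_lift.
by move=> ->; rewrite rV_cons_ord0.
Qed.

End cons.

Section cube.
Context (R : realType).

Definition cube n (M : R) : set 'rV[R]_n :=
  [set x | forall i, -M <= x ord0 i <= M].

Lemma measurable_cube n M : measurable (@cube n M).
Proof.
rewrite (_ : cube _ = \bigcap_(i in @setT 'I_n)
    (fun x : 'rV[R]_n => x ord0 i) @^-1` `[-M, M]%classic); last first.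
  apply/seteqP; split=> x /= h i => [_|]; first by rewrite /= in_itv/=; exact: h.
  by have := h i I; rewrite /= in_itv.
rewrite bigcap_mkcond; apply: fin_bigcap_measurable => //.
move=> i _; case: ifP => // _; rewrite -[X in measurable X]setTI.
exact: measurable_coord.
Qed.

Lemma cube_cover n : \bigcup_k @cube n k%:R = setT.
Proof.
apply/seteqP; split => // x _; pose M := \sum_i `|x ord0 i|.
have M0 : 0 <= M by apply: sumr_ge0.
exists (Num.truncn M).+1 => // i; rewrite -ler_norml.
apply: (@le_trans _ _ M); last exact/ltW/truncnS_gt.
by rewrite /M (bigD1 i)//= lerDl sumr_ge0.
Qed.

Lemma preimage_cons_cube n M :
  @rV_cons R n @^-1` cube M = cube M `*` `[-M, M]%classic.
Proof.
apply/seteqP; split=> -[y t]; rewrite /cube/= in_itv/=.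
  move=> h; split; first by move=> i; have := h (lift ord0 i); rewrite rV_cons_lift.
  by have := h ord0; rewrite rV_cons_ord0.
move=> [h1 h2] i; have [j ->|->] := unliftP ord0 i.
  by rewrite rV_cons_lift; exact: h1.
by rewrite rV_cons_ord0.
Qed.

Lemma lebesgue_cube n M : (@lebesgue_rV R n (cube M) < +oo)%E.
Proof.
elim: n => [|n IH].
  by rewrite /= diracE; case: (_ \in _); rewrite ltry.
rewrite /= /pushforward preimage_cons_cube.
have [m Em] := lebesgue_rV_is_measure R n.
rewrite Em product_measure1E//; last exact: measurable_cube.
have L : (@lebesgue_measure R `[(- M)%R, M]%classic < +oo)%E.
  by rewrite lebesgue_measure_itv/=; case: ifP => _; rewrite ?ltry// -EFinB ltry.
by rewrite -Em; apply: lte_mul_pinfty => //; rewrite ge0_fin_numE.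
Qed.

(** Lets the order of integration be exchanged in the recursive product that defines
    [lebesgue_rV]. *)
Lemma lebesgue_rV_sigma_finite n : sigma_finite setT (@lebesgue_rV R n).
Proof.
exists (fun k : nat => cube k%:R); first by rewrite cube_cover.
by move=> k; split; [exact: measurable_cube|exact: lebesgue_cube].
Qed.

HB.instance Definition _ (n : nat) :=
  Measure_isSigmaFinite.Build _ _ _ (@lebesgue_rV R n) (@lebesgue_rV_sigma_finite n).

End cube.

(** * Topology against the product sigma-algebra *)

Section open_measurable.
Context (R : realType) (n : nat).

Lemma rV_norm_lt (x : 'rV[R]_n) (e : R) : 0 < e ->
  (`|x| < e) <-> (forall i, `|x ord0 i| < e).
Proof.
move=> e0; rewrite (_ : `|x| = mx_norm x)// mx_normrE; split=> [/bigmax_ltP[_ h] i|h].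
  exact: (h (ord0, i) isT).
by apply/bigmax_ltP; split=> //= ij _; rewrite (ord1 ij.1).
Qed.

Lemma rV_norm_le (x : 'rV[R]_n) (e : R) : 0 <= e ->
  (`|x| <= e) <-> (forall i, `|x ord0 i| <= e).
Proof.
move=> e0; rewrite (_ : `|x| = mx_norm x)// mx_normrE; split=> [/bigmax_leP[_ h] i|h].
  exact: (h (ord0, i) isT).
by apply/bigmax_leP; split=> //= ij _; rewrite (ord1 ij.1).
Qed.

Lemma rV_coord_le (x : 'rV[R]_n) i : `|x ord0 i| <= `|x|.
Proof. by have [h _] := @rV_norm_le x `|x| (normr_ge0 x); exact: h. Qed.

Definition cbox (a b : 'rV[R]_n) : set 'rV[R]_n :=
  [set x | forall i, a ord0 i <= x ord0 i <= b ord0 i].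

Definition obox (a b : 'rV[R]_n) : set 'rV[R]_n :=
  [set x | forall i, a ord0 i < x ord0 i < b ord0 i].

Lemma measurable_obox a b : measurable (obox a b).
Proof.
rewrite (_ : obox _ _ = \bigcap_(i in @setT 'I_n)
    (fun x : 'rV[R]_n => x ord0 i) @^-1` `]a ord0 i, b ord0 i[%classic); last first.
  apply/seteqP; split=> x /= h i => [_|]; first by rewrite /= in_itv/=; exact: h.
  by have := h i I; rewrite /= in_itv.
rewrite bigcap_mkcond; apply: fin_bigcap_measurable => //.
move=> i _; case: ifP => // _; rewrite -[X in measurable X]setTI.
exact: measurable_coord.
Qed.

Definition rat_rV (q : 'rV[rat]_n) : 'rV[R]_n := map_mx ratr q.

(** The norm is the maximum norm, so a ball is a cube, and rational corners are chosen coordinate by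
    coordinate. The closed box is kept inside [U] because it will be the compact support of a test
    function. *)
Lemma open_rat_box (U : set 'rV[R]_n) (x : 'rV[R]_n) : open U -> U x ->
  exists q : 'rV[rat]_n * 'rV[rat]_n,
    obox (rat_rV q.1) (rat_rV q.2) x /\
    cbox (rat_rV q.1) (rat_rV q.2) `<=` U.
Proof.
rewrite openE => /(_ x) /[apply]; rewrite /interior => /nbhs_ballP[e /= e0 xU].
have lo i : exists q : rat, x ord0 i - e / 2 < ratr q < x ord0 i.
  have /(@rat_in_itvoo R)[q] : x ord0 i - e / 2 < x ord0 i by lra.
  by rewrite in_itv/=; exists q.
have hi i : exists q : rat, x ord0 i < ratr q < x ord0 i + e / 2.
  have /(@rat_in_itvoo R)[q] : x ord0 i < x ord0 i + e / 2 by lra.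
  by rewrite in_itv/=; exists q.
exists (\row_i xchoose (lo i), \row_i xchoose (hi i)); split=> [i|y xy] /=.
  rewrite !mxE; have /andP[_ ->] := xchooseP (lo i).
  by have /andP[-> _] := xchooseP (hi i).
apply: xU; rewrite -ball_normE /ball_/=; apply/rV_norm_lt => // i.
have := xy i; rewrite /= !mxE.
have /andP[h1 _] := xchooseP (lo i); have /andP[_ h2] := xchooseP (hi i).
by move=> /andP[h3 h4]; rewrite ltr_norml; apply/andP; split; lra.
Qed.

Lemma open_bigcup_rat_box (U : set 'rV[R]_n) : open U ->
  U = \bigcup_(q in [set q : 'rV[rat]_n * 'rV[rat]_n |
      cbox (rat_rV q.1) (rat_rV q.2) `<=` U])
    obox (rat_rV q.1) (rat_rV q.2).
Proof.
move=> oU; apply/seteqP; split=> [x /(open_rat_box oU)[q [h1 h2]]|x [q /= h1 h2]].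
  by exists q.
by apply: h1 => i; have /andP[/ltW -> /ltW ->] := h2 i.
Qed.

(** The sigma-algebra is generated by the coordinates, not by the open sets; countably many rational
    boxes bridge the two. *)
Lemma open_measurable_rV (U : set 'rV[R]_n) : open U -> measurable U.
Proof.
move=> /open_bigcup_rat_box ->; rewrite bigcup_mkcond.
apply: countable_bigcupT_measurable => [|q]; first exact: countableP.
by case: ifP => // _; exact: measurable_obox.
Qed.

Lemma continuous_measurable_rV (f : 'rV[R]_n -> R) (D : set 'rV[R]_n) :
  continuous f -> measurable_fun D f.
Proof.
move=> cf; apply: measurable_funTS.
apply: (measurability _ (measurable_realfun.RGenOpens.measurableE R)).
move=> _ [_ [a [b ->] <-]]; rewrite setTI; apply: open_measurable_rV.
by move/continuousP : cf; apply; exact: interval_open.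
Qed.

Lemma bounded_lebesgue (A : set 'rV[R]_n) : bounded_set A -> measurable A ->
  (@lebesgue_rV R n A < +oo)%E.
Proof.
move=> [M [Mreal AM]] mA.
apply: (@le_lt_trans _ _ (@lebesgue_rV R n (cube (M + 1)))); last exact: lebesgue_cube.
apply: le_measure; rewrite ?inE//; first exact: measurable_cube.
move=> x Ax i; rewrite -ler_norml; apply: le_trans (rV_coord_le _ _) _.
by apply: (AM (M + 1)) => //; rewrite ltrDl.
Qed.

End open_measurable.

(** * Divergence theorem for compactly supported functions *)

Section line.
Context (R : realType) (V : normedModType R).

(** The restriction of [f] to a line has literally the same difference quotients, so derivability
    and derivative transfer by rewriting under the limit, with no regularity of [f]. *)
Lemma line_quotient (f : V -> R) (x v : V) (t h : R) :
  h^-1 *: (((fun s : R => f (s *: v + x)) \o shift t) (h *: 1) - f (t *: v + x)) =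
  h^-1 *: ((f \o shift (t *: v + x)) (h *: v) - f (t *: v + x)).
Proof. by rewrite /= addrA -scalerDl [h *: 1]mulr1. Qed.

Lemma derive_line (f : V -> R) (x v : V) (t : R) :
  'D_1 (fun s : R => f (s *: v + x)) t = 'D_v f (t *: v + x).
Proof. by rewrite /derive; under eq_fun do rewrite line_quotient. Qed.

Lemma derivable_line (f : V -> R) (x v : V) (t : R) :
  derivable f (t *: v + x) v -> derivable (fun s : R => f (s *: v + x)) t 1.
Proof. by rewrite /derivable; under [in X in _ -> X]eq_fun do rewrite line_quotient. Qed.

Lemma derivable1_continuous (f : R -> R) t : derivable f t 1 -> {for t, continuous f}.
Proof. by move=> /derivable1_diffP /differentiable_continuous. Qed.

End line.

Section rV_topology.
Context (R : realType) (n : nat).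

Lemma rV_cvg (T : Type) (F : set_system T) (FF : Filter F) (u : T -> 'rV[R]_n)
    (l : 'rV[R]_n) :
  (forall i, u x ord0 i @[x --> F] --> l ord0 i) -> u x @[x --> F] --> l.
Proof.
move=> h; apply/cvgrPdist_lt => e e0.
have : \forall x \near F, forall i, `|l ord0 i - u x ord0 i| < e.
  by apply: filter_forall => i; move/cvgrPdist_lt : (h i); exact.
by apply: filterS => x hx; apply/rV_norm_lt => // i; rewrite !mxE.
Qed.

Lemma rV_continuous (T : topologicalType) (u : T -> 'rV[R]_n) :
  (forall i, continuous (fun x => u x ord0 i)) -> continuous u.
Proof. by move=> h x; apply: rV_cvg => i; exact: h. Qed.

Lemma closed_cube (M : R) : closed (@cube R n M).
Proof.
rewrite (_ : cube _ = \bigcap_i [set x : 'rV[R]_n | x ord0 i \in `[-M, M]]); last first.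
  apply/seteqP; split=> x /= h i => [_|]; first by rewrite /= in_itv/=; exact: h.
  by have := h i I; rewrite /= in_itv.
apply: closed_bigI => i _.
apply: (@closed_comp _ _ (fun x : 'rV[R]_n => x ord0 i) `[-M, M]%classic).
  by move=> x _; exact: coord_continuous.
exact: interval_closed.
Qed.

Lemma compact_cube (M : R) : compact (@cube R n M).
Proof.
apply: bounded_closed_compact; last exact: closed_cube.
exists `|M|; split => // N MN x xM /=; apply/rV_norm_le.
  by apply: le_trans (ltW MN).
move=> i; apply: (@le_trans _ _ M); first by rewrite ler_norml; exact: xM.
by apply: le_trans (ltW MN); exact: ler_norm.
Qed.

Lemma bounded_cube (A : set 'rV[R]_n) : bounded_set A -> exists M, A `<=` cube M.
Proof.
move=> [M [Mr AM]]; exists (M + 1) => x Ax i; rewrite -ler_norml.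
apply: le_trans (rV_coord_le _ _) _.
by apply: (AM (M + 1)) => //; rewrite ltrDl.
Qed.

End rV_topology.

(** * Hyperplanes are null sets *)

Section hyperplane.
Context (R : realType).

Definition lin n (a x : 'rV[R]_n) : R := \sum_i a ord0 i * x ord0 i.

Lemma measurable_lin n (a : 'rV[R]_n) : measurable_fun setT (lin a).
Proof.
apply: measurable_sum => i; apply: measurable_funM => //; exact: measurable_coord.
Qed.

Lemma measurable_hyperplane n (a : 'rV[R]_n) b : measurable [set x | lin a x = b].
Proof.
rewrite (_ : [set _ | _] = lin a @^-1` [set b]); last by [].
by rewrite -[X in measurable X]setTI; exact: measurable_lin.
Qed.

Lemma lin_cons n (a : 'rV[R]_n.+1) (y : 'rV[R]_n) (t : R) :
  lin a (rV_cons (y, t)) = a ord0 ord0 * t + lin (\row_j a ord0 (lift ord0 j)) y.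
Proof.
rewrite /lin big_ord_recl rV_cons_ord0; congr (_ + _).
by apply: eq_bigr => i _; rewrite rV_cons_lift mxE.
Qed.

(** Induction on the dimension. If the front coefficient is 0, the hyperplane is a cylinder over a
    hyperplane of lower dimension; otherwise each line in the front direction meets it in one
    point. *)
Lemma hyperplane_null n (a : 'rV[R]_n) b : a != 0 ->
  @lebesgue_rV R n [set x | lin a x = b] = 0%E.
Proof.
elim: n a => [|n IH] a; first by rewrite thinmx0 eqxx.
move=> a0 /=; rewrite /pushforward.
have [m Em] := lebesgue_rV_is_measure R n.
have mA : measurable (@rV_cons R n @^-1` [set x | lin a x = b]).
  rewrite -[X in measurable X]setTI; apply: measurable_rV_cons => //.
  exact: measurable_hyperplane.
pose a' : 'rV[R]_n := \row_j a ord0 (lift ord0 j).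
have [a00|a00] := eqVneq (a ord0 ord0) 0.
  have a'0 : a' != 0.
    apply: contraNneq a0 => a'0; apply/eqP/rowP => i; rewrite mxE.
    have [j ->|->//] := unliftP ord0 i.
    by move/rowP : a'0 => /(_ j); rewrite !mxE.
  rewrite (_ : _ @^-1` _ = [set y | lin a' y = b] `*` setT); last first.
    apply/seteqP; split=> -[y t] /=; rewrite lin_cons a00 mul0r add0r//.
    by case.
  rewrite Em product_measure1E//; last exact: measurable_hyperplane.
  (* The other factor is the whole line, of infinite measure: the convention 0 * oo = 0 is used. *)
  by rewrite -Em IH// mul0e.
rewrite /product_measure1/=; apply: integral0_eq => y _.
rewrite (_ : xsection _ _ = [set (b - lin a' y) / a ord0 ord0]).
  exact: lebesgue_measure_set1.
apply/seteqP; split=> t /=; rewrite /xsection/= inE/= lin_cons -/a'.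
  by move=> <-; rewrite addrK mulrAC mulfV// mul1r.
by move=> ->; rewrite mulrCA mulfV// mulr1 subrK.
Qed.

End hyperplane.

Section null_derivative.
Context (R : realType).
Local Notation mu := (@lebesgue_rV R _).

Lemma bounded_support_integrable d (T : measurableType d)
    (m : {measure set T -> \bar R}) (A : set T) (f : T -> R) (C : R) :
  measurable A -> (m A < +oo)%E -> measurable_fun setT f ->
  (forall x, `|f x| <= C) -> (forall x, ~ A x -> f x = 0) ->
  m.-integrable setT (EFin \o f).
Proof.
move=> mA Afin mf fC f0.
rewrite (_ : EFin \o f = (EFin \o f) \_ A); last first.
  apply/funext => x; rewrite patchE; case: ifPn => //.
  by rewrite notin_setE /= => /f0 ->.
apply/(integrable_mkcond _ mA); apply: measurable_bounded_integrable => //.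
  exact: measurable_funTS.
by exists C; split=> [|M CM x _]; [exact: num_real|exact: le_trans (fC _) (ltW CM)].
Qed.

(** Both orders of integration are recorded: the direction of a derivative decides which variable
    has to be integrated first. *)
Lemma integral_rV_cons n (g : 'rV[R]_n.+1 -> R) (M C : R) :
  measurable_fun setT g -> (forall x, `|g x| <= C) ->
  (forall x, ~ cube M x -> g x = 0) ->
  (\int[@lebesgue_rV R n.+1]_x (g x)%:E =
   \int[@lebesgue_rV R n]_y \int[@lebesgue_measure R]_t (g (rV_cons (y, t)))%:E)%E /\
  (\int[@lebesgue_rV R n.+1]_x (g x)%:E =
   \int[@lebesgue_measure R]_t \int[@lebesgue_rV R n]_y (g (rV_cons (y, t)))%:E)%E.
Proof.
move=> mg gC g0.
pose pm : {measure set _ -> \bar R} := (@lebesgue_rV R n \x @lebesgue_measure R)%E.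
have ig : pm.-integrable setT (EFin \o (g \o @rV_cons R n)).
  apply: (@bounded_support_integrable _ _ pm (@rV_cons R n @^-1` cube M) _ C) => //.
  - rewrite -[X in measurable X]setTI; apply: measurable_rV_cons => //.
    exact: measurable_cube.
  - exact: (lebesgue_cube n.+1 M).
  - by apply: measurableT_comp => //; exact: measurable_rV_cons.
  - by move=> x; exact: gC.
  - by move=> x Kx; exact: g0.
have E : (\int[@lebesgue_rV R n.+1]_x (g x)%:E = \int[pm]_z (g (rV_cons z))%:E)%E.
  have mg' : measurable_fun setT (EFin \o g) by exact/measurable_EFinP.
  exact: (integral_pushforward (@measurable_rV_cons R n) (mu := pm) mg' ig measurableT).
rewrite E; split; first by rewrite -(integral12_prod_meas1 ig).
by rewrite -(integral21_prod_meas1 ig).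
Qed.

Lemma rV_cons_shift n (y v : 'rV[R]_n) (h t : R) :
  rV_cons (h *: v + y, t) = h *: (rV_cons (v, 0)) + rV_cons (y, t).
Proof.
apply/rowP => i; rewrite [RHS]mxE [X in _ = X + _]mxE.
have [j ->|->] := unliftP ord0 i; first by rewrite !rV_cons_lift !mxE.
by rewrite !rV_cons_ord0 mulr0 add0r.
Qed.

Lemma rV_cons_basis n (j : 'I_n) :
  rV_cons (basis_vec R j, 0) = basis_vec R (lift ord0 j).
Proof.
by apply: rV_consP => [|k]; rewrite !mxE.
Qed.

Lemma rV_cons_line n (y : 'rV[R]_n) (t : R) :
  rV_cons (y, t) = t *: basis_vec R ord0 + rV_cons (y, 0).
Proof.
apply: rV_consP => [|k]; rewrite mxE [X in X + _]mxE.
  by rewrite rV_cons_ord0 mxE mulr1 addr0.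
by rewrite rV_cons_lift mxE mulr0 add0r.
Qed.

Lemma continuous_rV_cons_l n (t : R) : continuous (fun y : 'rV[R]_n => rV_cons (y, t)).
Proof.
apply: rV_continuous => i; have [j ->|->] := unliftP ord0 i.
  by under eq_fun do rewrite rV_cons_lift; exact: coord_continuous.
by under eq_fun do rewrite rV_cons_ord0; exact: cst_continuous.
Qed.

Lemma continuous_rV_cons_r n (y : 'rV[R]_n) : continuous (fun t : R => rV_cons (y, t)).
Proof.
apply: rV_continuous => i; have [j ->|->] := unliftP ord0 i.
  by under eq_fun do rewrite rV_cons_lift; exact: cst_continuous.
by under eq_fun do rewrite rV_cons_ord0; move=> x; exact: cvg_id.
Qed.

(** The complement of [K] is open, so [f] vanishes near the point and not only at it. *)
Lemma derive_supp n (f : 'rV[R]_n -> R) (K : set 'rV[R]_n) v x : closed K ->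
  (forall x, ~ K x -> f x = 0) -> ~ K x -> 'D_v f x = 0.
Proof.
move=> cK f0 Kx; rewrite (@near_eq_derive _ _ _ f (cst 0)) ?derive_cst//.
by apply: filterS (closed_openC cK x Kx) => z; exact: f0.
Qed.

Lemma compact_supp_bounded n (g : 'rV[R]_n -> R) (M : R) : continuous g ->
  (forall x, ~ cube M x -> g x = 0) -> exists C, forall x, `|g x| <= C.
Proof.
move=> cg g0.
have [N [_ gN]] := compact_bounded (continuous_compact (continuous_subspaceT cg) (@compact_cube R n M)).
exists (`|N| + 1) => x; have [xM|xM] := pselect (cube M x).
  apply: (gN (`|N| + 1)); last by exists x.
  by rewrite (le_lt_trans (ler_norm N))// ltrDl.
by rewrite g0// normr0 addr_ge0.
Qed.

(** Induction on the dimension. A derivative along the front coordinate is integrated first in that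
    variable, by the fundamental theorem of calculus; for any other direction the inner integral
    over a slice vanishes by induction. *)
Lemma integral_derive0 n (i : 'I_n) (f : 'rV[R]_n -> R) (M : R) :
  (forall x, derivable f x (basis_vec R i)) ->
  continuous ('D_(basis_vec R i) f) ->
  (forall x, ~ cube M x -> f x = 0) ->
  (\int[@lebesgue_rV R n]_x ('D_(basis_vec R i) f x)%:E = 0)%E.
Proof.
elim: n i f => [[]//|n IH] i f df cdf f0.
have g0 x : ~ cube M x -> 'D_(basis_vec R i) f x = 0.
  by apply: derive_supp f0; exact: closed_cube.
have [C gC] := compact_supp_bounded cdf g0.
have mg : measurable_fun setT ('D_(basis_vec R i) f) by exact: continuous_measurable_rV.
have [E1 E2] := integral_rV_cons mg gC g0.
have [j ij|i0] := unliftP ord0 i.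
  rewrite E2; apply: integral0_eq => t _.
  have Q y h : h^-1 *: (((fun y => f (rV_cons (y, t))) \o shift y) (h *: basis_vec R j) -
       f (rV_cons (y, t))) =
     h^-1 *: ((f \o shift (rV_cons (y, t))) (h *: basis_vec R i) - f (rV_cons (y, t))).
    by rewrite /= rV_cons_shift rV_cons_basis -ij.
  have Dq y : 'D_(basis_vec R i) f (rV_cons (y, t)) =
      'D_(basis_vec R j) (fun y => f (rV_cons (y, t))) y.
    by rewrite /derive; under [in RHS]eq_fun do rewrite Q.
  under eq_integral do rewrite Dq.
  apply: IH.
  - move=> y; have := df (rV_cons (y, t)); rewrite /derivable.
    by under [in X in _ -> X]eq_fun do rewrite Q.
  - rewrite (_ : 'D__ _ = 'D_(basis_vec R i) f \o (fun y => rV_cons (y, t))).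
      by move=> y; apply: continuous_comp; [exact: continuous_rV_cons_l|exact: cdf].
    by apply/funext => y /=; rewrite Dq.
  - move=> y yM; apply: f0 => h; apply: yM => k.
    by have := h (lift ord0 k); rewrite rV_cons_lift.
rewrite E1; apply: integral0_eq => y _.
pose F t := f (rV_cons (y, t)).
have FE : F = fun t => f (t *: basis_vec R i + rV_cons (y, 0)).
  by apply/funext => t; rewrite /F rV_cons_line i0.
have dF t : derivable F t 1 by rewrite FE; exact/derivable_line.
have DF t : 'D_1 F t = 'D_(basis_vec R i) f (rV_cons (y, t)).
  by rewrite FE derive_line (rV_cons_line _ t) i0.
have out t : t \notin `[-M, M] -> ~ cube M (rV_cons (y, t)).
  by move=> tM h; have := h ord0; rewrite rV_cons_ord0/=; rewrite in_itv/= in tM; exact/negP.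
(* Strictly larger than [M], so that the primitive vanishes at both ends of [-L, L]; the absolute
   value keeps the interval nondegenerate when [M] is negative. *)
pose L := `|M| + 1.
have ML : M < L by rewrite /L (le_lt_trans (ler_norm M))// ltrDl.
have L0 : - L < L by rewrite /L; have := normr_ge0 M; lra.
transitivity (\int[lebesgue_measure]_(t in `[(- L)%R, L]%classic)
    ('D_(basis_vec R i) f (rV_cons (y, t)))%:E)%E.
  rewrite [RHS]integral_mkcond; apply: eq_integral => t _.
  rewrite patchE; case: ifPn => // tL; rewrite g0//; apply: out.
  apply: contra tL; rewrite inE/= !in_itv/= => /andP[t1 t2].
  by apply/andP; split; lra.
rewrite (@continuous_FTC2 _ _ F)//.
- rewrite /F !f0 ?subee//; apply: out; rewrite in_itv/=; apply/negP => /andP[]; lra.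
- apply: continuous_subspaceT => t.
  apply: (@continuous_comp _ _ _ (fun t => rV_cons (y, t)) ('D_(basis_vec R i) f)).
    exact: continuous_rV_cons_r.
  exact: cdf.
- split; first by move=> t _; exact: dF.
  + by exact: (cvg_at_right_filter (derivable1_continuous (dF _))).
  + by exact: (cvg_at_left_filter (derivable1_continuous (dF _))).
- by move=> t _; rewrite derive1E DF.
Qed.

End null_derivative.

(** * Smooth functions *)

Section Cn_theory.
Context (R : realType) (n : nat).
Implicit Types (f g : 'rV[R]_n -> R) (m : nat).
Local Notation e_ := (basis_vec R).

Lemma CnW m f : Cn m.+1 f -> Cn m f.
Proof.
elim: m f => [|m IH] f [cf df] //; split=> // i.
by split; [exact: (df i).1|apply: IH; exact: (df i).2].
Qed.

Lemma smooth_continuous f : smooth f -> continuous f.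
Proof. by move=> /(_ 0%N). Qed.

Lemma smooth_derivable f i x : smooth f -> derivable f x (e_ i).
Proof. by move=> /(_ 1%N)[_ /(_ i)[]]. Qed.

Lemma smooth_derive f i : smooth f -> smooth ('D_(e_ i) f).
Proof. by move=> sf m; have [_ /(_ i)[]] := sf m.+1. Qed.

Lemma Cn_cst m (c : R) : Cn m (fun _ : 'rV[R]_n => c).
Proof.
elim: m c => [|m IH] c; first exact: cst_continuous.
split=> [|i]; first exact: cst_continuous.
split=> [x|]; first exact: derivable_cst.
rewrite (_ : 'D__ _ = fun=> 0); first exact: IH.
by apply/funext => x; rewrite derive_cst.
Qed.

Lemma CnD m f g : Cn m f -> Cn m g -> Cn m (fun x => f x + g x).
Proof.
elim: m f g => [|m IH] f g; first by move=> /= cf cg x; exact: (cvgD (cf x) (cg x)).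
move=> [cf df] [cg dg]; split=> [x|i]; first by exact: (cvgD (cf x) (cg x)).
split=> [x|]; first by exact: (derivableD ((df i).1 x) ((dg i).1 x)).
rewrite (_ : 'D__ _ = fun x => 'D_(e_ i) f x + 'D_(e_ i) g x).
  by apply: IH; [exact: (df i).2|exact: (dg i).2].
by apply/funext => x; exact: (deriveD ((df i).1 x) ((dg i).1 x)).
Qed.

Lemma CnM m f g : Cn m f -> Cn m g -> Cn m (fun x => f x * g x).
Proof.
elim: m f g => [|m IH] f g; first by move=> /= cf cg x; exact: (cvgM (cf x) (cg x)).
move=> Cf Cg; have [cf df] := Cf; have [cg dg] := Cg.
split=> [x|i]; first by exact: (cvgM (cf x) (cg x)).
split=> [x|]; first by exact: (derivableM ((df i).1 x) ((dg i).1 x)).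
rewrite (_ : 'D__ _ = fun x => f x * 'D_(e_ i) g x + g x * 'D_(e_ i) f x).
  by apply: CnD; apply: IH; (exact: CnW || exact: (df i).2 || exact: (dg i).2).
by apply/funext => x; rewrite (@deriveM _ _ f g)//; [exact: (df i).1|exact: (dg i).1].
Qed.

Lemma Cn_coord m j : Cn m (fun x : 'rV[R]_n => x ord0 j).
Proof.
have D (x v : 'rV[R]_n) : is_derive x v (fun x : 'rV[R]_n => x ord0 j) (v ord0 j).
  have Q (h : R) : h != 0 -> h^-1 *: (((fun x : 'rV[R]_n => x ord0 j) \o shift x) (h *: v) - x ord0 j) = v ord0 j.
    by move=> h0; rewrite /= !mxE addrK [_ *: _]mulrA mulVf// mul1r.
  have C : h^-1 *: (((fun x : 'rV[R]_n => x ord0 j) \o shift x) (h *: v) - x ord0 j) @[h --> 0^'] --> v ord0 j.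
    have K : (fun _ : R => v ord0 j) h @[h --> 0^'] --> v ord0 j by exact: cvg_cst.
    apply: cvg_trans K; apply: near_eq_cvg; near=> h.
    by rewrite Q//; near: h; exact: nbhs_dnbhs_neq.
  by apply: DeriveDef; [apply/cvg_ex; exists (v ord0 j)|exact: cvg_lim C].
case: m => [|m]; first by move=> x; exact: coord_continuous.
split=> [x|i]; first exact: coord_continuous.
split=> [x|]; first by case: (D x (e_ i)).
rewrite (_ : 'D__ _ = fun=> e_ i ord0 j); first exact: Cn_cst.
by apply/funext => x; apply: derive_val.
Unshelve. all: by end_near. Qed.

Lemma smooth_cst (c : R) : smooth (fun _ : 'rV[R]_n => c).
Proof. by move=> m; exact: Cn_cst. Qed.

Lemma smooth_coord j : smooth (fun x : 'rV[R]_n => x ord0 j).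
Proof. by move=> m; exact: Cn_coord. Qed.

Lemma smoothD f g : smooth f -> smooth g -> smooth (fun x => f x + g x).
Proof. by move=> sf sg m; apply: CnD. Qed.

Lemma smoothM f g : smooth f -> smooth g -> smooth (fun x => f x * g x).
Proof. by move=> sf sg m; apply: CnM. Qed.

Lemma smooth_sum (I : Type) (r : seq I) (P : pred I) (F : I -> 'rV[R]_n -> R) :
  (forall i, P i -> smooth (F i)) -> smooth (fun x => \sum_(i <- r | P i) F i x).
Proof.
move=> sF; elim: r => [|i r IH].
  by under eq_fun do rewrite big_nil; exact: smooth_cst.
under eq_fun do rewrite big_cons; case: (boolP (P i)) => // Pi.
by apply: smoothD => //; exact: sF.
Qed.

Lemma smooth_prod (I : Type) (r : seq I) (P : pred I) (F : I -> 'rV[R]_n -> R) :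
  (forall i, P i -> smooth (F i)) -> smooth (fun x => \prod_(i <- r | P i) F i x).
Proof.
move=> sF; elim: r => [|i r IH].
  by under eq_fun do rewrite big_nil; exact: smooth_cst.
under eq_fun do rewrite big_cons; case: (boolP (P i)) => // Pi.
by apply: smoothM => //; exact: sF.
Qed.

(** [Cn] speaks of partial derivatives only, so the chain rule is obtained for one direction by
    restricting to the line through [x], where the one-variable rule applies. *)
Lemma derive_comp1 (h : R -> R) f (x v : 'rV[R]_n) (a : R) :
  is_derive (f x) 1 h a -> derivable f x v ->
  is_derive x v (h \o f) (a * 'D_v f x).
Proof.
move=> dh df.
have x0 : 0 *: v + x = x by rewrite scale0r add0r.
have df' : is_derive (0 : R) 1 (fun s : R => f (s *: v + x)) ('D_v f x).
  apply: DeriveDef; first by apply: derivable_line; rewrite x0.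
  by rewrite derive_line x0.
have dh' : is_derive (f (0 *: v + x)) 1 h a by rewrite x0.
have [d1 d2] : derivable (fun s : R => (h \o f) (s *: v + x)) 0 1 /\
    'D_1 (fun s : R => (h \o f) (s *: v + x)) 0 = a * 'D_v f x.
  by case: (@is_derive1_comp _ h (fun s : R => f (s *: v + x)) 0 _ _ dh' df').
rewrite derive_line x0 in d2; apply: DeriveDef => //.
move: d1; rewrite /derivable.
by under [in X in X -> _]eq_fun do rewrite line_quotient x0.
Qed.

End Cn_theory.

(** * Smooth bump functions supported in boxes *)

Section bump.
Context (R : realType).

(* bump 0 is smooth, and every derivative of it is a combination of the bump k *)
Definition bump (k : nat) (s : R) : R :=
  if 0 < s then s^-1 ^+ k * expR (- s^-1) else 0.

Lemma bump_le0 k s : s <= 0 -> bump k s = 0.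
Proof. by move=> s0; rewrite /bump ltNge s0. Qed.

Lemma bump_ge0 k s : 0 <= bump k s.
Proof.
rewrite /bump; case: ifPn => // s0.
by rewrite mulr_ge0 ?expR_ge0// exprn_ge0// invr_ge0 ltW.
Qed.

Lemma bump0_le1 s : bump 0 s <= 1.
Proof.
rewrite /bump; case: ifPn => // s0; rewrite expr0 mul1r.
by rewrite -[leRHS]expR0 ler_expR oppr_le0 invr_ge0 ltW.
Qed.

(** With u = 1/s, the bound exp u >= u^(k+1) / (k+1)! gives u^k exp(-u) <= (k+1)! / u. *)
Lemma bump_le k s : bump k s <= (k.+1)`!%:R * `|s|.
Proof.
rewrite /bump; case: ifPn => [s0|_]; last by rewrite mulr_ge0.
have si0 : 0 <= s^-1 by rewrite invr_ge0 ltW.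
have := expR_ge1Dxn k si0; set u := s^-1; set e := expR u; set F := _%:R => H.
have F0 : 0 < F by rewrite ltr0n fact_gt0.
have u0 : 0 < u by rewrite invr_gt0.
have H' : u ^+ k.+1 <= F * e.
  rewrite mulrC -ler_pdivrMr//; apply: le_trans H; by rewrite lerDr.
rewrite (gtr0_norm s0) expRN -/e -[s]invrK -/u.
rewrite ler_pdivrMr ?expR_gt0// mulrAC ler_pdivlMr// -exprSr.
by [].
Qed.

Lemma bump_cvg0 k : bump k s @[s --> (0 : R)] --> (0 : R).
Proof.
apply/cvgrPdist_le => e e0.
pose C : R := (k.+1)`!%:R.
have C0 : 0 < C by rewrite ltr0n fact_gt0.
near=> s; rewrite sub0r normrN ger0_norm ?bump_ge0//.
apply: le_trans (bump_le k s) _; rewrite mulrC -ler_pdivlMr//.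
apply/ltW; near: s; exists (e / C); first by rewrite /= divr_gt0.
by move=> y /=; rewrite sub0r normrN.
Unshelve. all: by end_near. Qed.

Lemma is_derive_bump k (s : R) :
  is_derive s 1 (bump k) (- k%:R * bump k.+1 s + bump k.+2 s).
Proof.
have [s0|s0|->] := ltgtP s 0.
- rewrite !bump_le0 ?(ltW s0)// mulr0 addr0.
  apply: (@near_eq_is_derive _ _ _ (cst 0)).
  by near=> t; rewrite bump_le0//= ltW//; near: t; exact: lt_nbhsl.
- pose F t : R := (t ^-1) ^+ k * expR (- t^-1).
  apply: (@near_eq_is_derive _ _ _ F).
    near=> t; rewrite /bump ifT//; near: t; exact: lt_nbhsr.
  have sn0 : s != 0 by rewrite gt_eqF.
  have dI : is_derive s 1 (fun t : R => t^-1) (- s ^- 2).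
    have := @is_deriveV R id s 1 1 sn0 (is_derive_id s 1).
    by rewrite [_ *: 1]mulr1.
  have dX := @is_deriveX _ _ (fun t : R => t^-1) k s 1 _ dI.
  have dN := is_deriveN dI.
  have dE := @is_derive1_comp R expR (- (fun t : R => t^-1)) s _ _ (is_derive_expR _) dN.
  have := is_deriveM dX dE.
  have -> : (fun t : R => t^-1) ^+ k * (expR \o - (fun t => t^-1)) = F.
    by apply/funext => t; rewrite /F !fctE.
  move=> H; apply: (@is_derive_eq _ _ _ _ _ _ _ _ H).
  rewrite /bump s0 !fctE /=.
  have -> : - s^-2 = - (s^-1)^+2 by rewrite exprVn.
  set u := s^-1; set e := expR _.
  rewrite /GRing.scale/=.
  (* The power rule involves the predecessor of [k], hence the separate case 0. *)
  case: k {dX dE H F} => [|k]; first by rewrite /=; ring.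
  rewrite /= -mulr_natl !exprS; ring.
(* At 0 the difference quotient of [bump k] is [bump k.+1], which tends to 0. *)
- rewrite !bump_le0// mulr0 addr0.
  have C : h^-1 *: ((bump k \o shift 0) (h *: 1) - bump k 0) @[h --> 0^'] --> (0 : R).
    have B : bump k.+1 h @[h --> 0^'] --> (0 : R).
      by apply: cvg_within_filter; exact: bump_cvg0.
    apply: cvg_trans B; apply: near_eq_cvg; near=> h.
    rewrite /= (bump_le0 _ (lexx 0)) subr0 addr0 [h *: 1]mulr1 /bump.
    case: ifPn => _; last by rewrite scaler0.
    by rewrite [_ *: _]mulrA exprS.
  by apply: DeriveDef; [apply/cvg_ex; exists 0|exact: cvg_lim C].
Unshelve. all: by end_near. Qed.

Lemma continuous_bump k : continuous (bump k).
Proof. by move=> s; apply: derivable1_continuous; case: (is_derive_bump k s). Qed.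

(** The induction on the order of differentiation is for all [k] together, since differentiating
    [bump k] produces [bump k.+1] and [bump k.+2]. *)
Lemma smooth_bump n k (f : 'rV[R]_n -> R) : smooth f -> smooth (bump k \o f).
Proof.
move=> sf m; elim: m k => [|m IH] k.
  by move=> x; apply: continuous_comp; [exact: smooth_continuous|exact: continuous_bump].
split=> [x|i].
  by apply: continuous_comp; [exact: smooth_continuous|exact: continuous_bump].
have D x := derive_comp1 (is_derive_bump k (f x)) (@smooth_derivable _ _ f i x sf).
split=> [x|]; first by case: (D x).
rewrite (_ : 'D__ _ = fun x => (- k%:R * (bump k.+1 \o f) x + (bump k.+2 \o f) x)
     * 'D_(basis_vec R i) f x).
  apply: CnM; last exact: smooth_derive.
  by apply: CnD => //; apply: CnM => //; exact: Cn_cst.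
by apply/funext => x; apply: derive_val.
Qed.

Section box_bump.
Context (n : nat) (a b : 'rV[R]_n).

(** For a <= b the quadratic is positive exactly strictly between the two faces. The factor [m]
    drives the values to 1 there, so these functions increase from smooth bumps to the indicator of
    the open box. *)
Definition box_bump (m : nat) (x : 'rV[R]_n) : R :=
  \prod_i bump 0 (m%:R * ((x ord0 i - a ord0 i) * (b ord0 i - x ord0 i))).

Lemma smooth_box_bump m : smooth (box_bump m).
Proof.
apply: smooth_prod => i _.
apply: (@smooth_bump n 0 (fun x => m%:R * ((x ord0 i - a ord0 i) * (b ord0 i - x ord0 i)))).
apply: smoothM; first exact: smooth_cst.
apply: smoothM; apply: smoothD; (exact: smooth_cst || exact: smooth_coord || idtac).
rewrite (_ : (fun x : 'rV_n => _) = fun x : 'rV[R]_n => (-1) * x ord0 i).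
  by apply: smoothM; [exact: smooth_cst|exact: smooth_coord].
by apply/funext => x; rewrite mulN1r.
Qed.

Lemma box_bump_ge0 m x : 0 <= box_bump m x.
Proof. by apply: prodr_ge0 => i _; exact: bump_ge0. Qed.

Lemma box_bump_le1 m x : box_bump m x <= 1.
Proof. by apply: prodr_ile1 => i _; rewrite bump_ge0 bump0_le1. Qed.

(** Off the open interval the two factors of the quadratic have opposite signs. This uses a <= b:
    between b and a, if b < a, both factors would be negative. *)
Lemma box_bump_out m x : (forall i, a ord0 i <= b ord0 i) -> ~ obox a b x -> box_bump m x = 0.
Proof.
move=> ab /existsNP[i /negP xi]; apply/eqP/prodf_eq0.
exists i => //; apply/eqP; apply: bump_le0.
apply: mulr_ge0_le0 => //; move: xi; rewrite negb_and -!leNgt => /orP[xi|xi].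
  by rewrite mulr_le0_ge0 ?subr_le0 ?subr_ge0// (le_trans xi).
by rewrite mulr_ge0_le0 ?subr_le0 ?subr_ge0// (le_trans _ xi).
Qed.

Lemma box_bump_cvg x : (forall i, a ord0 i <= b ord0 i) ->
  box_bump m x @[m --> \oo] --> (\1_(obox a b) x : R).
Proof.
move=> ab; rewrite indicE; case: (boolP (x \in obox a b)) => [|].
  rewrite inE => xab; rewrite (_ : true%:R = \prod_(i < n) (1 : R)); last by rewrite big1.
  apply: (@cvg_big R^o _ _ _ _ _ _ _ _ (fun i m => bump 0 (m%:R * ((x ord0 i - a ord0 i) * (b ord0 i - x ord0 i))))) => //.
    exact: mul_continuous.
  move=> i _; have /andP[ax xb] := xab i.
  set c := _ * (_ - _); have c0 : 0 < c by rewrite mulr_gt0 ?subr_gt0.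
  have L : expR (- (m%:R * c)^-1) @[m --> \oo] --> (1 : R).
    rewrite -[X in _ --> X]expR0; apply: (cvg_comp _ expR); last exact: continuous_expR.
    rewrite -oppr0; apply: cvgN.
    apply/gtr0_cvgV0; first by near=> m; rewrite mulr_gt0// ltr0n; near: m; exact: nbhs_infty_gt.
    apply/cvgryPge => A; near=> m; rewrite -ler_pdivrMr//; near: m.
    exact: nbhs_infty_ger.
  apply: cvg_trans L; apply: near_eq_cvg; near=> m.
  rewrite /bump ifT ?expr0 ?mul1r// mulr_gt0// ltr0n; near: m; exact: nbhs_infty_gt.
rewrite notin_setE => /box_bump_out Z; under eq_fun do rewrite Z//.
exact: cvg_cst.
Unshelve. all: by end_near. Qed.

End box_bump.
End bump.

(** * Symmetry of second derivatives *)

Section schwarz.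
Context (R : realType) (n : nat).

(** Two applications of the mean value theorem: to the difference of [f] along two parallel segments
    of direction u, then to the derivative along u on a segment of direction v. Each shift moves the
    point by at most h. *)
Lemma second_difference (f : 'rV[R]_n -> R) (u v x : 'rV[R]_n) (h : R) :
  (forall y, derivable f y u) -> (forall y, derivable ('D_u f) y v) ->
  `|u| <= 1 -> `|v| <= 1 -> 0 < h ->
  exists2 p, `|x - p| <= 2 * h &
    f (h *: u + (h *: v + x)) - f (h *: u + x) - f (h *: v + x) + f x =
    h ^+ 2 * 'D_v ('D_u f) p.
Proof.
move=> du dv u1 v1 h0.
pose G s := f (s *: u + (h *: v + x)) - f (s *: u + x).
have dG (s : R) : is_derive s 1 G
    ('D_u f (s *: u + (h *: v + x)) - 'D_u f (s *: u + x)).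
  apply: is_deriveB; (apply: DeriveDef; [exact: (derivable_line (du _))|exact: (derive_line f)]).
have cG : {within `[0, h], continuous G}.
  by apply: continuous_subspaceT => s; apply: derivable1_continuous; case: (dG s).
have [s] := MVT h0 (fun s _ => dG s) cG.
rewrite in_itv/= => /andP[s0 sh] E1.
pose H t := 'D_u f (t *: v + (s *: u + x)).
have dH (t : R) : is_derive t 1 H ('D_v ('D_u f) (t *: v + (s *: u + x))).
  by apply: DeriveDef; [exact: (derivable_line (dv _))|exact: (derive_line ('D_u f))].
have cH : {within `[0, h], continuous H}.
  by apply: continuous_subspaceT => t; apply: derivable1_continuous; case: (dH t).
have [t] := MVT h0 (fun t _ => dH t) cH.
rewrite in_itv/= => /andP[t0 th] E2.
exists (t *: v + (s *: u + x)).
  rewrite addrA opprD addrCA subrr addr0 normrN.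
  apply: le_trans (ler_normD _ _) _; rewrite !normrZ !gtr0_norm//.
  have : t * `|v| <= h * 1 by rewrite ler_pM// ltW.
  have : s * `|u| <= h * 1 by rewrite ler_pM// ltW.
  lra.
rewrite subr0 in E1; rewrite subr0 /H scale0r add0r in E2.
transitivity (G h - G 0); first by rewrite /G !scale0r !add0r; ring.
by rewrite E1 (addrCA (s *: u)) E2; ring.
Qed.

(** The second difference is symmetric in u and v, so both mixed derivatives take a common value at
    points as near to x as desired; continuity at x concludes. *)
Lemma schwarz (f : 'rV[R]_n -> R) (u v x : 'rV[R]_n) :
  (forall y, derivable f y u) -> (forall y, derivable f y v) ->
  (forall y, derivable ('D_u f) y v) -> (forall y, derivable ('D_v f) y u) ->
  `|u| <= 1 -> `|v| <= 1 ->
  {for x, continuous ('D_v ('D_u f))} -> {for x, continuous ('D_u ('D_v f))} ->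
  'D_v ('D_u f) x = 'D_u ('D_v f) x.
Proof.
move=> du dv duv dvu u1 v1 c1 c2; apply/eqP; rewrite -subr_eq0; apply/eqP.
set A := 'D_v ('D_u f) in c1 *; set B := 'D_u ('D_v f) in c2 *.
have close e : 0 < e -> `|A x - B x| <= e.
  move=> e0; have e20 : 0 < e / 2 by rewrite divr_gt0.
  have /nbhs_ballP[r1 /= r10 h1] : \forall t \near x, `|A x - A t| < e / 2.
    by move/cvgrPdist_lt : c1; exact.
  have /nbhs_ballP[r2 /= r20 h2] : \forall t \near x, `|B x - B t| < e / 2.
    by move/cvgrPdist_lt : c2; exact.
  (* The points supplied by [second_difference] lie within 2h, which must stay below both radii. *)
  pose h := Num.min r1 r2 / 3.
  have r0 : 0 < Num.min r1 r2 by rewrite lt_min r10.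
  have h0 : 0 < h by rewrite divr_gt0.
  have hr : 2 * h < Num.min r1 r2.
    by rewrite /h mulrCA gtr_pMr// ltr_pdivrMr// mul1r ltr_nat.
  have [p px E1] := second_difference x du duv u1 v1 h0.
  have [q qx E2] := second_difference x dv dvu v1 u1 h0.
  have E : A p = B q.
    have : h ^+ 2 * A p = h ^+ 2 * B q.
      by rewrite -E1 -E2 (addrCA (h *: v)); congr (_ + _); rewrite addrAC.
    by apply: mulfI; rewrite expf_neq0// gt_eqF.
  move: hr; rewrite lt_min => /andP[hr1 hr2].
  have H1 : `|A x - A p| < e / 2.
    by apply: h1; rewrite -ball_normE /=; exact: le_lt_trans hr1.
  have H2 : `|B x - B q| < e / 2.
    by apply: h2; rewrite -ball_normE /=; exact: le_lt_trans hr2.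
  rewrite (_ : A x - B x = (A x - A p) - (B x - B q)); last by rewrite E opprB addrA subrK.
  rewrite [leRHS]splitr; apply: (le_trans (ler_normB _ _)).
  by apply: lerD; apply: ltW; [exact: H1|exact: H2].
apply/eqP; rewrite -normr_le0; apply/ler_addgt0Pr => e e0; rewrite add0r.
exact: close.
Qed.

Lemma norm_basis_vec (i : 'I_n) : `|basis_vec R i| <= 1.
Proof.
by apply/rV_norm_le => // j; rewrite mxE/=; case: (_ == _); rewrite ?normr1 ?normr0.
Qed.

Lemma smooth_schwarz (f : 'rV[R]_n -> R) i j x : smooth f ->
  'D_(basis_vec R i) ('D_(basis_vec R j) f) x =
  'D_(basis_vec R j) ('D_(basis_vec R i) f) x.
Proof.
move=> sf; apply: schwarz; try exact: norm_basis_vec.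
- by move=> y; exact: smooth_derivable.
- by move=> y; exact: smooth_derivable.
- by move=> y; apply: smooth_derivable; exact: smooth_derive.
- by move=> y; apply: smooth_derivable; exact: smooth_derive.
- by apply: smooth_continuous; do 2 apply: smooth_derive.
- by apply: smooth_continuous; do 2 apply: smooth_derive.
Qed.

End schwarz.

(** * The fundamental lemma of the calculus of variations *)

Section boxes_generate.
Context (R : realType) (n : nat).

Definition oboxes : set (set 'rV[R]_n) := [set B | exists a b, B = obox a b].

Lemma obox_setI (a b a' b' : 'rV[R]_n) : obox a b `&` obox a' b' =
  obox (\row_i Num.max (a ord0 i) (a' ord0 i)) (\row_i Num.min (b ord0 i) (b' ord0 i)).
Proof.
apply/seteqP; split=> x /=.
  move=> [h h'] i; rewrite !mxE gt_max lt_min.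
  by have /andP[-> ->] := h i; have /andP[-> ->] := h' i.
move=> h; split=> i; have := h i; rewrite !mxE gt_max lt_min => /andP[/andP[h1 h2] /andP[h3 h4]].
  by rewrite h1.
by rewrite h2.
Qed.

Lemma oboxes_setI : setI_closed oboxes.
Proof. by move=> _ _ [a [b ->]] [a' [b' ->]]; rewrite obox_setI; do 2 eexists. Qed.

(** The identity is measurable from the sigma-algebra generated by boxes: its coordinates are
    continuous, and open sets are countable unions of boxes. *)
Lemma measurable_oboxes (E : set 'rV[R]_n) : measurable E -> <<s oboxes >> E.
Proof.
pose T := g_sigma_algebraType oboxes.
have mo (U : set 'rV[R]_n) : open U -> measurable (U : set T).
  move=> /open_bigcup_rat_box ->; rewrite bigcup_mkcond.
  apply: countable_bigcupT_measurable => [|q]; first exact: countableP.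
  by case: ifP => // _; apply: sub_sigma_algebra; do 2 eexists.
have : measurable_fun (setT : set T) (id : T -> 'rV[R]_n).
  apply: measurable_to_rV => i.
  apply: (measurability _ (measurable_realfun.RGenOpens.measurableE R)).
  move=> _ [_ [a [b ->] <-]]; rewrite setTI; apply: mo.
  have : continuous (fun x : 'rV[R]_n => x ord0 i) by move=> x; exact: coord_continuous.
  by move/continuousP; apply; exact: interval_open.
by move=> h mE; have := h measurableT E mE; rewrite setTI preimage_id.
Qed.

End boxes_generate.

Section fundamental_lemma.
Context (R : realType) (n : nat) (U : set 'rV[R]_n) (s : 'rV[R]_n -> R).
Local Notation mu := (@lebesgue_rV R n).
Hypotheses (oU : open U) (iS : mu.-integrable U (EFin \o s)).
Hypothesis s0 : forall (a b : 'rV[R]_n) m, (forall i, a ord0 i <= b ord0 i) -> cbox a b `<=` U ->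
  (\int[mu]_(x in U) (s x * box_bump a b m x)%:E = 0)%E.

Let mU : measurable U := open_measurable_rV oU.

Let ms : measurable_fun U s.
Proof. by apply/measurable_EFinP; exact: measurable_int iS. Qed.

Lemma obox_sub (a b : 'rV[R]_n) : obox a b `<=` cbox a b.
Proof. by move=> x xab i; have /andP[/ltW -> /ltW ->] := xab i. Qed.

(** Dominated convergence: the bumps tend to the indicator of the box and are bounded by 1, so |s|
    dominates. *)
Lemma integral_obox0 a b : cbox a b `<=` U -> (\int[mu]_(x in obox a b) (s x)%:E = 0)%E.
Proof.
move=> abU; have [ab|/existsNP[i /negP]] := pselect (forall i, a ord0 i <= b ord0 i); last first.
  rewrite -ltNge => ba; rewrite (_ : obox a b = set0) ?integral_set0//.
  by apply/seteqP; split => // x /(_ i)/andP[h1 h2]; have := lt_trans (lt_trans ba h1) h2; rewrite ltxx.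
have oabU : obox a b `<=` U by move=> x /obox_sub/abU.
rewrite -(setIidl oabU) integral_mkcondl.
have mB m : measurable_fun U (box_bump a b m).
  by apply: continuous_measurable_rV; apply: smooth_continuous; exact: smooth_box_bump.
have [||||| _ _] := @dominated_convergence _ _ _ mu U mU
  (fun m x => (s x * box_bump a b m x)%:E) ((EFin \o s) \_ (obox a b)) (fun x => `|(s x)%:E|%E).
- by move=> m; apply/measurable_EFinP; exact: measurable_funM.
- apply/(measurable_restrict _ (measurable_obox a b) mU).
  apply: measurable_funS (measurable_int _ iS) => //; exact: subIsetl.
- apply: aeW => x Ux.
  rewrite (_ : (_ \_ _) x = (s x * \1_(obox a b) x)%:E).
    apply: cvg_EFin; first by near=> m.
    by apply: cvgM; [exact: cvg_cst|exact: box_bump_cvg].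
  by rewrite patchE indicE; case: ifP => _; rewrite ?mulr1// mulr0.
- by apply: (integrable_abse iS).
- apply: aeW => x m Ux; rewrite lee_fin normrM [X in _ * X]ger0_norm ?box_bump_ge0//.
  by rewrite ler_piMr// box_bump_le1.
under eq_fun do rewrite s0//.
by move/cvg_lim => <- //; rewrite lim_cst.
Unshelve. all: by end_near. Qed.

(** Dynkin's pi-lambda argument for the traces on one fixed box. Working inside a box whose closure
    lies in [U] matters, as the hypothesis covers only such boxes. *)
Lemma integral_box_setI0 (q : 'rV[R]_n * 'rV[R]_n) (E : set 'rV[R]_n) :
  cbox q.1 q.2 `<=` U -> measurable E ->
  (\int[mu]_(x in E `&` obox q.1 q.2) (s x)%:E = 0)%E.
Proof.
move=> qU; set B := obox _ _ => mE.
have mB : measurable B by exact: measurable_obox.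
have BU : B `<=` U by move=> x /obox_sub/qU.
have iB A : measurable A -> A `<=` B -> mu.-integrable A (EFin \o s).
  by move=> mA AB; apply: integrableS iS => //; exact: subset_trans AB BU.
pose H := [set E | measurable E /\ (\int[mu]_(x in E `&` B) (s x)%:E = 0)%E].
suff : <<s @oboxes R n >> `<=` H by move=> /(_ E (measurable_oboxes mE)) [].
apply: lambda_system_subset => //; first exact: oboxes_setI.
- apply/dynkin_lambda_system; split.
  + by split => //; rewrite setTI; exact: integral_obox0.
  + move=> A [mA A0]; split; first exact: measurableC.
    have : (\int[mu]_(x in (A `&` B) `|` (~` A `&` B)) (s x)%:E = 0)%E.
      by rewrite -setIUl setUv setTI; exact: integral_obox0.
    rewrite integral_setU//; first by rewrite A0 add0e.
    * exact: measurableI.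
    * by apply: measurableI => //; exact: measurableC.
    * apply: measurable_funS (measurable_int _ iS) => //.
      by rewrite -setIUl setUv setTI.
    * by apply/disj_set2P; rewrite setIACA setICr set0I.
  + move=> F tF HF; split; first by apply: bigcupT_measurable => k; have [] := HF k.
    rewrite setI_bigcupl integral_bigcup.
    * by apply: eseries0 => k _ _; have [] := HF k.
    * by apply: trivIset_setIr.
    * by move=> k; apply: measurableI => //; have [] := HF k.
    * apply: iB; last by move=> x [k _ []].
      by apply: bigcupT_measurable => k; apply: measurableI => //; have [] := HF k.
(* The intersection of any box with the fixed one is again a box, and its closed version is still
   inside [U]. *)
- move=> _ [a [b ->]]; split; first exact: measurable_obox.
  rewrite obox_setI; apply: integral_obox0 => x xab; apply: qU => i.
  by have := xab i; rewrite !mxE ge_max le_min => /andP[/andP[_ ->] /andP[_ ->]].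
Qed.

Lemma integral_bump_eq0 : {ae mu, forall x, U x -> s x = 0}.
Proof.
pose D := [set q : 'rV[rat]_n * 'rV[rat]_n | cbox (@rat_rV R n q.1) (rat_rV R q.2) `<=` U].
have Dq q : D q -> {ae mu, forall x, obox (rat_rV R q.1) (rat_rV R q.2) x -> s x = 0}.
  move=> qU; set B := obox _ _; have mB : measurable B by exact: measurable_obox.
  have BU : B `<=` U by move=> x /obox_sub/qU.
  have : ae_eq mu B (EFin \o s) (cst 0%E).
    apply: integral_ae_eq => //; first exact: integrableS iS.
    move=> E EB mE; rewrite integral_cst// mul0e.
    rewrite -(setIidl EB); exact: (@integral_box_setI0 (rat_rV R q.1, rat_rV R q.2)).
  by apply: filterS => x h Bx; have := h Bx => -[].
(* The rational boxes are numbered by [unpickle], to turn the countable family into a sequence of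
   statements. *)
have A k : {ae mu, forall x, forall q, unpickle k = Some q -> D q ->
    obox (rat_rV R q.1) (rat_rV R q.2) x -> s x = 0}.
  case E : (unpickle k) => [q|]; last by apply: aeW.
  have [Hq|Hq] := pselect (D q); last by apply: aeW => x _ [<-].
  by apply: filterS (Dq q Hq) => x h _ [<-] _.
apply: filterS (ae_foralln A) => x h Ux.
have [q [q1 q2]] := open_rat_box oU Ux.
by apply: (h (pickle q) q) => //; exact: pickleK.
Qed.

End fundamental_lemma.

(** * Algebra of forms *)

Section signs.
Context (R : realType) (n : nat).
Implicit Types (S T U : {set 'I_n}) (i j : 'I_n).
Local Notation sgn := (@pos_sign R n).

Lemma pos_sign_sqr i S : sgn i S * sgn i S = 1.
Proof. by rewrite /pos_sign -expr2 sqrr_sign. Qed.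

Lemma pos_signU1 i j S : j \notin S -> sgn i (j |: S)%SET = sgn i S * (-1) ^+ (j < i)%N.
Proof.
move=> jS; rewrite /pos_sign -exprD; congr (_ ^+ _).
rewrite -!sum1_card (bigID (pred1 j)) addnC /=; congr (_ + _)%N; last first.
  apply: eq_bigl => l; rewrite !inE.
  by have [->|] := eqVneq l j; rewrite ?(negPf jS)/= ?andbF ?andbT.
rewrite (eq_bigl (fun l => (l == j) && (j < i)%N)); last first.
  move=> l; rewrite !inE.
  by have [->|] := eqVneq l j; rewrite /= ?andbF ?andbT.
case: (j < i)%N; last by rewrite big_pred0// => l; rewrite andbF.
by rewrite (eq_bigl (pred1 j)) ?big_pred1_eq// => l; rewrite andbT.
Qed.

Lemma pos_signU1_id i S : sgn i (i |: S)%SET = sgn i S.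
Proof.
have [iS|iS] := boolP (i \in S); first by rewrite (finset.setUidPr _)// finset.sub1set.
by rewrite pos_signU1// ltnn mulr1.
Qed.

Lemma pos_signD1_id i S : sgn i (S :\ i)%SET = sgn i S.
Proof.
have [iS|iS] := boolP (i \in S); first by rewrite -[in RHS](finset.setD1K iS) pos_signU1_id.
by congr (sgn i _); apply/finset.setDidPl; rewrite disjoint_sym disjoints1.
Qed.

Lemma pos_signD1 i j S : j \in S -> sgn i (S :\ j)%SET = sgn i S * (-1) ^+ (j < i)%N.
Proof.
move=> jS; rewrite -[in RHS](finset.setD1K jS) pos_signU1 ?inE ?eqxx//.
by rewrite -mulrA -expr2 sqrr_sign mulr1.
Qed.

(** The pairs (U, i) with i in U and the pairs (S, i) with i outside S correspond by S = U minus i.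
    The exchange underlies the component formulas and the adjointness of [ext_d] and [cod]. *)
Lemma reindex_setU1 (V : nmodType) (G : 'I_n -> {set 'I_n} -> {set 'I_n} -> V) :
  \sum_(U : {set 'I_n}) \sum_(i in U) G i (U :\ i)%SET U =
  \sum_(S : {set 'I_n}) \sum_(i | i \notin S) G i S (i |: S)%SET.
Proof.
rewrite (exchange_big_dep xpredT)//= [RHS](exchange_big_dep xpredT)//=.
apply: eq_bigr => i _.
rewrite [RHS](reindex_onto (fun U => U :\ i)%SET (fun S => i |: S)%SET)/=; last first.
  by move=> S iS; rewrite finset.setU1K.
apply: eq_big => [U|U iU]; last by rewrite finset.setD1K.
rewrite !inE eqxx /=; apply/idP/eqP => [/finset.setD1K//|<-].
by rewrite finset.setU11.
Qed.

Lemma sum_dxU (F : {set 'I_n} -> 'I_n -> R) U :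
  (\sum_(S : {set 'I_n}) \sum_(i | i \notin S) F S i *: dx R (i |: S)%SET) U =
  \sum_(i in U) F (U :\ i)%SET i.
Proof.
rewrite -(reindex_setU1 (fun i S T => F S i *: dx R T)) sum_ffunE (bigD1 U)//=.
rewrite [X in _ + X]big1 ?addr0 => [|T TU].
  by rewrite sum_ffunE; apply: eq_bigr => i iU; rewrite !ffunE eqxx [_ *: _]mulr1.
rewrite sum_ffunE big1// => i _.
by rewrite !ffunE eq_sym (negPf TU) [_ *: _]mulr0.
Qed.

Lemma sum_dxD (F : {set 'I_n} -> 'I_n -> R) T :
  (\sum_(S : {set 'I_n}) \sum_(i in S) F S i *: dx R (S :\ i)%SET) T =
  \sum_(i | i \notin T) F (i |: T)%SET i.
Proof.
rewrite (reindex_setU1 (fun i S U => F U i *: dx R S)) sum_ffunE (bigD1 T)//=.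
rewrite [X in _ + X]big1 ?addr0 => [|S ST].
  by rewrite sum_ffunE; apply: eq_bigr => i iU; rewrite !ffunE eqxx [_ *: _]mulr1.
rewrite sum_ffunE big1// => i _.
by rewrite !ffunE eq_sym (negPf ST) [_ *: _]mulr0.
Qed.

Lemma koszulE (x : 'rV[R]_n) (w : covector R n) T :
  koszul x w T = \sum_(i | i \notin T) w (i |: T)%SET * sgn i T * x ord0 i.
Proof.
rewrite /koszul (sum_dxD (fun S i => w S * sgn i S * x ord0 i)).
by apply: eq_bigr => i _; rewrite pos_signU1_id.
Qed.

Lemma hodge_starE (w : covector R n) U :
  hodge_star w U = w (~: U)%SET * star_sign R (~: U)%SET.
Proof.
rewrite /hodge_star sum_ffunE (bigD1 (~: U)%SET)//= big1 ?addr0 => [|S SU].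
  by rewrite !ffunE finset.setCK eqxx [_ *: _]mulr1.
by rewrite !ffunE eq_sym (can2_eq (@finset.setCK _) (@finset.setCK _)) (negPf SU) [_ *: _]mulr0.
Qed.

Lemma ext_dE (omega : Defs.form R n) x U : ext_d omega x U =
  \sum_(i in U) 'D_(basis_vec R i) (fun y => omega y (U :\ i)%SET) x * sgn i U.
Proof.
rewrite /ext_d (sum_dxU (fun S i => 'D_(basis_vec R i) (fun y => omega y S) x * sgn i S)).
by apply: eq_bigr => i _; rewrite pos_signD1_id.
Qed.

(* the formal adjoint of ext_d on smooth forms *)
Definition cod (phi : Defs.form R n) : Defs.form R n := fun x =>
  [ffun T : {set 'I_n} => - \sum_(i | i \notin T)
     'D_(basis_vec R i) (fun y => phi y (i |: T)%SET) x * sgn i T].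

(* the form x |-> x_1 dx^1 + ... + x_n dx^n, wedged with a *)
Definition wedge (x : 'rV[R]_n) (a : covector R n) : covector R n :=
  [ffun S : {set 'I_n} => \sum_(i in S) a (S :\ i)%SET * sgn i S * x ord0 i].

(** Removing i from S adds i to the complement: each remaining j > i gains a sign, and the factor of
    i disappears. The elements of S above i and those below i together number #|S| - 1. *)
Lemma star_signD1 i S : i \in S ->
  star_sign R (S :\ i)%SET * sgn i S = (-1) ^+ #|S|.-1 * star_sign R S * sgn i (~: S)%SET.
Proof.
move=> iS; rewrite /star_sign [in RHS](bigD1 i)//= finset.setCD.
rewrite (eq_bigl (fun j => (j \in S) && (j != i))); last by move=> j; rewrite !inE andbC.
rewrite (eq_bigr (fun j => sgn j (~: S)%SET * (-1) ^+ (i < j)%N)); last first.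
  by move=> j _; rewrite finset.setUC pos_signU1// inE iS.
rewrite big_split/= !prodrXr.
have -> : (#|S|.-1 = \sum_(j in S | j != i) (i < j)%N + #|[pred j in S | (j < i)%N]|)%N.
  rewrite (cardsD1 i) iS add1n /= -!sum1_card.
  rewrite [X in (_ = _ + X)%N](_ : _ = \sum_(j in S | j != i) (j < i)%N)%N; last first.
    rewrite [RHS]big_mkcond /= [LHS]big_mkcond /=; apply: eq_bigr => j _.
    rewrite !inE; case: (j \in S) => //=; have [->|] := eqVneq j i; first by rewrite ltnn.
    by case: (j < i)%N.
  rewrite -big_split /= [LHS](eq_bigl (fun j => (j \in S) && (j != i))); last first.
    by move=> j; rewrite !inE andbC.
  apply: eq_bigr => j /andP[_]; rewrite neq_ltn => /orP[] h; rewrite h.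
    by rewrite ltnNge (ltnW h).
  by rewrite (ltnNge j i) (ltnW h).
rewrite exprD -/(sgn i S).
have := pos_sign_sqr i (~: S)%SET; set p := sgn i _ => pp.
set A := _ ^+ (\sum_(_ in S | _) (i < _)%N); set B := (_ ^+ _ : R).
rewrite [RHS](_ : _ = A * B * sgn i S * (p * p)); last by ring.
by rewrite pp mulr1 (mulrC A).
Qed.

Lemma star_sign_sqr S : star_sign R S * star_sign R S = 1.
Proof. by rewrite /star_sign -big_split/= big1// => i _; exact: pos_sign_sqr. Qed.

(** The star turns contraction with x into exterior multiplication by x, up to signs; this makes the
    dual Whitney forms explicit. *)
Lemma hodge_koszul x (c : covector R n) :
  hodge_star (koszul x c) =
  wedge x [ffun T : {set 'I_n} => (-1) ^+ #|~: T|%SET.-1 * star_sign R (~: T)%SET * c (~: T)%SET].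
Proof.
apply/ffunP => S; rewrite hodge_starE koszulE ffunE mulr_suml.
rewrite (eq_bigl (fun i => i \in S)); last by move=> i; rewrite inE negbK.
apply: eq_bigr => i iS; rewrite ffunE.
have E : (~: (S :\ i))%SET = (i |: ~: S)%SET by rewrite finset.setCD finset.setUC.
have iSC : i \notin (~: S)%SET by rewrite inE iS.
have := @star_signD1 i (i |: ~: S)%SET (finset.setU11 _ _).
rewrite E finset.setU1K// pos_signU1_id -E finset.setCK pos_signD1_id => H.
transitivity (star_sign R (~: S)%SET * sgn i (~: S)%SET * (c (~: (S :\ i))%SET * x ord0 i)).
  by ring.
by rewrite H; ring.
Qed.

Lemma covector_eq0 (c : covector R n) : (forall S, c S = 0) -> c = 0.
Proof. by move=> h; apply/ffunP => S; rewrite h ffunE. Qed.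

Lemma of_degreeD k (c d : covector R n) : of_degree k c -> of_degree k d -> of_degree k (c + d).
Proof. by move=> hc hd S Sk; rewrite ffunE hc// hd// addr0. Qed.

Lemma of_degreeZ k t (c : covector R n) : of_degree k c -> of_degree k (t *: c).
Proof. by move=> hc S Sk; rewrite ffunE hc// scaler0. Qed.

Lemma of_degree0 k : of_degree k (0 : covector R n).
Proof. by move=> S _; rewrite ffunE. Qed.

Lemma of_degree_dx S : of_degree #|S| (dx R S).
Proof. by move=> T TS; rewrite ffunE; have [E|//] := eqVneq T S; rewrite E eqxx in TS. Qed.

Lemma cards_D1 i S : i \in S -> #|S| = #|(S :\ i)%SET|.+1.
Proof. by move=> iS; rewrite (cardsD1 i) iS. Qed.

Lemma cards_U1 i S : i \notin S -> #|(i |: S)%SET| = #|S|.+1.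
Proof. by move=> iS; rewrite cardsU1 iS. Qed.

Lemma of_degree_koszul k x (c : covector R n) : of_degree k.+1 c -> of_degree k (koszul x c).
Proof.
move=> hc S Sk; rewrite koszulE big1// => i iS.
by rewrite hc ?mul0r// cards_U1// eqSS.
Qed.

Lemma koszul_linear x t (c d : covector R n) :
  koszul x (t *: c + d) = t *: koszul x c + koszul x d.
Proof.
apply/ffunP => S; rewrite !ffunE !koszulE [X in _ = X + _]mulr_sumr -big_split/=.
by apply: eq_bigr => i _; rewrite !ffunE /GRing.scale/=; ring.
Qed.

Lemma wedge_linear x t (c d : covector R n) :
  wedge x (t *: c + d) = t *: wedge x c + wedge x d.
Proof.
apply/ffunP => S; rewrite !ffunE [X in _ = X + _]mulr_sumr -big_split/=.
by apply: eq_bigr => i _; rewrite !ffunE /GRing.scale/=; ring.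
Qed.

Lemma is_derive_affine (b : R) (a x v : 'rV[R]_n) :
  is_derive x v (fun y => b + lin a y) (lin a v).
Proof.
have C : h^-1 *: (((fun y => b + lin a y) \o shift x) (h *: v) - (b + lin a x)) @[h --> 0^']
    --> lin a v.
  have K : (fun _ : R => lin a v) h @[h --> 0^'] --> lin a v by exact: cvg_cst.
  apply: cvg_trans K; apply: near_eq_cvg; near=> h.
  have h0 : h != 0 by near: h; exact: nbhs_dnbhs_neq.
  have -> : ((fun y => b + lin a y) \o shift x) (h *: v) - (b + lin a x) = h * lin a v.
    rewrite /= opprD addrACA subrr add0r /lin mulr_sumr -sumrB.
    by apply: eq_bigr => i _; rewrite !mxE; ring.
  by rewrite [_ *: _]mulrA mulVf// mul1r.
by apply: DeriveDef; [apply/cvg_ex; exists (lin a v)|exact: cvg_lim C].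
Unshelve. all: by end_near. Qed.

Lemma lin_basis (a : 'rV[R]_n) i : lin a (basis_vec R i) = a ord0 i.
Proof.
rewrite /lin (bigD1 i)//= big1 ?addr0 => [|j ji]; first by rewrite mxE !eqxx mulr1.
by rewrite mxE (negPf ji) andbF mulr0.
Qed.

Lemma smooth_affine (b : R) (a : 'rV[R]_n) : smooth (fun x => b + lin a x).
Proof.
apply: smoothD; first exact: smooth_cst.
apply: smooth_sum => i _.
by apply: smoothM; [exact: smooth_cst|exact: smooth_coord].
Qed.

(** The gradient of the T-component of the Koszul form (and, for [wcoef], of the wedge). Both
    derivatives and zero sets are read off from it. *)
Definition kcoef (c : covector R n) T : 'rV[R]_n :=
  \row_i (if i \notin T then c (i |: T)%SET * sgn i T else 0).
Definition wcoef (a : covector R n) T : 'rV[R]_n :=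
  \row_i (if i \in T then a (T :\ i)%SET * sgn i T else 0).

Lemma koszul_lin x c T : koszul x c T = lin (kcoef c T) x.
Proof.
rewrite koszulE /lin big_mkcond; apply: eq_bigr => i _.
by rewrite mxE; case: ifP => // _; rewrite mul0r.
Qed.

Lemma wedge_lin x a T : wedge x a T = lin (wcoef a T) x.
Proof.
rewrite ffunE /lin big_mkcond; apply: eq_bigr => i _.
by rewrite mxE; case: ifP => // _; rewrite mul0r.
Qed.

(** Each of the k indices i in U contributes the same term c' U, because the sign of i occurs
    twice. *)
Lemma ext_d_P1m k (c c' : covector R n) x : of_degree k c' ->
  ext_d (fun y => c + koszul y c') x = k%:R *: c'.
Proof.
move=> dc'; apply/ffunP => U; rewrite ext_dE ffunE.
rewrite (eq_bigr (fun=> c' U)) => [|i iU].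
  rewrite sumr_const; have [<-|Uk] := eqVneq #|U| k; first by rewrite [RHS]mulr_natl.
  by rewrite dc'// mul0rn scaler0.
rewrite (_ : (fun y => (c + koszul y c') _) = fun y => c (U :\ i)%SET + lin (kcoef c' (U :\ i)%SET) y).
  have -> : 'D_(basis_vec R i) (fun y => c (U :\ i)%SET + lin (kcoef c' (U :\ i)%SET) y) x =
     kcoef c' (U :\ i)%SET ord0 i by rewrite (@derive_val _ _ _ _ _ _ _ (is_derive_affine _ _ _ _)) lin_basis.
  by rewrite mxE !inE eqxx /= finset.setD1K// pos_signD1_id -mulrA pos_sign_sqr mulr1.
by apply/funext => y; rewrite ffunE koszul_lin.
Qed.

Lemma hodge_star_linear t (c d : covector R n) :
  hodge_star (t *: c + d) = t *: hodge_star c + hodge_star d.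
Proof. by apply/ffunP => S; rewrite !(ffunE, hodge_starE) /GRing.scale/=; ring. Qed.

Lemma hodge_starD (c d : covector R n) : hodge_star (c + d) = hodge_star c + hodge_star d.
Proof. by rewrite -{1}[c]scale1r hodge_star_linear scale1r. Qed.

Lemma card_setC S : #|(~: S)%SET| = (n - #|S|)%N.
Proof. by rewrite cardsCs finset.setCK card_ord. Qed.

Lemma card_le S : (#|S| <= n)%N.
Proof. by rewrite -[X in (_ <= X)%N](card_ord n) max_card. Qed.

(** Each of the n - k indices outside T contributes the same term a T, the signs again squaring to
    1. *)
Lemma cod_P1sm k (e a : covector R n) x : of_degree k a ->
  cod (fun y => e + wedge y a) x = - (n - k)%:R *: a.
Proof.
move=> da; apply/ffunP => T; rewrite !ffunE.
rewrite (eq_bigr (fun=> a T)) => [|i iT].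
  rewrite sumr_const; have [Tk|Tk] := eqVneq #|T| k; last first.
    by rewrite da// mul0rn oppr0 scaler0.
  have -> : #|[pred i | i \notin T]| = (n - k)%N.
    by rewrite -Tk -card_setC; apply: eq_card => i; rewrite !inE.
  by rewrite [RHS]mulNr mulr_natl.
rewrite (_ : (fun y => (e + wedge y a) _) = fun y => e (i |: T)%SET + lin (wcoef a (i |: T)%SET) y).
  have -> : 'D_(basis_vec R i) (fun y => e (i |: T)%SET + lin (wcoef a (i |: T)%SET) y) x =
     wcoef a (i |: T)%SET ord0 i by rewrite (@derive_val _ _ _ _ _ _ _ (is_derive_affine _ _ _ _)) lin_basis.
  by rewrite mxE !inE eqxx /= finset.setU1K// pos_signU1_id -mulrA pos_sign_sqr mulr1.
by apply/funext => y; rewrite ffunE wedge_lin.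
Qed.

(** For k < n the truncated difference [n - k.+1] is the true complementary degree. Since signs
    square to 1, the star is inverted coefficient by coefficient. *)
Lemma P1smP k (q : Defs.form R n) : (k < n)%N -> @P1sm R n k.+1 q <->
  exists e a, [/\ of_degree k.+1 e, of_degree k a & q = fun x => e + wedge x a].
Proof.
move=> kn; split=> [[_ [c [c' [dc dc' ->]]] ->]|[e [a [de da ->]]]].
  exists (hodge_star c), [ffun T : {set 'I_n} =>
    (-1) ^+ #|~: T|%SET.-1 * star_sign R (~: T)%SET * c' (~: T)%SET]; split.
  - move=> S Sk; rewrite hodge_starE dc ?mul0r// card_setC.
    by apply: contra Sk => /eqP h; apply/eqP; have := card_le S; lia.
  - move=> S Sk; rewrite ffunE dc' ?mulr0// card_setC.
    by apply: contra Sk => /eqP h; apply/eqP; have := card_le S; lia.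
  - by apply/funext => x; rewrite -hodge_koszul hodge_starD.
pose c : covector R n := [ffun S : {set 'I_n} => e (~: S)%SET * star_sign R S].
pose c' : covector R n :=
  [ffun S : {set 'I_n} => (-1) ^+ #|S|.-1 * star_sign R S * a (~: S)%SET].
exists (fun x => c + koszul x c').
  exists c, c'; split=> //.
  - move=> S Sk; rewrite ffunE de ?mul0r// card_setC.
    by apply: contra Sk => /eqP h; apply/eqP; have := card_le S; lia.
  - move=> S Sk; rewrite ffunE da ?mulr0// card_setC.
    by apply: contra Sk => /eqP h; apply/eqP; have := card_le S; lia.
apply/funext => x; rewrite hodge_starD hodge_koszul.
congr (_ + wedge x _); apply/ffunP => S.
  by rewrite hodge_starE ffunE finset.setCK -mulrA star_sign_sqr mulr1.
rewrite !ffunE finset.setCK; set p : R := (-1) ^+ _; set t := star_sign R _.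
have pp : p * p = 1 by rewrite /p -expr2 sqrr_sign.
have tt : t * t = 1 by exact: star_sign_sqr.
by rewrite mulrA mulrACA pp tt !mul1r.
Qed.

Lemma derive_smooth_sum (I : Type) (r : seq I) (P : pred I) (F : I -> 'rV[R]_n -> R) i x :
  (forall l, P l -> smooth (F l)) ->
  'D_(basis_vec R i) (fun y => \sum_(l <- r | P l) F l y) x =
  \sum_(l <- r | P l) 'D_(basis_vec R i) (F l) x.
Proof.
move=> sF; elim: r => [|l r IH].
  under eq_fun do rewrite big_nil.
  by rewrite big_nil derive_cst.
under eq_fun do rewrite big_cons; rewrite big_cons; case: ifP => // Pl.
rewrite (@deriveD _ _ _ (F l) (fun y => \sum_(l <- r | P l) F l y)) ?IH//.
  by apply: smooth_derivable; exact: sF.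
by apply: smooth_derivable; exact: smooth_sum.
Qed.

Lemma derive_mulr_cst (f : 'rV[R]_n -> R) (c : R) i x : smooth f ->
  'D_(basis_vec R i) (fun y => f y * c) x = 'D_(basis_vec R i) f x * c.
Proof.
move=> sf; rewrite (@deriveM _ _ f (fun=> c)).
- by rewrite derive_cst scaler0 add0r [LHS]mulrC.
- by apply: smooth_derivable.
- by apply: smooth_derivable; exact: smooth_cst.
Qed.

(** The terms of (i, j) and (j, i) have equal second derivatives and opposite signs, so each
    component equals its own negative. *)
Lemma ext_d_ext_d (psi : Defs.form R n) x : (forall S, smooth (fun y => psi y S)) ->
  ext_d (ext_d psi) x = 0.
Proof.
move=> sp; apply/ffunP => U; rewrite ext_dE ffunE.
pose G i j := 'D_(basis_vec R i) ('D_(basis_vec R j) (fun y => psi y ((U :\ i) :\ j)%SET)) x *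
   (sgn j (U :\ i)%SET * sgn i U).
have E : \sum_(i in U) 'D_(basis_vec R i) (fun y => ext_d psi y (U :\ i)%SET) x * sgn i U =
    \sum_(i in U) \sum_(j in U | j != i) G i j.
  apply: eq_bigr => i iU.
  under eq_fun do rewrite ext_dE.
  rewrite derive_smooth_sum; last first.
    by move=> j _; apply: smoothM; [apply: smooth_derive; exact: sp|exact: smooth_cst].
  rewrite mulr_suml; apply: eq_big => [j|j _]; first by rewrite !inE andbC.
  by rewrite derive_mulr_cst -?mulrA//; apply: smooth_derive; exact: sp.
have A i j : i \in U -> j \in U -> j != i -> G j i = - G i j.
  move=> iU jU ji; rewrite /G smooth_schwarz//.
  have -> : ((U :\ j) :\ i)%SET = ((U :\ i) :\ j)%SET.
    by apply/setP => l; rewrite !inE andbCA.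
  rewrite !pos_signD1//.
  have -> : (-1) ^+ (j < i)%N = - (-1) ^+ (i < j)%N :> R.
    move: ji; rewrite neq_ltn => /orP[h|h]; rewrite h.
      by rewrite ltnNge (ltnW h) expr0 expr1.
    by rewrite (ltnNge j i) (ltnW h) expr0 expr1 opprK.
  by ring.
rewrite E; apply/eqP; rewrite -eqNr -sumrN; apply/eqP.
rewrite [RHS](exchange_big_dep (mem U))/= => [|i j iU /andP[]//].
apply: eq_bigr => i iU; rewrite -sumrN; apply: eq_big => [j|j /andP[jU ji]].
  by rewrite iU eq_sym; case: (j \in U).
by rewrite (A i j).
Qed.

(* Leibniz: the two sides differ by a divergence *)
Lemma ext_d_cod_pairing (psi phi : Defs.form R n) x :
  (forall S, smooth (fun y => psi y S)) -> (forall S, smooth (fun y => phi y S)) ->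
  \sum_U ext_d psi x U * phi x U - \sum_T psi x T * cod phi x T =
  \sum_(T : {set 'I_n}) \sum_(i | i \notin T)
    'D_(basis_vec R i) (fun y => psi y T * phi y (i |: T)%SET) x * sgn i T.
Proof.
move=> sp sf.
under eq_bigr do rewrite ext_dE mulr_suml.
rewrite (eq_bigr (fun U => \sum_(i in U) 'D_(basis_vec R i) (fun y => psi y (U :\ i)%SET) x
    * sgn i (U :\ i)%SET * phi x U)); last first.
  by move=> U _; apply: eq_bigr => i _; rewrite pos_signD1_id.
rewrite (reindex_setU1 (fun i S U => 'D_(basis_vec R i) (fun y => psi y S) x
    * sgn i S * phi x U)) -sumrB.
apply: eq_bigr => T _; rewrite ffunE mulrN opprK mulr_sumr -big_split/=.
apply: eq_bigr => i iT.
rewrite (@deriveM _ _ (fun y => psi y T) (fun y => phi y (i |: T)%SET)).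
- by rewrite /GRing.scale/=; ring.
- by apply: smooth_derivable; exact: sp.
- by apply: smooth_derivable; exact: sf.
Qed.

End signs.

(** * Square-integrable forms *)

Section L2.
Context (R : realType) (n : nat) (Omega : set 'rV[R]_n).
Local Notation form := (Defs.form R n).
Local Notation mu := (@lebesgue_rV R n).
Hypotheses (mO : measurable Omega) (bO : bounded_set Omega).
Local Notation L2ip := (L2ip Omega).

Definition L2f (omega : form) : Prop := forall S : {set 'I_n},
  measurable_fun Omega (fun x => omega x S) /\
  mu.-integrable Omega (fun x => (omega x S ^+ 2)%:E).

Lemma mu_Omega : (mu Omega < +oo)%E.
Proof. exact: bounded_lebesgue. Qed.

Lemma sqr_integrableM (f g : 'rV[R]_n -> R) :
  measurable_fun Omega f -> measurable_fun Omega g ->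
  mu.-integrable Omega (fun x => (f x ^+ 2)%:E) ->
  mu.-integrable Omega (fun x => (g x ^+ 2)%:E) ->
  mu.-integrable Omega (fun x => (f x * g x)%:E).
Proof.
move=> mf mg f2 g2.
apply: (le_integrable mO _ _ (integrableD mO f2 g2)).
  by apply/measurable_EFinP; exact: measurable_funM.
move=> x _; rewrite /= lee_fin normrM [leRHS]ger0_norm ?addr_ge0 ?sqr_ge0//.
rewrite -[f x ^+ 2]real_normK ?num_real// -[g x ^+ 2]real_normK ?num_real//.
have := normr_ge0 (g x); have := normr_ge0 (f x).
set a := `|f x|; set b := `|g x| => a0 b0.
have := sqr_ge0 (a - b); have := mulr_ge0 a0 b0; nra.
Qed.

Lemma L2ip_integrable omega eta : L2f omega -> L2f eta ->
  mu.-integrable Omega (EFin \o (fun x => \sum_(S : {set 'I_n}) omega x S * eta x S)).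
Proof.
move=> ho he.
rewrite (_ : _ \o _ = fun x => (\sum_(S : {set 'I_n}) (omega x S * eta x S)%:E)%E); last first.
  by apply/funext => x; rewrite /= sumEFin.
apply: integrable_sum => // S _.
by apply: sqr_integrableM; (exact: (ho S).1 || exact: (ho S).2 || exact: (he S).1 || exact: (he S).2).
Qed.

Lemma L2ipC omega eta : L2ip omega eta = L2ip eta omega.
Proof. by rewrite /L2ip; under eq_Rintegral do under eq_bigr do rewrite mulrC. Qed.

Lemma L2ip_linearl a omega omega' eta : L2f omega -> L2f omega' -> L2f eta ->
  L2ip (fun x => a *: omega x + omega' x) eta = a * L2ip omega eta + L2ip omega' eta.
Proof.
move=> h h' he; rewrite /L2ip -RintegralZl//; last exact: L2ip_integrable.
rewrite -RintegralD//.
- apply: eq_Rintegral => x _; rewrite mulr_sumr -big_split/=.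
  by apply: eq_bigr => S _; rewrite !ffunE /GRing.scale/= mulrDl mulrA.
- by apply: (integrableZl mO a (L2ip_integrable h he)).
- exact: L2ip_integrable.
Qed.

Lemma L2f_linear a omega eta : L2f omega -> L2f eta -> L2f (fun x => a *: omega x + eta x).
Proof.
move=> ho he S.
have E : (fun x => (a *: omega x + eta x) S) = fun x => a * omega x S + eta x S.
  by apply/funext => x; rewrite !ffunE.
have mS : measurable_fun Omega (fun x => a * omega x S + eta x S).
  apply: measurable_funD; last exact: (he S).1.
  by apply: measurable_funM; [exact: measurable_cst|exact: (ho S).1].
split; first by rewrite E.
have -> : (fun x => ((a *: omega x + eta x) S ^+ 2)%:E) =
    (fun x => ((a * omega x S + eta x S) ^+ 2)%:E).
  by apply/funext => x; rewrite !ffunE.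
have I2 := integrableD mO (integrableZl mO (2 * a ^+ 2) (ho S).2) (integrableZl mO 2 (he S).2).
apply: (le_integrable mO _ _ I2).
  by apply/measurable_EFinP; exact: measurable_funX.
move=> x _; rewrite /= lee_fin ger0_norm ?sqr_ge0// ger0_norm; last first.
  apply: addr_ge0; last by apply: mulr_ge0; rewrite ?sqr_ge0.
  by apply: mulr_ge0; rewrite ?sqr_ge0//; apply: mulr_ge0; rewrite ?sqr_ge0.
have := sqr_ge0 (a * omega x S - eta x S); nra.
Qed.

Lemma L2f0 : L2f (fun=> 0).
Proof.
split; first by rewrite (_ : (fun _ => _) = fun=> 0)//; apply/funext => x; rewrite ffunE.
rewrite (_ : (fun _ => _) = cst 0%E); first exact: integrable0.
by apply/funext => x; rewrite ffunE expr0n.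
Qed.

Lemma L2form_linear k a omega eta : L2form Omega k omega -> L2form Omega k eta ->
  L2form Omega k (fun x => a *: omega x + eta x).
Proof.
move=> [d1 h1] [d2 h2]; split; last exact: L2f_linear.
by move=> x; apply: of_degreeD => //; exact: of_degreeZ.
Qed.

Lemma L2form0 k : L2form Omega k (fun=> 0).
Proof. by split => [x|]; [exact: of_degree0|exact: L2f0]. Qed.

Lemma L2ip0l eta : L2ip (fun=> 0) eta = 0.
Proof.
rewrite /L2ip (@eq_Rintegral _ _ _ _ _ (cst 0)) => [|x _].
  by rewrite Rintegral_cst// mul0r.
by rewrite big1// => S _; rewrite ffunE mul0r.
Qed.

Lemma L2ip_scalel a omega eta : L2f omega -> L2f eta ->
  L2ip (fun x => a *: omega x) eta = a * L2ip omega eta.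
Proof.
move=> ho he; have := L2ip_linearl a ho L2f0 he.
by rewrite L2ip0l addr0 => <-; congr (L2ip _ _); apply/funext => x; rewrite addr0.
Qed.

Lemma L2f_sum (I : Type) (r : seq I) (t : I -> R) (e : I -> form) :
  (forall i, L2f (e i)) -> L2f (fun x => \sum_(i <- r) t i *: e i x).
Proof.
move=> he; elim: r => [|i r IH].
  by under eq_fun do rewrite big_nil; exact: L2f0.
by under eq_fun do rewrite big_cons; exact: L2f_linear.
Qed.

Lemma L2ip_suml (I : Type) (r : seq I) (t : I -> R) (e : I -> form) eta :
  (forall i, L2f (e i)) -> L2f eta ->
  L2ip (fun x => \sum_(i <- r) t i *: e i x) eta = \sum_(i <- r) t i * L2ip (e i) eta.
Proof.
move=> he heta; elim: r => [|i r IH].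
  rewrite big_nil (_ : (fun x => _) = (fun=> 0)) ?L2ip0l//.
  by apply/funext => x; rewrite big_nil.
rewrite (_ : (fun x => _) = fun x => t i *: e i x + \sum_(i <- r) t i *: e i x); last first.
  by apply/funext => x; rewrite big_cons.
by rewrite big_cons L2ip_linearl// ?IH//; exact: L2f_sum.
Qed.

Lemma L2ip_ae omega omega' eta : L2f omega -> L2f omega' -> L2f eta ->
  ae_eq mu Omega omega omega' -> L2ip omega eta = L2ip omega' eta.
Proof.
move=> h h' he E; rewrite /L2ip /Rintegral; congr fine.
apply: ae_eq_integral => //; try exact: measurable_int (L2ip_integrable _ _).
by apply: filterS E => x + Ox => /(_ Ox) ->.
Qed.

Lemma L2ip_ge0 omega : 0 <= L2ip omega omega.
Proof. by apply: Rintegral_ge0 => x _; apply: sumr_ge0 => S _; rewrite -expr2 sqr_ge0. Qed.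

Lemma L2ip_eq0 omega : L2f omega -> L2ip omega omega = 0 -> ae_eq mu Omega omega (fun=> 0).
Proof.
move=> h E; have I2 := L2ip_integrable h h.
have mh := measurable_int _ I2.
have : (\int[mu]_(x in Omega) `|(\sum_(S : {set 'I_n}) omega x S * omega x S)%:E| = 0)%E.
  under eq_integral => x _.
    rewrite gee0_abs; last by rewrite lee_fin sumr_ge0// => S _; rewrite -expr2 sqr_ge0.
    over.
  by rewrite -[LHS]fineK ?[fine _]E//; exact: integrable_fin_num.
move/(ae_eq_integral_abs _ mO mh).1; apply: filterS => x + Ox => /(_ Ox) [H].
apply/ffunP => S; rewrite ffunE; apply/eqP.
have /psumr_eq0P : forall T, true -> 0 <= omega x T * omega x T.
  by move=> T _; rewrite -expr2 sqr_ge0.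
by move=> /(_ H S isT)/eqP; rewrite mulf_eq0 orbb.
Qed.

End L2.

(** * Test forms *)

Section test_forms.
Context (R : realType) (n : nat) (Omega : set 'rV[R]_n).
Local Notation form := (Defs.form R n).
Local Notation mu := (@lebesgue_rV R n).
Hypotheses (oO : open Omega) (bO : bounded_set Omega).
Local Notation L2ip := (L2ip Omega).
Local Notation L2f := (L2f Omega).
Local Notation smoothf phi := (forall S : {set 'I_n}, smooth (fun x => phi x S)).

Let mO : measurable Omega := open_measurable_rV oO.

Lemma continuous_bounded_Omega (f : 'rV[R]_n -> R) : continuous f ->
  exists C, forall x, Omega x -> `|f x| <= C.
Proof.
move=> cf; have [M OM] := bounded_cube bO.
have [N [_ fN]] := compact_bounded (continuous_compact (continuous_subspaceT cf) (@compact_cube R n M)).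
exists (`|N| + 1) => x /OM xM; apply: (fN (`|N| + 1)); last by exists x.
by rewrite (le_lt_trans (ler_norm N))// ltrDl.
Qed.

Lemma bounded_integrable (f : 'rV[R]_n -> R) C : measurable_fun Omega f ->
  (forall x, Omega x -> `|f x| <= C) -> mu.-integrable Omega (EFin \o f).
Proof.
move=> mf fC; apply: measurable_bounded_integrable => //; first exact: mu_Omega.
by exists C; split=> [|N CN x Ox]; [exact: num_real|exact: le_trans (fC _ Ox) (ltW CN)].
Qed.

Lemma continuous_integrable (f : 'rV[R]_n -> R) : continuous f ->
  mu.-integrable Omega (EFin \o f).
Proof.
move=> cf; have [C fC] := continuous_bounded_Omega cf.
by apply: (bounded_integrable _ fC); exact: continuous_measurable_rV.
Qed.

Lemma bounded_L2f (omega : form) :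
  (forall S : {set 'I_n}, measurable_fun Omega (fun x => omega x S)) ->
  (forall S : {set 'I_n}, exists C, forall x, Omega x -> `|omega x S| <= C) -> L2f omega.
Proof.
move=> mo oC S; split => //; have [C SC] := oC S.
apply: (@bounded_integrable _ (C ^+ 2)); first exact: measurable_funX.
move=> x Ox; rewrite normrX lerXn2r ?nnegrE//; last exact: SC.
by apply: le_trans (SC x Ox).
Qed.

Lemma smooth_L2f (omega : form) : smoothf omega -> L2f omega.
Proof.
move=> so S; split.
  by apply: continuous_measurable_rV; exact: smooth_continuous.
have c2 : continuous (fun x => omega x S * omega x S).
  by apply: smooth_continuous; apply: smoothM; exact: so.
by have := continuous_integrable c2; under eq_fun do rewrite /= -expr2.
Qed.

(** The derivative vanishes off [K], so the integral over [Omega] is the one over the whole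
    space. *)
Lemma Rintegral_derive0 (f : 'rV[R]_n -> R) (K : set 'rV[R]_n) i :
  smooth f -> compact K -> K `<=` Omega -> (forall x, ~ K x -> f x = 0) ->
  Rintegral mu Omega ('D_(basis_vec R i) f) = 0.
Proof.
move=> sf cK KO f0.
have clK : closed K by apply: compact_closed => //; exact: norm_hausdorff.
have [M KM] := bounded_cube (compact_bounded cK).
rewrite /Rintegral integral_mkcond (eq_integral (fun x => ('D_(basis_vec R i) f x)%:E)).
  rewrite (@integral_derive0 _ _ _ _ M)//.
  - by move=> x; exact: smooth_derivable.
  - by apply: smooth_continuous; exact: smooth_derive.
  - by move=> x xM; apply: f0 => /KM.
move=> x _; rewrite patchE; case: ifPn => //; rewrite notin_setE => Ox.
by rewrite (derive_supp _ clK f0)// => /KO.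
Qed.

(** Integrability is carried along so that the finite sum in the Leibniz formula can be integrated
    term by term. *)
Let null (g : 'rV[R]_n -> R) :=
  mu.-integrable Omega (EFin \o g) /\ Rintegral mu Omega g = 0.

Let null_sum (I : Type) (r : seq I) (P : pred I) (g : I -> 'rV[R]_n -> R) :
  (forall l, P l -> null (g l)) -> null (fun x => \sum_(l <- r | P l) g l x).
Proof.
move=> hg; elim: r => [|l r [IH1 IH2]].
  rewrite (_ : (fun x => _) = cst 0); last by apply/funext => x; rewrite big_nil.
  by split; [exact: integrable0|rewrite Rintegral_cst// mul0r].
have [Pl|Pl] := boolP (P l); last first.
  rewrite (_ : (fun x => _) = (fun x => \sum_(l <- r | P l) g l x)) //.
  by apply/funext => x; rewrite big_cons (negPf Pl).
rewrite (_ : (fun x => _) = (fun x => g l x + \sum_(l <- r | P l) g l x)); last first.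
  by apply/funext => x; rewrite big_cons Pl.
have [g1 g2] := hg l Pl.
split; first exact: (integrableD mO g1 IH1).
by rewrite RintegralD// g2 IH2 addr0.
Qed.

Lemma smooth_ext_d (phi : form) : smoothf phi -> smoothf (ext_d phi).
Proof.
move=> sp U; rewrite (_ : (fun x => _) = fun x => \sum_(i in U)
    'D_(basis_vec R i) (fun y => phi y (U :\ i)%SET) x * pos_sign R i U).
  apply: smooth_sum => i _; apply: smoothM; last exact: smooth_cst.
  by apply: smooth_derive; exact: sp.
by apply/funext => x; rewrite ext_dE.
Qed.

Lemma smooth_cod (phi : form) : smoothf phi -> smoothf (cod phi).
Proof.
move=> sp T; rewrite (_ : (fun x => _) = fun x => (-1) * \sum_(i | i \notin T)
     'D_(basis_vec R i) (fun y => phi y (i |: T)%SET) x * pos_sign R i T).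
  apply: smoothM; first exact: smooth_cst.
  apply: smooth_sum => i _; apply: smoothM; last exact: smooth_cst.
  by apply: smooth_derive; exact: sp.
by apply/funext => x; rewrite ffunE mulN1r.
Qed.

(** Only [psi] has compact support; [phi] is merely smooth, so the formula applies to the polynomial
    representing a Whitney form on a cell. *)
Lemma cod_adjoint k (psi phi : form) : test_form Omega k psi -> smoothf phi ->
  L2ip (ext_d psi) phi = L2ip psi (cod phi).
Proof.
move=> [dpsi sp [K [cK KO psi0]]] sf.
apply/eqP; rewrite -subr_eq0; apply/eqP.
have i1 := L2ip_integrable mO (smooth_L2f (smooth_ext_d sp)) (smooth_L2f sf).
have i2 := L2ip_integrable mO (smooth_L2f sp) (smooth_L2f (smooth_cod sf)).
rewrite /L2ip -RintegralB//.
under eq_Rintegral do rewrite ext_d_cod_pairing//.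
suff [] : null (fun x => \sum_(T : {set 'I_n}) \sum_(i | i \notin T)
    'D_(basis_vec R i) (fun y => psi y T * phi y (i |: T)%SET) x * pos_sign R i T) by [].
apply: null_sum => T _; apply: null_sum => i _.
have sM : smooth (fun y => psi y T * phi y (i |: T)%SET) by apply: smoothM.
have I0 : mu.-integrable Omega (EFin \o 'D_(basis_vec R i) (fun y => psi y T * phi y (i |: T)%SET)).
  by apply: continuous_integrable; apply: smooth_continuous; exact: smooth_derive.
split.
  by apply: continuous_integrable; apply: smooth_continuous; apply: smoothM;
    [exact: smooth_derive|exact: smooth_cst].
rewrite RintegralZr// (Rintegral_derive0 i sM cK KO) ?mul0r//.
by move=> x /psi0 ->; rewrite ffunE mul0r.
Qed.

Lemma test_closed (K : set 'rV[R]_n) : compact K -> closed K.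
Proof. by apply: compact_closed; exact: norm_hausdorff. Qed.

Lemma ext_d_test k (phi : form) : test_form Omega k phi -> test_form Omega k.+1 (ext_d phi).
Proof.
move=> [dp sp [K [cK KO p0]]]; split.
- move=> x S Sk; rewrite ext_dE big1// => i iS.
  rewrite (_ : (fun y => _) = cst 0) ?derive_cst ?mul0r//.
  by apply/funext => y; apply: dp; move: Sk; rewrite (cards_D1 iS) eqSS.
- exact: smooth_ext_d.
- exists K; split => // x xK; apply/ffunP => S; rewrite ext_dE ffunE big1// => i _.
  rewrite (derive_supp _ (test_closed cK)) ?mul0r// => y /p0 ->.
  by rewrite ffunE.
Qed.

Lemma cod_test k (phi : form) : test_form Omega k.+1 phi -> test_form Omega k (cod phi).
Proof.
move=> [dp sp [K [cK KO p0]]]; split.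
- move=> x S Sk; rewrite ffunE big1 ?oppr0// => i iS.
  rewrite (_ : (fun y => _) = cst 0) ?derive_cst ?mul0r//.
  by apply/funext => y; apply: dp; rewrite cards_U1// eqSS.
- exact: smooth_cod.
- exists K; split => // x xK; apply/ffunP => S; rewrite !ffunE big1 ?oppr0// => i _.
  rewrite (derive_supp _ (test_closed cK)) ?mul0r// => y /p0 ->.
  by rewrite ffunE.
Qed.

Lemma test_L2form k (phi : form) : test_form Omega k phi -> L2form Omega k phi.
Proof. by move=> [dp sp _]; split => //; exact: smooth_L2f. Qed.

Lemma codiff_test k (phi : form) : test_form Omega k.+1 phi ->
  codiff Omega k.+1 phi (cod phi).
Proof.
move=> tp; have [_ sp _] := tp; split; [exact: test_L2form|exact/test_L2form/cod_test|].
by move=> psi tpsi; exact: cod_adjoint tpsi sp.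
Qed.

Lemma cbox_compact (a b : 'rV[R]_n) : compact (cbox a b).
Proof.
apply: bounded_closed_compact.
  exists (`|a| + `|b|); split; first exact: num_real.
  move=> N MN x xab /=; apply: (le_trans _ (ltW MN)).
  apply/rV_norm_le => [|i]; first by rewrite addr_ge0.
  have /andP[h1 h2] := xab i.
  have := rV_coord_le a i; rewrite ler_norml => /andP[h3 _].
  have := rV_coord_le b i; rewrite ler_norml => /andP[_ h4].
  have h5 := normr_ge0 a; have h6 := normr_ge0 b.
  rewrite ler_norml; apply/andP; split.
    by apply: le_trans h1; apply: le_trans h3; rewrite lerN2 lerDl.
  by apply: (le_trans h2); apply: (le_trans h4); rewrite lerDr.
rewrite (_ : cbox _ _ = \bigcap_i [set x : 'rV[R]_n | x ord0 i \in `[a ord0 i, b ord0 i]]); last first.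
  apply/seteqP; split=> x /= h i => [_|]; first by rewrite /= in_itv/=; exact: h.
  by have := h i I; rewrite /= in_itv.
apply: closed_bigI => i _.
apply: (@closed_comp _ _ (fun x : 'rV[R]_n => x ord0 i) `[a ord0 i, b ord0 i]%classic).
  by move=> x _; exact: coord_continuous.
exact: interval_closed.
Qed.

(** A bump times [dx S] isolates the component S and reduces the claim to the scalar fundamental
    lemma. The version local to [U] serves for single cells. *)
Lemma test_separates k (U : set 'rV[R]_n) (tau : form) : open U -> U `<=` Omega ->
  L2form Omega k tau ->
  (forall phi, test_form U k phi -> L2ip phi tau = 0) ->
  ae_eq mu U tau (fun=> 0).
Proof.
move=> oU UO [dt ht] h.
have mU : measurable U by exact: open_measurable_rV.
have A (S : {set 'I_n}) : {ae mu, forall x, U x -> tau x S = 0}.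
  have [Sk|Sk] := eqVneq #|S| k; last by apply: aeW => x _; exact: dt.
  have [mS iS] := ht S.
  (* On a bounded domain the constant 1 is square-integrable, hence square-integrable functions are
     integrable. *)
  have i1 : mu.-integrable Omega (EFin \o (fun x => tau x S)).
    have := @sqr_integrableM _ _ _ mO (cst 1) (fun x => tau x S) _ mS _ iS.
    rewrite (_ : (fun x => (cst 1 x * tau x S)%:E) = EFin \o (fun x => tau x S)).
      apply; first exact: measurable_cst.
      by apply: (@continuous_integrable (fun=> 1 ^+ 2)); exact: cst_continuous.
    by apply/funext => x; rewrite /= mul1r.
  apply: (@integral_bump_eq0 _ _ U (fun x => tau x S)) => //; first exact: integrableS i1.
  move=> a b m ab abU.
  pose phi : form := fun x => box_bump a b m x *: dx R S.
  have tphi : test_form U k phi.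
    split.
    - by move=> x; apply: of_degreeZ; rewrite -Sk; exact: of_degree_dx.
    - move=> T; rewrite (_ : (fun x => _) = fun x => box_bump a b m x * dx R S T).
        by apply: smoothM; [exact: smooth_box_bump|exact: smooth_cst].
      by apply/funext => x; rewrite /phi !ffunE.
    - exists (cbox a b); split => //; first exact: cbox_compact.
      move=> x xab; rewrite /phi box_bump_out ?scale0r// => /obox_sub.
      exact: xab.
  have out x : ~ U x -> box_bump a b m x = 0.
    by move=> Ux; apply: box_bump_out => // /obox_sub /abU.
  have E x : \sum_(T : {set 'I_n}) phi x T * tau x T = tau x S * box_bump a b m x.
    rewrite (bigD1 S)//= big1 ?addr0 => [|T TS].
      by rewrite /phi !ffunE eqxx [_ *: _]mulr1 mulrC.
    by rewrite /phi !ffunE (negPf TS) [_ *: _]mulr0 mul0r.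
  have ip : mu.-integrable Omega (EFin \o (fun x => tau x S * box_bump a b m x)).
    have := L2ip_integrable mO (smooth_L2f (let: And3 _ s _ := tphi in s)) ht.
    by under eq_fun do rewrite /= E.
  have := h _ tphi; rewrite /L2ip; under eq_Rintegral do rewrite E.
  move=> Z; have : (\int[mu]_(x in Omega) (tau x S * box_bump a b m x)%:E = 0)%E.
    by rewrite -[LHS]fineK ?[fine _]Z//; exact: integrable_fin_num.
  move=> <-; rewrite integral_mkcond [RHS]integral_mkcond; apply: eq_integral => x _.
  rewrite !patchE; case: ifPn => [|]; first by rewrite inE => /UO/mem_set ->.
  by rewrite notin_setE => /out ->; rewrite mulr0; case: ifP.
have : {ae mu, forall x, forall S : {set 'I_n}, U x -> tau x S = 0}.
  apply: (@filter_forall _ _ _ (almost_everywhere mu)) => S; exact: A.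
by apply: filterS => x h' Ux; apply/ffunP => S; rewrite ffunE; exact: h'.
Qed.

End test_forms.

(** * The weak codifferential *)

Section codiff_theory.
Context (R : realType) (n : nat) (Omega : set 'rV[R]_n).
Local Notation form := (Defs.form R n).
Local Notation mu := (@lebesgue_rV R n).
Hypotheses (oO : open Omega) (bO : bounded_set Omega).
Local Notation L2ip := (L2ip Omega).
Local Notation L2f := (L2f Omega).
Local Notation smoothf phi := (forall S : {set 'I_n}, smooth (fun x => phi x S)).
Local Notation codiff := (codiff Omega).

Let mO : measurable Omega := open_measurable_rV oO.

Lemma L2ip_linearr a omega omega' eta : L2f omega -> L2f omega' -> L2f eta ->
  L2ip eta (fun x => a *: omega x + omega' x) = a * L2ip eta omega + L2ip eta omega'.
Proof. by move=> h h' he; rewrite L2ipC L2ip_linearl// !(L2ipC Omega eta). Qed.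

Lemma test_L2f k phi : test_form Omega k phi -> L2f phi.
Proof. by move=> /(test_L2form oO bO)[]. Qed.

Lemma codiff_linear k a eta sigma eta' sigma' : codiff k eta sigma -> codiff k eta' sigma' ->
  codiff k (fun x => a *: eta x + eta' x) (fun x => a *: sigma x + sigma' x).
Proof.
move=> [h1 h2 h3] [g1 g2 g3]; split; [exact: L2form_linear|exact: L2form_linear|].
move=> phi tphi; have tf := test_L2f tphi; have te := test_L2f (ext_d_test tphi).
by rewrite !L2ip_linearr ?h3 ?g3//; (exact: h1.2 || exact: h2.2 || exact: g1.2 || exact: g2.2).
Qed.

Lemma codiff0 k : codiff k (fun=> 0) (fun=> 0).
Proof.
split; try exact: L2form0; move=> phi _.
by rewrite !(L2ipC _ _ (fun=> 0)) !L2ip0l.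
Qed.

Lemma L2ip_aer omega eta eta' : L2f omega -> L2f eta -> L2f eta' ->
  ae_eq mu Omega eta eta' -> L2ip omega eta = L2ip omega eta'.
Proof. by move=> h h1 h2 E; rewrite L2ipC (L2ip_ae mO h1 h2 h E) L2ipC. Qed.

Lemma codiff_ae k eta sigma eta' sigma' : codiff k eta sigma ->
  L2form Omega k eta' -> L2form Omega k.-1 sigma' ->
  ae_eq mu Omega eta eta' -> ae_eq mu Omega sigma sigma' -> codiff k eta' sigma'.
Proof.
move=> [h1 h2 h3] g1 g2 E1 E2; split => // phi tphi.
have tf := test_L2f tphi; have te := test_L2f (ext_d_test tphi).
by rewrite -(L2ip_aer te h1.2 g1.2 E1) h3// (L2ip_aer tf h2.2 g2.2 E2).
Qed.

Lemma ae_sub0 (D : set 'rV[R]_n) (f g : form) :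
  ae_eq mu D (fun x => (-1) *: f x + g x) (fun=> 0) -> ae_eq mu D g f.
Proof.
by apply: filterS => x + Dx => /(_ Dx) H; apply/eqP; rewrite -subr_eq0 addrC -scaleN1r H.
Qed.

Lemma codiff_unique k eta sigma sigma' : codiff k eta sigma -> codiff k eta sigma' ->
  ae_eq mu Omega sigma' sigma.
Proof.
move=> [_ s1 h] [_ s2 h']; apply: ae_sub0.
apply: (test_separates oO bO oO) => //; first exact: L2form_linear s1 s2.
move=> phi tphi; rewrite L2ip_linearr; [|exact: s1.2|exact: s2.2|exact: test_L2f tphi].
by rewrite -h// -h'// mulN1r addNr.
Qed.

(** Test forms supported in [U] see only the smooth [p], for which Green's formula yields [cod p];
    such test forms separate forms on [U]. *)
Lemma codiff_local k (U : set 'rV[R]_n) eta sigma (p : form) : open U -> U `<=` Omega ->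
  codiff k.+1 eta sigma -> smoothf p -> (forall x, of_degree k (cod p x)) ->
  ae_eq mu U eta p -> ae_eq mu U sigma (cod p).
Proof.
move=> oU UO [h1 h2 h3] sp dp E; apply: ae_sub0.
have Lp : L2f p by exact: smooth_L2f.
have Lc : L2form Omega k (cod p) by split => //; apply: smooth_L2f => //; exact: smooth_cod.
apply: (test_separates oO bO oU) => //; first exact: L2form_linear Lc h2.
move=> phi tphiU; have tphi : test_form Omega k phi.
  have [a b [K [cK KU p0]]] := tphiU; split => //; exists K; split => //.
  exact: subset_trans KU UO.
rewrite L2ip_linearr; [|exact: Lc.2|exact: h2.2|exact: test_L2f tphi].
rewrite -h3// -(cod_adjoint oO bO tphi sp).
rewrite mulN1r addrC; apply/eqP; rewrite subr_eq0; apply/eqP.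
have te := test_L2f (ext_d_test tphi).
rewrite /Defs.L2ip /Rintegral; congr fine; apply: ae_eq_integral => //.
- by apply: (measurable_int _ (L2ip_integrable mO te h1.2)).
- by apply: (measurable_int _ (L2ip_integrable mO te Lp)).
have [_ _ [K [_ KU e0]]] := ext_d_test tphiU.
apply: filterS E => x Ex Ox.
have [Ux|Ux] := pselect (U x); first by rewrite Ex.
rewrite e0; last by move=> /KU.
by rewrite !big1// => S _; rewrite ffunE mul0r.
Qed.

(** Testing against psi amounts to testing the original relation against d psi, and d d psi = 0. *)
Lemma codiff_codiff k eta sigma : codiff k.+2 eta sigma -> codiff k.+1 sigma (fun=> 0).
Proof.
move=> [h1 h2 h3]; split => //; first exact: L2form0.
move=> psi tpsi; rewrite -h3; last exact: ext_d_test.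
rewrite (_ : ext_d (ext_d psi) = fun=> 0); last first.
  by apply/funext => x; apply: ext_d_ext_d; case: tpsi.
by rewrite (L2ipC Omega psi) !L2ip0l.
Qed.

Local Notation nrm2 omega := (L2ip omega omega).

(** The parallelogram law, with the nonnegative square of - a u + v dropped. *)
Lemma nrm2_linear a u v : L2f u -> L2f v ->
  nrm2 (fun x => a *: u x + v x) <= 2 * a ^+ 2 * nrm2 u + 2 * nrm2 v.
Proof.
move=> hu hv; have huv := L2f_linear mO a hu hv; have huv' := L2f_linear mO (- a) hu hv.
have := L2ip_ge0 Omega (fun x => - a *: u x + v x).
rewrite !L2ip_linearl// !L2ip_linearr// (L2ipC Omega v u).
set p := L2ip u u; set q := L2ip u v; set r := L2ip v v => H.
rewrite -subr_ge0; apply: le_trans H _.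
by rewrite le_eqVlt; apply/orP; left; apply/eqP; ring.
Qed.

(** Squared graph norms avoid the square root, and differences are written as linear combinations so
    that the linearity lemmas apply to them. *)
Lemma Hstar0P k eta : Hstar0 Omega k eta <->
  exists2 sigma, codiff k eta sigma & forall e : R, 0 < e -> exists phi tau,
    [/\ test_form Omega k phi, codiff k phi tau &
        nrm2 (fun x => (-1) *: phi x + eta x) + nrm2 (fun x => (-1) *: tau x + sigma x) < e].
Proof.
have E (f g : form) : (fun x => f x - g x) = (fun x => (-1) *: g x + f x).
  by apply/funext => x; rewrite scaleN1r addrC.
split=> -[sigma h1 h2]; exists sigma => // e e0.
  have e1 : 0 < Num.sqrt e by rewrite sqrtr_gt0.
  have [phi [tau [t1 t2 t3]]] := h2 _ e1.
  exists phi, tau; split=> //; move: t3; rewrite !E ltr_sqrt//.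
have [phi [tau [t1 t2 t3]]] := h2 (e ^+ 2) (exprn_gt0 _ e0).
exists phi, tau; split=> //; rewrite !E -[ltRHS](ger0_norm (ltW e0)) -sqrtr_sqr.
by rewrite ltr_sqrt// exprn_gt0.
Qed.

Lemma Hstar0_linear k a eta eta' : Hstar0 Omega k eta -> Hstar0 Omega k eta' ->
  Hstar0 Omega k (fun x => a *: eta x + eta' x).
Proof.
move=> /Hstar0P[s h1 h2] /Hstar0P[s' h1' h2']; apply/Hstar0P.
exists (fun x => a *: s x + s' x); first exact: codiff_linear.
move=> e e0; pose c := 2 * a ^+ 2 + 2.
have a0 := sqr_ge0 a.
have c0 : 0 < c by rewrite /c ltr_wpDl// mulr_ge0.
(* With this tolerance for both approximations the estimate of [nrm2_linear] totals c * e / (2c) =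
   e/2; the summand 2 in c keeps it positive when a = 0. *)
have d0 : 0 < e / (2 * c) by rewrite divr_gt0// mulr_gt0.
have [phi [tau [t1 t2 t3]]] := h2 _ d0.
have [phi' [tau' [t1' t2' t3']]] := h2' _ d0.
exists (fun x => a *: phi x + phi' x), (fun x => a *: tau x + tau' x).
have [p1 p2 [K [cK KO p0]]] := t1; have [p1' p2' [K' [cK' KO' p0']]] := t1'.
split; last 2 first.
- exact: codiff_linear.
- have L2c k' o w : codiff k' o w -> L2f o /\ L2f w by move=> [[_ o1] [_ w1] _].
  have [l1 l2] := L2c _ _ _ h1; have [l1' l2'] := L2c _ _ _ h1'.
  have [m1 m2] := L2c _ _ _ t2; have [m1' m2'] := L2c _ _ _ t2'.
  have N (f g f' g' : form) : (fun x => (-1) *: (a *: f x + f' x) + (a *: g x + g' x)) =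
      fun x => a *: ((-1) *: f x + g x) + ((-1) *: f' x + g' x).
    by apply/funext => x; apply/ffunP => S; rewrite !ffunE /GRing.scale/=; ring.
  rewrite !N.
  have n1 := nrm2_linear a (L2f_linear mO (-1) m1 l1) (L2f_linear mO (-1) m1' l1').
  have n2 := nrm2_linear a (L2f_linear mO (-1) m2 l2) (L2f_linear mO (-1) m2' l2').
  apply: le_lt_trans (lerD n1 n2) _.
  rewrite (_ : _ + _ + _ = 2 * a ^+ 2 * (nrm2 (fun x => (-1) *: phi x + eta x) +
       nrm2 (fun x => (-1) *: tau x + s x)) + 2 * (nrm2 (fun x => (-1) *: phi' x + eta' x) +
       nrm2 (fun x => (-1) *: tau' x + s' x))); last by ring.
  apply: (@lt_le_trans _ _ (2 * a ^+ 2 * (e / (2 * c)) + 2 * (e / (2 * c)))).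
    apply: ler_ltD; last by rewrite ltr_pM2l.
    by apply: ler_wpM2l; [rewrite mulr_ge0|exact: ltW].
  rewrite -mulrDl -/c; move: (c) (c0) => c' c0'.
  have -> : c' * (e / (2 * c')) = e / 2 by field; rewrite gt_eqF.
  by rewrite ler_pdivrMr// mulr_natr mulr2n lerDl ltW.
- split.
  + by move=> x; apply: of_degreeD => //; exact: of_degreeZ.
  + move=> S; rewrite (_ : (fun x => _) = fun x => a * phi x S + phi' x S).
      by apply: smoothD => //; apply: smoothM => //; exact: smooth_cst.
    by apply/funext => x; rewrite !ffunE.
  + exists (K `|` K'); split; [exact: compactU|by move=> x [/KO|/KO']|].
    by move=> x xK; rewrite p0 ?p0' ?scaler0 ?addr0//; move=> h; apply: xK; [right|left].
Qed.

Lemma Hstar0_ae k eta eta' : Hstar0 Omega k eta -> L2form Omega k eta' ->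
  ae_eq mu Omega eta eta' -> Hstar0 Omega k eta'.
Proof.
move=> /Hstar0P[s h1 h2] l' E; apply/Hstar0P; exists s.
  by have [_ ls _] := h1; apply: (codiff_ae h1 l' ls E); exact: ae_eq_refl.
move=> e e0; have [phi [tau [t1 t2 t3]]] := h2 _ e0; exists phi, tau; split => //.
have lp := test_L2f t1; have [l _ _] := h1.
have E' : ae_eq mu Omega (fun x => (-1) *: phi x + eta' x) (fun x => (-1) *: phi x + eta x).
  by apply: filterS E => x + Ox => /(_ Ox) ->.
have l1 := L2f_linear mO (-1) lp l'.2; have l2 := L2f_linear mO (-1) lp l.2.
by rewrite (L2ip_ae mO l1 l2 l1 E') (L2ip_aer l2 l1 l2 E').
Qed.

(** If test forms phi approximate eta in the graph norm, the test forms delta phi approximate delta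
    eta in L2. Since delta delta = 0, this is already convergence in the graph norm. *)
Lemma Hstar0_codiff k eta sigma : Hstar0 Omega k.+2 eta -> codiff k.+2 eta sigma ->
  Hstar0 Omega k.+1 sigma.
Proof.
move=> /Hstar0P[s h1 h2] hs; have Es := codiff_unique h1 hs.
apply: (@Hstar0_ae _ s); [|by case: hs|exact: ae_eq_sym].
apply/Hstar0P; exists (fun=> 0); first exact: codiff_codiff h1.
move=> e e0; have [phi [tau [t1 t2 t3]]] := h2 _ e0.
have tc := cod_test t1.
exists (cod phi), (fun=> 0); split=> //.
  exact: codiff_codiff (codiff_test oO bO t1).
have Et := codiff_unique (codiff_test oO bO t1) t2.
have lt := test_L2f tc; have [_ [_ lt2] _] := t2; have [_ [_ ls] _] := h1.
have E' : ae_eq mu Omega (fun x => (-1) *: cod phi x + s x) (fun x => (-1) *: tau x + s x).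
  by apply: filterS Et => x + Ox => /(_ Ox) ->.
have l1 := L2f_linear mO (-1) lt ls; have l2 := L2f_linear mO (-1) lt2 ls.
rewrite (L2ip_ae mO l1 l2 l1 E') (L2ip_aer l2 l1 l2 E').
rewrite (_ : (fun x => -1 *: 0 + 0) = (fun=> 0)); last by apply/funext => x; rewrite scaler0 addr0.
by rewrite L2ip0l// addr0; apply: le_lt_trans t3; rewrite lerDr L2ip_ge0.
Qed.

Lemma Hstar_codiff k eta sigma : codiff k.+2 eta sigma -> Hstar Omega k.+1 sigma.
Proof. by move=> h; exists (fun=> 0); exact: codiff_codiff h. Qed.

Lemma Hstar_linear k a eta eta' : Hstar Omega k eta -> Hstar Omega k eta' ->
  Hstar Omega k (fun x => a *: eta x + eta' x).
Proof. by move=> [s h] [s' h']; exists (fun x => a *: s x + s' x); exact: codiff_linear. Qed.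

Lemma Hstar_ae k eta eta' : Hstar Omega k eta -> L2form Omega k eta' ->
  ae_eq mu Omega eta eta' -> Hstar Omega k eta'.
Proof.
move=> [s h] l' E; exists s; have [_ ls _] := h.
by apply: (codiff_ae h l' ls E); exact: ae_eq_refl.
Qed.

Lemma Hstar0_Hstar k eta : Hstar0 Omega k eta -> Hstar Omega k eta.
Proof. by move=> [s h _]; exists s. Qed.

End codiff_theory.

(** * Simplices *)

Section barycentric.
Context (R : realType) (n : nat).

(** Homogeneous coordinates (1, x): affine independence of n+1 points becomes invertibility of the
    square matrix [vmx] of the extended vertices. *)
Let ext1 (x : 'rV[R]_n) : 'rV[R]_n.+1 :=
  \row_c (if unlift ord0 c is Some i then x ord0 i else 1).

Let ext1_0 x : ext1 x ord0 ord0 = 1.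
Proof. by rewrite mxE unlift_none. Qed.

Let ext1_lift x i : ext1 x ord0 (lift ord0 i) = x ord0 i.
Proof. by rewrite mxE liftK. Qed.

Let vmx (p : 'I_n.+1 -> 'rV[R]_n) : 'M[R]_n.+1 := \matrix_(v, c) ext1 (p v) ord0 c.

Let mul_vmx (p : 'I_n.+1 -> 'rV[R]_n) (t : 'rV[R]_n.+1) (x : 'rV[R]_n) (s : R) :
  t *m vmx p = \row_c (if unlift ord0 c is Some i then x ord0 i else s) <->
  \sum_v t ord0 v = s /\ \sum_v t ord0 v *: p v = x.
Proof.
split=> [/rowP H|[H1 H2]].
  split; first by have := H ord0; rewrite !mxE unlift_none => <-; apply: eq_bigr => v _;
    rewrite mxE ext1_0 mulr1.
  apply/rowP => i; have := H (lift ord0 i); rewrite !mxE liftK => <-.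
  by rewrite summxE; apply: eq_bigr => v _; rewrite !mxE liftK.
apply/rowP => c; rewrite !mxE; have [i ->|->] := unliftP ord0 c.
  by rewrite -H2 summxE; apply: eq_bigr => v _; rewrite !mxE liftK.
by rewrite -H1; apply: eq_bigr => v _; rewrite mxE ext1_0 mulr1.
Qed.

(** The coordinates are the entries of (1, x) times the inverse vertex matrix; the first row of the
    inverse gives the constant terms, the other rows the gradients. *)
Lemma barycentric (p : 'I_n.+1 -> 'rV[R]_n) : aff_indep p ->
  exists (b : 'I_n.+1 -> R) (a : 'I_n.+1 -> 'rV[R]_n),
    [/\ forall x, \sum_v (b v + lin (a v) x) = 1,
        forall x, \sum_v (b v + lin (a v) x) *: p v = x &
        forall t x, \sum_v t v = 1 -> \sum_v t v *: p v = x ->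
          forall v, t v = b v + lin (a v) x].
Proof.
move=> hp; have M1 : vmx p \in unitmx.
  rewrite -row_free_unit -kermx_eq0; apply/eqP/row_matrixP => i; rewrite row0.
  set u := row i _; have uM : u *m vmx p = 0 by rewrite -row_mul mulmx_ker row0.
  have E0 : (0 : 'rV[R]_n.+1) =
      \row_c (if unlift ord0 c is Some i then (0 : 'rV[R]_n) ord0 i else 0).
    by apply/rowP => c; rewrite !mxE; case: unlift => // j; rewrite mxE.
  rewrite {}E0 in uM; have /mul_vmx[h1 h2] := uM; apply/rowP => v; rewrite [RHS]mxE.
  exact: (hp (fun v => u ord0 v) h1 h2).
pose N := invmx (vmx p).
pose b v := N ord0 v; pose a v : 'rV[R]_n := \row_i N (lift ord0 i) v.
have L x v : (ext1 x *m N) ord0 v = b v + lin (a v) x.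
  rewrite mxE big_ord_recl ext1_0 mul1r; congr (_ + _).
  by apply: eq_bigr => i _; rewrite ext1_lift mxE mulrC.
have H x : ext1 x *m N *m vmx p = ext1 x by rewrite mulmxKV.
exists b, a; split=> [x|x|t x t1 tx v].
- have /mul_vmx[<- _] := H x; apply: eq_bigr => v _; by rewrite L.
- have /mul_vmx[_ E] := H x; rewrite -[RHS]E; apply: eq_bigr => v _; by rewrite L.
- pose T : 'rV[R]_n.+1 := \row_v t v.
  have E : T *m vmx p = ext1 x.
    apply/mul_vmx; split; first by rewrite -t1; apply: eq_bigr => w _; rewrite mxE.
    by rewrite -tx; apply: eq_bigr => w _; rewrite mxE.
  by rewrite -L -E mulmxK// mxE.
Qed.

End barycentric.

Section cells.
Context (R : realType) (n : nat).
Hypothesis n0 : (0 < n)%N.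
Local Notation mu := (@lebesgue_rV R n).
Variables (p : 'I_n.+1 -> 'rV[R]_n) (b : 'I_n.+1 -> R) (a : 'I_n.+1 -> 'rV[R]_n).
Hypotheses (ba1 : forall x, \sum_v (b v + lin (a v) x) = 1)
  (bap : forall x, \sum_v (b v + lin (a v) x) *: p v = x)
  (bau : forall t x, \sum_v t v = 1 -> \sum_v t v *: p v = x ->
          forall v, t v = b v + lin (a v) x).

Lemma hullE (A : pred 'I_n.+1) : hull p A =
  [set x | (forall v, 0 <= b v + lin (a v) x) /\ (forall v, ~~ A v -> b v + lin (a v) x = 0)].
Proof.
apply/seteqP; split=> x.
  move=> [t [t0 tA t1 tx]].
  by split=> v => [|Av]; rewrite -(bau t1 (esym tx)) ?t0// tA.
move=> [h1 h2]; exists (fun v => b v + lin (a v) x); split => //.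
Qed.

Lemma bary_vertex v w : b v + lin (a v) (p w) = (v == w)%:R.
Proof.
rewrite -(@bau (fun v => (v == w)%:R) (p w))//.
  by rewrite (bigD1 w)//= eqxx big1 ?addr0// => u /negPf ->.
by rewrite (bigD1 w)//= eqxx scale1r big1 ?addr0// => u /negPf ->; rewrite scale0r.
Qed.

(** The coordinate is 1 at its own vertex and 0 at another one, which exists because n > 0. *)
Lemma bary_nonconst v : a v != 0.
Proof.
have [w wv] : exists w, w != v.
  have [->|] := eqVneq v ord0; last by exists ord0; rewrite eq_sym.
  by exists ord_max; rewrite -val_eqE /= -lt0n.
apply/eqP => av.
have lin0 x : lin (a v) x = 0.
  by rewrite av /lin big1// => i _; rewrite mxE mul0r.
have E1 : b v = 1 by rewrite -[LHS]addr0 -(lin0 (p v)) bary_vertex eqxx.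
have E2 : b v = 0 by rewrite -[LHS]addr0 -(lin0 (p w)) bary_vertex eq_sym (negPf wv).
by move: E1; rewrite E2 => /eqP; rewrite eq_sym oner_eq0.
Qed.

Lemma affine_null (c : R) (d : 'rV[R]_n) : d != 0 ->
  mu.-negligible [set x | c + lin d x = 0].
Proof.
move=> d0; exists [set x | lin d x = - c]; split => //.
- exact: measurable_hyperplane.
- exact: hyperplane_null.
- by move=> x /= /eqP; rewrite addrC addr_eq0 => /eqP.
Qed.

(** A proper face lies in the hyperplane where the barycentric coordinate of an omitted vertex
    vanishes. *)
Lemma face_null (A : pred 'I_n.+1) v : ~~ A v -> mu.-negligible (hull p A).
Proof.
move=> Av; rewrite hullE; apply: negligibleS (affine_null (b v) (bary_nonconst v)).
by move=> x [_ h]; exact: h.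
Qed.

Definition ocell : set 'rV[R]_n := [set x | forall v, 0 < b v + lin (a v) x].

Lemma continuous_affine (c : R) (d : 'rV[R]_n) : continuous (fun x => c + lin d x).
Proof. by apply: smooth_continuous; exact: smooth_affine. Qed.

Lemma open_ocell : open ocell.
Proof.
rewrite openE => x xo; rewrite /interior.
have : \forall y \near x, forall v, 0 < b v + lin (a v) y.
  apply: (@filter_forall _ _ (fun v y => 0 < b v + lin (a v) y) (nbhs x)) => v.
  have : (fun y => b v + lin (a v) y) @ x --> b v + lin (a v) x by exact: continuous_affine.
  move/cvgr_gt; apply; exact: xo.
by apply: filterS => y.
Qed.

Lemma ocell_sub : ocell `<=` hull p predT.
Proof. by move=> x xo; rewrite hullE; split => // v; exact: ltW. Qed.

Lemma ocell_interior : ocell `<=` interior (hull p predT).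
Proof. by rewrite -open_subsetE; [exact: ocell_sub|exact: open_ocell]. Qed.

Lemma measurable_hull (A : pred 'I_n.+1) : measurable (hull p A).
Proof.
rewrite hullE; rewrite (_ : [set _ | _] =
  (\bigcap_(v in @setT 'I_n.+1) [set x | 0 <= b v + lin (a v) x]) `&`
  \bigcap_(v in [set v | ~~ A v]) [set x | b v + lin (a v) x = 0]); last first.
  apply/seteqP; split=> x [h1 h2]; split=> v.
  - by move=> _; exact: h1.
  - by move=> Av; exact: h2.
  - exact: h1.
  - exact: h2.
have mA v : measurable_fun setT (fun x => b v + lin (a v) x).
  by apply: continuous_measurable_rV; exact: continuous_affine.
apply: measurableI; (apply: fin_bigcap_measurable; [exact: finite_finset|]) => v _.
  rewrite (_ : [set _ | _] = (fun x => b v + lin (a v) x) @^-1` `[0, +oo[%classic).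
    by rewrite -[X in measurable X]setTI; exact: mA.
  by apply/seteqP; split=> x /=; rewrite in_itv/= andbT.
rewrite (_ : [set _ | _] = (fun x => b v + lin (a v) x) @^-1` [set 0]) //.
by rewrite -[X in measurable X]setTI; exact: mA.
Qed.

Lemma cell_ocell_null : mu.-negligible (hull p predT `\` ocell).
Proof.
apply: (@negligibleS _ _ _ _ (\big[setU/set0]_v [set x | b v + lin (a v) x = 0])).
  move=> x; rewrite hullE => -[[h1 _] /existsNP[v h2]].
  rewrite (bigD1 v)//=; left.
  by apply/eqP; rewrite eq_le h1 andbT leNgt; exact/negP.
elim/big_ind: _ => //; [exact: negligible_set0|exact: negligibleU|].
by move=> v _; apply: affine_null; exact: bary_nonconst.
Qed.

End cells.

(** * Duality in finite dimension *)

Section double_orthogonal.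
Context (R : realType) (I : finType).
Implicit Types (S : set (I -> R)) (t u v : I -> R).

Definition dot u v : R := \sum_i u i * v i.

Definition lin_closed S := S (fun=> 0) /\
  forall a u v, S u -> S v -> S (fun i => a * u i + v i).

Let vec (w : 'rV[R]_#|I|) : I -> R := fun i => w ord0 (enum_rank i).
Let row_of v : 'rV[R]_#|I| := \row_j v (enum_val j).

Let row_ofK v : vec (row_of v) = v.
Proof. by apply/funext => i; rewrite /vec mxE enum_rankK. Qed.

Let sub_closed S m (B : 'M[R]_(m, #|I|)) (w : 'rV[R]_#|I|) : lin_closed S ->
  (forall i, S (vec (row i B))) -> (w <= B)%MS -> S (vec w).
Proof.
move=> [S0 Sl] SB /submxP[c ->]; rewrite mulmx_sum_row.
elim/big_ind : _ => [|x y Sx Sy|i _].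
- rewrite (_ : vec 0 = fun=> 0) //; apply/funext => i; by rewrite /vec mxE.
- rewrite (_ : vec (x + y) = fun i => 1 * vec x i + vec y i); first exact: Sl.
  by apply/funext => i; rewrite /vec mxE mul1r.
- rewrite (_ : vec _ = fun l => c ord0 i * vec (row i B) l + (fun=> 0) l); first exact: Sl.
  by apply/funext => l; rewrite /vec mxE addr0.
Qed.

(** [S] is the row space of a matrix of maximal rank with rows in [S]. The columns of its cokernel
    matrix are orthogonal to [S], and a vector orthogonal to all of them lies in the row space. *)
Lemma double_orthogonal S v : lin_closed S ->
  (forall t, (forall u, S u -> dot t u = 0) -> dot t v = 0) -> S v.
Proof.
move=> Slin Sv.
(* The ranks attained by square matrices with rows in [S]; they are bounded by the dimension, so a
   largest one exists, and adjoining a vector of [S] cannot raise it. *)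
pose P r := `[< exists A : 'M[R]_#|I|, (forall i, S (vec (row i A))) /\ \rank A = r >].
have P0 : exists r, P r.
  exists 0%N; apply/asboolP; exists 0; split; last exact: mxrank0.
  move=> i; rewrite row0 (_ : vec 0 = fun=> 0); first by case: Slin.
  by apply/funext => l; rewrite /vec mxE.
have Pmax r : P r -> (r <= #|I|)%N by move=> /asboolP[A [_ <-]]; exact: rank_leq_col.
case: (ex_maxnP P0 Pmax) => r /asboolP[A [SA rA]] rmax.
have SleA u : S u -> (row_of u <= A)%MS.
  move=> Su; pose B := col_mx A (row_of u).
  have SB i : S (vec (row i B)).
    rewrite /B; case: (split_ordP i) => j ->; first by rewrite rowKu.
    by rewrite rowKd (ord1 j) row_id row_ofK.
  have : P (\rank <<B>>%MS).
    apply/asboolP; exists <<B>>%MS; split => // i.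
    by apply: (sub_closed Slin SB); rewrite (submx_trans (row_sub _ _))// genmxE.
  move=> /rmax; rewrite mxrank_gen -rA => rBA.
  have AB : (A <= B)%MS by rewrite -addsmxE addsmxSl.
  have /andP[_ BA] : (A == B)%MS by rewrite -(geq_leqif (mxrank_leqif_eq AB)).
  by apply: submx_trans BA; rewrite -addsmxE addsmxSr.
rewrite -(row_ofK v); apply: (sub_closed Slin SA); rewrite submxE.
apply/eqP/rowP => j; rewrite [RHS]mxE mxE.
pose t i := cokermx A (enum_rank i) j.
have dotE u : dot t u = (row_of u *m cokermx A) ord0 j.
  rewrite mxE [RHS](reindex (@enum_rank I))/=; last first.
    by apply: onW_bij; exact: enum_rank_bij.
  by apply: eq_bigr => i _; rewrite /t [X in _ = X * _]mxE enum_rankK mulrC.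
have := Sv t; rewrite dotE mxE; apply => u Su.
by rewrite dotE; have /eqP -> : row_of u *m cokermx A == 0; rewrite ?mxE// -submxE SleA.
Qed.

(** Apply [double_orthogonal] to the sum of [S] and its orthogonal: a vector orthogonal to that sum
    is orthogonal to [S], hence belongs to the sum and is orthogonal to itself. *)
Lemma orthogonal_projection S v : lin_closed S ->
  exists2 u, S u & forall w, S w -> dot (fun i => v i - u i) w = 0.
Proof.
move=> Slin; have [S0 Sl] := Slin.
pose Q : set (I -> R) := [set x | exists u z,
  [/\ S u, (forall w, S w -> dot z w = 0) & x = fun i => u i + z i]].
have dotl a u v' w : dot (fun i => a * u i + v' i) w = a * dot u w + dot v' w.
  by rewrite /dot mulr_sumr -big_split/=; apply: eq_bigr => i _; ring.
have dot0 w : dot (fun=> 0) w = 0 by rewrite /dot big1// => i _; rewrite mul0r.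
have Qlin : lin_closed Q.
  split.
    by exists (fun=> 0), (fun=> 0); split => //; apply/funext => i; rewrite addr0.
  move=> a _ _ [u [z [Su Sz ->]]] [u' [z' [Su' Sz' ->]]].
  exists (fun i => a * u i + u' i), (fun i => a * z i + z' i); split; first exact: Sl.
    by move=> w Sw; rewrite dotl Sz// Sz'// mulr0 addr0.
  by apply/funext => i; ring.
suff [u [z [Su Sz vE]]] : Q v.
  exists u => // w Sw; rewrite (_ : (fun i => v i - u i) = z); first exact: Sz.
  by apply/funext => i; rewrite vE addrC addKr.
apply: double_orthogonal => // t tQ.
have tS u : S u -> dot t u = 0.
  by move=> Su; apply: tQ; exists u, (fun=> 0); split => //; apply/funext => i; rewrite addr0.
have : dot t t = 0.
  by apply: tQ; exists (fun=> 0), t; split => //; apply/funext => i; rewrite add0r.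
rewrite /dot => /psumr_eq0P H.
rewrite big1// => i _; have t2 l : true -> 0 <= t l * t l by rewrite -expr2 sqr_ge0.
have /eqP := H t2 i isT.
by rewrite mulf_eq0 orbb => /eqP ->; rewrite mul0r.
Qed.

End double_orthogonal.

(** * The cells of a subdivision *)

Section subdivision.
Context (R : realType) (n : nat) (n0 : (0 < n)%N) (Omega : set 'rV[R]_n).
Local Notation form := (Defs.form R n).
Local Notation mu := (@lebesgue_rV R n).
Hypotheses (oO : open Omega) (bO : bounded_set Omega).
Context (N : nat) (V : 'I_N -> 'I_n.+1 -> 'rV[R]_n).
Hypothesis hV : simplicial_subdivision Omega V.
Local Notation cell j := (hull (V j) predT).
Local Notation L2ip := (L2ip Omega).
Local Notation L2f := (L2f Omega).

Let mO : measurable Omega := open_measurable_rV oO.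

Lemma cell_interior j : exists U, [/\ open U, U `<=` cell j, U `<=` Omega &
  mu.-negligible (cell j `\` U)].
Proof.
have [aff _ intO _ _] := hV.
have [b [a [h1 h2 h3]]] := barycentric (aff j).
exists (ocell b a); split.
- exact: open_ocell.
- exact: (ocell_sub h1 h2 h3).
- by move=> x /(ocell_interior h1 h2 h3)/intO.
- exact: (cell_ocell_null n0 h1 h2 h3).
Qed.

Lemma measurable_cell j : measurable (cell j).
Proof.
have [aff _ _ _ _] := hV; have [b [a [h1 h2 h3]]] := barycentric (aff j).
exact: (measurable_hull h1 h2 h3 _).
Qed.

(** The intersection is a face of both cells. If it is proper in one of them it is null; if it is
    full in both, the cells coincide, against injectivity. *)
Lemma cell_overlap i j : i != j -> mu.-negligible (cell i `&` cell j).
Proof.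
move=> ij; have [aff _ _ injV /(_ i j)[A [B [EA EB]]]] := hV.
have face l (C : pred 'I_n.+1) v : ~~ C v -> mu.-negligible (hull (V l) C).
  have [b [a [h1 h2 h3]]] := barycentric (aff l).
  by move=> Cv; exact: (face_null n0 h1 h2 h3 Cv).
have [AT|/existsNP[v /negP]] := pselect (forall v, A v); last by rewrite EA; exact: face.
have [BT|/existsNP[v /negP]] := pselect (forall v, B v); last by rewrite EA EB; exact: face.
have full l (C : pred 'I_n.+1) : (forall v, C v) -> hull (V l) C = cell l.
  by move=> CT; congr hull; apply/funext => v; rewrite CT.
by have := injV i j; rewrite -(full i A AT) -(full j B BT) => /(_ EB) E; rewrite E eqxx in ij.
Qed.

(** Cells lie only in the closure of [Omega]; the part outside [Omega] misses the open simplex and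
    is therefore null. *)
Lemma ae_cell_Omega j : {ae mu, forall x, cell j x -> Omega x}.
Proof.
have [U [_ _ UO Un]] := cell_interior j.
apply: negligibleS Un => x /= /not_implyP[xj xO]; split => // /UO.
exact: xO.
Qed.

Lemma Omega_cell x : Omega x -> exists j, cell j x.
Proof.
move=> Ox; have [_ E _ _ _] := hV.
by have : closure Omega x by [exact: subset_closure]; rewrite E => -[j _ jx]; exists j.
Qed.

Lemma ae_all (I : finType) (P : I -> 'rV[R]_n -> Prop) :
  (forall i, {ae mu, forall x, P i x}) -> {ae mu, forall x, forall i, P i x}.
Proof. by move=> h; apply: (@filter_forall _ _ P (almost_everywhere mu)). Qed.

Lemma ae_cell_unique : {ae mu, forall x, forall i j, cell i x -> cell j x -> i = j}.
Proof.
apply: ae_all => i; apply: ae_all => j; have [->|ij] := eqVneq i j; first exact: aeW.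
by apply: negligibleS (cell_overlap ij) => x /= /not_implyP[xi /not_implyP[xj _]].
Qed.

Lemma ae_Omega (P : 'rV[R]_n -> Prop) :
  (forall j, {ae mu, forall x, cell j x -> P x}) -> {ae mu, forall x, Omega x -> P x}.
Proof.
by move=> /ae_all; apply: filterS => x h /Omega_cell[j /h].
Qed.

Lemma ae_cell (P : 'rV[R]_n -> Prop) j :
  {ae mu, forall x, Omega x -> P x} -> {ae mu, forall x, cell j x -> P x}.
Proof. by apply: filterS2 (ae_cell_Omega j) => x h1 h2 /h1 /h2. Qed.

Lemma ae_null_cell (P : 'rV[R]_n -> Prop) j : mu.-negligible (cell j) ->
  {ae mu, forall x, cell j x -> P x}.
Proof. by apply: negligibleS => x /= /not_implyP[]. Qed.

Lemma ae_ocell (P : 'rV[R]_n -> Prop) j (U : set 'rV[R]_n) : mu.-negligible (cell j `\` U) ->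
  {ae mu, forall x, U x -> P x} -> {ae mu, forall x, cell j x -> P x}.
Proof.
move=> h1 h2; have : {ae mu, forall x, cell j x -> U x}.
  by apply: negligibleS h1 => x /= /not_implyP[].
by apply: filterS2 h2 => x h3 h4 /h4/h3.
Qed.

Lemma cell_subset_null (P : 'rV[R]_n -> Prop) j (Q : set 'rV[R]_n) :
  {ae mu, forall x, cell j x -> P x} -> mu.-negligible Q ->
  (forall x, cell j x -> P x -> Q x) -> mu.-negligible (cell j).
Proof.
move=> h1 h2 h3; apply: negligibleS (negligibleU h1 h2) => x xj.
by have [Px|Px] := pselect (P x); [right; exact: h3|left => /(_ xj)].
Qed.

(** The null alternative is harmless: by [ae_null_cell] any statement almost everywhere on a null
    cell holds. *)
Lemma const_ae0 j (c : covector R n) : {ae mu, forall x, cell j x -> c = 0} ->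
  mu.-negligible (cell j) \/ c = 0.
Proof.
move=> h; have [->|c0] := eqVneq c 0; [by right|left].
apply: (@cell_subset_null (fun=> c = 0) j set0 h) => [|x _ E]; first exact: negligible_set0.
by rewrite E eqxx in c0.
Qed.

(** If c' is nonzero, some component of the form is a nonconstant affine function, and the cell is
    then almost contained in a hyperplane. *)
Lemma koszul_ae0 j k (c c' : covector R n) : of_degree k.+1 c' ->
  {ae mu, forall x, cell j x -> c + koszul x c' = 0} -> mu.-negligible (cell j) \/ c' = 0.
Proof.
(* Every coefficient of c' occurs up to sign in some [kcoef]: its index set has k+1 > 0 elements, so
   an index i can be removed. *)
move=> dc' h; have [kT|/existsNP[T /eqP kT]] := pselect (forall T, kcoef c' T = 0).
  right; apply: covector_eq0 => U; have [Uk|Uk] := eqVneq #|U| k.+1; last exact: dc'.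
  have [i iU] : exists i, i \in U by apply/set0Pn; rewrite -card_gt0 Uk.
  have /rowP/(_ i) := kT (U :\ i)%SET.
  rewrite !mxE !inE eqxx /= finset.setD1K// => /eqP.
  by rewrite mulf_eq0 /pos_sign signr_eq0 orbF => /eqP.
left; apply: (@cell_subset_null (fun x => c + koszul x c' = 0) j _ h (affine_null (c T) kT)) => x _ E.
by have /ffunP/(_ T) := E; rewrite !ffunE koszul_lin.
Qed.

Lemma P1m_linear k a (p q : form) : P1m k p -> P1m k q -> P1m k (fun x => a *: p x + q x).
Proof.
move=> [c [c' [dc dc' ->]]] [e [e' [de de' ->]]].
exists (a *: c + e), (a *: c' + e'); split.
- by apply: of_degreeD => //; exact: of_degreeZ.
- by apply: of_degreeD => //; exact: of_degreeZ.
- by apply/funext => x; rewrite koszul_linear scalerDr addrACA.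
Qed.

Lemma P1m0 k : P1m k (fun=> 0 : covector R n).
Proof.
exists 0, 0; split; [exact: of_degree0|exact: of_degree0|].
apply/funext => x; rewrite add0r; apply/ffunP => S.
by rewrite koszulE ffunE big1// => i _; rewrite ffunE !mul0r.
Qed.

Lemma P1m_ext_d k (p : form) : P1m k p -> exists2 c', of_degree k.+1 c' &
  ext_d p = (fun=> k.+1%:R *: c').
Proof.
move=> [c [c' [dc dc' ->]]]; exists c' => //.
by apply/funext => x; rewrite (ext_d_P1m c x dc').
Qed.

Lemma ext_d_linear k a (p q : form) : P1m k p -> P1m k q ->
  ext_d (fun x => a *: p x + q x) = fun x => a *: ext_d p x + ext_d q x.
Proof.
move=> [c [c' [dc dc' ->]]] [e [e' [de de' ->]]].
rewrite (_ : (fun x => a *: (c + koszul x c') + (e + koszul x e')) =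
  fun x => (a *: c + e) + koszul x (a *: c' + e')); last first.
  by apply/funext => x; rewrite koszul_linear scalerDr addrACA.
have dd : of_degree k.+1 (a *: c' + e') by apply: of_degreeD => //; exact: of_degreeZ.
apply/funext => x; rewrite (ext_d_P1m _ x dd) (ext_d_P1m c x dc') (ext_d_P1m e x de').
by rewrite scalerDr !scalerA mulrC.
Qed.

Lemma d_h_linear k a omega theta omega' theta' :
  d_h Omega V k omega theta -> d_h Omega V k omega' theta' ->
  d_h Omega V k (fun x => a *: omega x + omega' x) (fun x => a *: theta x + theta' x).
Proof.
move=> [l1 l2 h] [l1' l2' h']; split; try exact: L2form_linear.
move=> j; have [p [Pp E1 E2]] := h j; have [p' [Pp' E1' E2']] := h' j.
exists (fun x => a *: p x + p' x); split; first exact: P1m_linear.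
  by apply: filterS2 E1 E1' => x e1 e2 xj; rewrite e1// e2.
apply: filterS2 E2 E2' => x e1 e2 xj; rewrite e1// e2//.
by rewrite (ext_d_linear _ Pp Pp').
Qed.

Lemma d_h0 k : d_h Omega V k (fun=> 0) (fun=> 0).
Proof.
split; try exact: L2form0; move=> j; exists (fun=> 0); split; [exact: P1m0|exact: ae_eq_refl|].
apply: aeW => x _; apply/ffunP => U; rewrite ext_dE [LHS]ffunE big1// => i _.
rewrite (_ : (fun y => _) = cst 0) ?derive_cst ?mul0r//.
by apply/funext => y; rewrite ffunE.
Qed.

Lemma d_h_sum k (I : Type) (r : seq I) (t : I -> R) (e th : I -> form) :
  (forall i, d_h Omega V k (e i) (th i)) ->
  d_h Omega V k (fun x => \sum_(i <- r) t i *: e i x) (fun x => \sum_(i <- r) t i *: th i x).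
Proof.
move=> h; elim: r => [|i r IH].
  rewrite (_ : (fun x => _) = fun=> 0); last by apply/funext => x; rewrite big_nil.
  rewrite (_ : (fun x => _) = fun=> 0); last by apply/funext => x; rewrite big_nil.
  exact: d_h0.
under eq_fun do rewrite big_cons; under [X in d_h _ _ _ _ X]eq_fun do rewrite big_cons.
exact: d_h_linear.
Qed.

(** Two graphs may use different polynomials on a cell. By linearity their difference represents 0,
    so its Koszul part, and with it its derivative, vanishes unless the cell is null. *)
Lemma d_h_unique k omega theta theta' :
  d_h Omega V k omega theta -> d_h Omega V k omega theta' -> ae_eq mu Omega theta theta'.
Proof.
move=> h1 h2; apply: (@ae_sub0 _ _ Omega).
have [_ _ h] := d_h_linear (-1) h2 h1.
apply: ae_Omega => j; have [p [[c [c' [dc dc' pE]]] E1 E2]] := h j.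
have /(koszul_ae0 dc')[nj|c0] : {ae mu, forall x, cell j x -> c + koszul x c' = 0}.
  apply: filterS E1 => x + xj => /(_ xj); rewrite pE => <-.
  by rewrite scaleN1r addNr.
- exact: ae_null_cell.
- by apply: filterS E2 => x + xj => /(_ xj) ->; rewrite pE (ext_d_P1m c x dc') c0 scaler0.
Qed.

End subdivision.

(** * Piecewise Whitney forms *)

Section main.
Context (R : realType) (n : nat) (n0 : (0 < n)%N) (Omega : set 'rV[R]_n).
Local Notation form := (Defs.form R n).
Local Notation mu := (@lebesgue_rV R n).
Hypotheses (oO : open Omega) (bO : bounded_set Omega).
Context (N : nat) (V : 'I_N -> 'I_n.+1 -> 'rV[R]_n).
Hypothesis hV : simplicial_subdivision Omega V.
Local Notation cell j := (hull (V j) predT).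
Local Notation L2ip := (L2ip Omega).
Local Notation L2f := (L2f Omega).
Local Notation L2form := (L2form Omega).
Local Notation codiff := (codiff Omega).
Local Notation d_h := (d_h Omega V).
Local Notation P0h := (P0h Omega V).
Local Notation piecewise := (piecewise Omega V).

Let mO : measurable Omega := open_measurable_rV oO.

Lemma P1sm_smooth (e a : covector R n) (S : {set 'I_n}) :
  smooth (fun x => (e + wedge x a) S).
Proof.
rewrite (_ : (fun x => _) = fun x => e S + lin (wcoef a S) x); first exact: smooth_affine.
by apply/funext => x; rewrite ffunE wedge_lin.
Qed.

Lemma P1m_smooth (c c' : covector R n) (S : {set 'I_n}) :
  smooth (fun x => (c + koszul x c') S).
Proof.
rewrite (_ : (fun x => _) = fun x => c S + lin (kcoef c' S) x); first exact: smooth_affine.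
by apply/funext => x; rewrite ffunE koszul_lin.
Qed.

(** The weak codifferential is computed by [codiff_local] on the open simplex and extended to the
    cell, from which it differs by a null set. *)
Lemma codiff_cell m eta sigma : (m < n)%N -> piecewise m.+1 (@P1sm R n m.+1) eta ->
  codiff m.+1 eta sigma -> forall j, exists e a, [/\ of_degree m.+1 e, of_degree m a,
    ae_eq mu (cell j) eta (fun x => e + wedge x a) &
    ae_eq mu (cell j) sigma (fun=> - (n - m)%:R *: a)].
Proof.
move=> mn [leta heta] hc j; have [q /(P1smP q mn)[e [a [de da ->]]] E] := heta j.
exists e, a; split => //; have [U [oU Uj UO Un]] := cell_interior n0 hV j.
apply: (ae_ocell Un).
have EU : ae_eq mu U eta (fun x => e + wedge x a) by apply: ae_eq_subset E.
have cE : cod (fun x => e + wedge x a) = (fun=> - (n - m)%:R *: a).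
  by apply/funext => x; rewrite (cod_P1sm _ _ da).
have := codiff_local oO bO oU UO hc (P1sm_smooth e a) _ EU.
rewrite cE; apply => x; exact: of_degreeZ.
Qed.

Lemma codiff_P0h m eta sigma : (m < n)%N -> piecewise m.+1 (@P1sm R n m.+1) eta ->
  codiff m.+1 eta sigma -> P0h m sigma.
Proof.
move=> mn peta hc; have [_ ls _] := hc; split => // j.
have [e [a [_ da _ E]]] := codiff_cell mn peta hc j.
exists (fun=> - (n - m)%:R *: a) => //; exists (- (n - m)%:R *: a) => //; exact: of_degreeZ.
Qed.

Lemma kernel_P0h m eta : (m < n)%N -> piecewise m.+1 (@P1sm R n m.+1) eta ->
  codiff m.+1 eta (fun=> 0) -> P0h m.+1 eta.
Proof.
move=> mn peta hc; have [le _ _] := hc; split => // j.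
have [e [a [de da E E']]] := codiff_cell mn peta hc j.
exists (fun=> e); first by exists e.
have nm : - (n - m)%:R != 0 :> R by rewrite oppr_eq0 pnatr_eq0 subn_eq0 -ltnNge.
have [|/eqP] : mu.-negligible (cell j) \/ - (n - m)%:R *: a = 0.
- by apply: const_ae0; apply: filterS E' => x + xj => /(_ xj) <-.
- exact: ae_null_cell.
rewrite scaler_eq0 (negPf nm) /= => /eqP a0.
apply: filterS E => x + xj => /(_ xj) ->; rewrite a0.
rewrite (_ : wedge x 0 = 0) ?addr0//.
by apply/ffunP => S; rewrite !ffunE big1// => i _; rewrite ffunE !mul0r.
Qed.

Lemma P0_P1m k (p : form) : P0 k p -> P1m k p.
Proof.
move=> [c dc ->]; exists c, 0; split => //; first exact: of_degree0.
apply/funext => x; rewrite (_ : koszul x 0 = 0) ?addr0//; apply/ffunP => S.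
by rewrite koszulE ffunE big1// => i _; rewrite ffunE !mul0r.
Qed.

Lemma P0_P1sm m (p : form) : (m < n)%N -> P0 m.+1 p -> P1sm m.+1 p.
Proof.
move=> mn [c dc ->]; apply/(P1smP _ mn); exists c, 0; split => //; first exact: of_degree0.
apply/funext => x; rewrite (_ : wedge x 0 = 0) ?addr0//; apply/ffunP => S.
by rewrite !ffunE big1// => i _; rewrite ffunE !mul0r.
Qed.

Lemma P1sm_linear m t (p q : form) : (m < n)%N -> P1sm m.+1 p -> P1sm m.+1 q ->
  P1sm m.+1 (fun x => t *: p x + q x).
Proof.
move=> mn /(P1smP _ mn)[e [a [de da ->]]] /(P1smP _ mn)[e' [a' [de' da' ->]]].
apply/(P1smP _ mn); exists (t *: e + e'), (t *: a + a'); split.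
- by apply: of_degreeD => //; exact: of_degreeZ.
- by apply: of_degreeD => //; exact: of_degreeZ.
- by apply/funext => x; rewrite wedge_linear scalerDr addrACA.
Qed.

Lemma piecewise_linear k (P : set form) t omega omega' :
  (forall p q, P p -> P q -> P (fun x => t *: p x + q x)) ->
  piecewise k P omega -> piecewise k P omega' ->
  piecewise k P (fun x => t *: omega x + omega' x).
Proof.
move=> hP [l h] [l' h']; split; first exact: L2form_linear.
move=> j; have [p Pp E] := h j; have [p' Pp' E'] := h' j.
exists (fun x => t *: p x + p' x); first exact: hP.
by apply: filterS2 E E' => x e1 e2 xj; rewrite e1// e2.
Qed.

Lemma piecewise_sub k (P Q : set form) omega : P `<=` Q ->
  piecewise k P omega -> piecewise k Q omega.
Proof. by move=> PQ [l h]; split => // j; have [p /PQ Qp E] := h j; exists p. Qed.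

Lemma piecewise_ae k (P : set form) omega omega' : L2form k omega' ->
  ae_eq mu Omega omega omega' -> piecewise k P omega -> piecewise k P omega'.
Proof.
move=> l' E [l h]; split => // j; have [p Pp Ep] := h j; exists p => //.
have Ej := ae_cell n0 hV j E.
by apply: filterS2 Ej Ep => x e1 e2 xj; rewrite -e1// e2.
Qed.

Lemma P0h_linear k t omega omega' : P0h k omega -> P0h k omega' ->
  P0h k (fun x => t *: omega x + omega' x).
Proof.
apply: piecewise_linear => p q [c dc ->] [c' dc' ->]; exists (t *: c + c') => //.
by apply: of_degreeD => //; exact: of_degreeZ.
Qed.

Lemma P0h0 k : P0h k (fun=> 0).
Proof.
split; first exact: L2form0.
by move=> j; exists (fun=> 0); [exists 0 => //; exact: of_degree0|exact: ae_eq_refl].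
Qed.

Lemma d_h_P0h k omega theta : d_h k omega theta -> P0h k.+1 theta.
Proof.
move=> [l1 l2 h]; split => // j; have [p [Pp E1 E2]] := h j.
have [c' dc' pE] := P1m_ext_d Pp; exists (ext_d p) => //.
by rewrite pE; exists (k.+1%:R *: c') => //; exact: of_degreeZ.
Qed.

Lemma d_h_kernel k omega : d_h k omega (fun=> 0) -> P0h k omega.
Proof.
move=> [l1 l2 h]; split => // j; have [p [[c [c' [dc dc' pE]]] E1 E2]] := h j.
exists (fun=> c); first by exists c.
have [|/eqP] : mu.-negligible (cell j) \/ k.+1%:R *: c' = 0.
- apply: const_ae0; apply: filterS E2 => x + xj => /(_ xj).
  by rewrite pE (ext_d_P1m c x dc').
- exact: ae_null_cell.
rewrite scaler_eq0 pnatr_eq0 /= => /eqP c0.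
apply: filterS E1 => x + xj => /(_ xj) ->; rewrite pE c0.
rewrite (_ : koszul x 0 = 0) ?addr0//; apply/ffunP => S.
by rewrite koszulE ffunE big1// => i _; rewrite ffunE !mul0r.
Qed.

Lemma P0h_d_h k omega : P0h k omega -> d_h k omega (fun=> 0).
Proof.
move=> [l h]; split => //; first exact: L2form0.
move=> j; have [p Pp E] := h j; exists p; split => //; first exact: P0_P1m.
have [c dc ->] := Pp; apply: aeW => x _.
apply/ffunP => U; rewrite ext_dE [LHS]ffunE big1// => i _.
by rewrite derive_cst mul0r.
Qed.

Lemma d_h_piecewise k omega theta : d_h k omega theta -> piecewise k (@P1m R n k) omega.
Proof. by move=> [l _ h]; split => // j; have [p [Pp E _]] := h j; exists p. Qed.

(** * Orthogonal generators and coordinates for piecewise constant forms *)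

Definition on_cell j (p : form) : form := fun x => \1_(cell j) x *: p x.

Lemma on_cellE j p x : cell j x -> on_cell j p x = p x.
Proof. by move=> xj; rewrite /on_cell indicE mem_set// scale1r. Qed.

Lemma on_cell_out j p x : ~ cell j x -> on_cell j p x = 0.
Proof. by move=> xj; rewrite /on_cell indicE memNset// scale0r. Qed.

Lemma L2form_on_cell k j (p : form) : (forall x, of_degree k (p x)) ->
  (forall S : {set 'I_n}, smooth (fun x => p x S)) -> L2form k (on_cell j p).
Proof.
move=> dp sp; split; first by move=> x; exact: of_degreeZ.
apply: bounded_L2f => // S.
  rewrite (_ : (fun x => _) = fun x => \1_(cell j) x * p x S); last first.
    by apply/funext => x; rewrite /on_cell ffunE.
  apply: measurable_funM; first by apply: measurable_indic; exact: measurable_cell hV j.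
  by apply: continuous_measurable_rV; exact: smooth_continuous.
have [C hC] := continuous_bounded_Omega bO (smooth_continuous (sp S)).
exists C => x Ox; apply: le_trans (hC x Ox); rewrite /on_cell ffunE indicE.
by case: (_ \in _); rewrite ?scale1r// scale0r normr0.
Qed.

Lemma d_h_on_cell k j (p : form) : P1m k p -> d_h k (on_cell j p) (on_cell j (ext_d p)).
Proof.
move=> Pp; have [c [c' [dc dc' pE]]] := Pp; have [e de eE] := P1m_ext_d Pp; split.
- apply: L2form_on_cell; last by rewrite pE; exact: P1m_smooth.
  by move=> x; rewrite pE; apply: of_degreeD => //; exact: of_degree_koszul.
- apply: L2form_on_cell; last by rewrite eE => S; exact: smooth_cst.
  by move=> x; rewrite eE; exact: of_degreeZ.
- move=> i; have [->|ij] := eqVneq i j.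
    by exists p; split => //; apply: aeW => x xj; exact: on_cellE.
  have out q : ae_eq mu (cell i) (on_cell j q) (fun=> 0).
    apply: filterS (ae_cell_unique n0 hV) => x h xi; apply: on_cell_out => xj.
    by move: ij; rewrite (h i j)// eqxx.
  exists (fun=> 0); split; [exact: P1m0|exact: out|].
  have E : ae_eq mu (cell i) (fun=> 0) (ext_d (fun=> 0 : covector R n)).
    apply: aeW => x _; apply/ffunP => U; rewrite ext_dE [LHS]ffunE big1// => l _.
    by rewrite derive_cst mul0r.
  exact: ae_eq_trans (out _) E.
Qed.

(** Zero in the wrong degree, so that all degrees share the index set of all subsets; [cell_basis]
    is therefore a generating family that contains zero forms. *)
Definition unit_cov k (S : {set 'I_n}) : covector R n := if #|S| == k then dx R S else 0.

Lemma of_degree_unit k S : of_degree k (unit_cov k S).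
Proof.
by rewrite /unit_cov; case: eqP => [<-|_]; [exact: of_degree_dx|exact: of_degree0].
Qed.

Lemma unit_cov_sum k (c : covector R n) : of_degree k c ->
  \sum_(S : {set 'I_n}) c S *: unit_cov k S = c.
Proof.
move=> dc; apply/ffunP => T; rewrite sum_ffunE (bigD1 T)//= big1 ?addr0 => [|S ST].
  rewrite ffunE /unit_cov; have [Tk|Tk] := eqVneq #|T| k.
    by rewrite ffunE eqxx [LHS]mulr1.
  by rewrite dc// scale0r.
rewrite !ffunE /unit_cov; case: eqP => _; rewrite ffunE ?scaler0//.
by rewrite eq_sym (negPf ST) scaler0.
Qed.

Definition cell_basis k (i : 'I_N * {set 'I_n}) : form :=
  on_cell i.1 (fun=> unit_cov k i.2).

Lemma cell_basis_P0h k i : P0h k (cell_basis k i).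
Proof.
apply: d_h_kernel.
have P : P1m k (fun=> unit_cov k i.2) by apply: P0_P1m; exists (unit_cov k i.2) => //; exact: of_degree_unit.
have := d_h_on_cell i.1 P; congr (d_h _ _ _).
apply/funext => x; rewrite /on_cell (_ : ext_d _ x = 0) ?scaler0//.
apply/ffunP => U; rewrite ext_dE [RHS]ffunE big1// => l _.
by rewrite derive_cst mul0r.
Qed.

Lemma P0h_L2f k omega : P0h k omega -> L2f omega.
Proof. by move=> [[]]. Qed.

Lemma cell_basis_L2f k i : L2f (cell_basis k i).
Proof. exact: P0h_L2f (cell_basis_P0h k i). Qed.

Lemma P0h_span k omega : P0h k omega -> exists s : 'I_N * {set 'I_n} -> R,
  ae_eq mu Omega omega (fun x => \sum_i s i *: cell_basis k i x).
Proof.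
move=> [l h].
have /choice[c hc] j : exists c, of_degree k c /\ ae_eq mu (cell j) omega (fun=> c).
  by have [p [c dc ->] E] := h j; exists c.
exists (fun i => c i.1 i.2); apply: (ae_Omega hV) => j; have [dc E] := hc j.
apply: filterS2 E (ae_cell_unique n0 hV) => x E u xj; rewrite E//.
rewrite -[LHS](unit_cov_sum dc) -(pair_bigA _ (fun j S => c j S *: cell_basis k (j, S) x))/=.
rewrite (bigD1 j)//= [X in _ = _ + X]big1 ?addr0 => [|i ij].
  by apply: eq_bigr => S _; rewrite /cell_basis on_cellE.
apply: big1 => S _; rewrite /cell_basis on_cell_out ?scaler0//= => xi.
by move: ij; rewrite (u i j)// eqxx.
Qed.

Lemma cell_basis_orthogonal k i i' : i != i' -> L2ip (cell_basis k i) (cell_basis k i') = 0.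
Proof.
move=> ii'; have l := cell_basis_L2f k i; have l' := cell_basis_L2f k i'.
rewrite /Defs.L2ip /Rintegral (@ae_eq_integral _ _ _ mu Omega (cst 0%E)).
- by rewrite integral0.
- exact: mO.
- exact: measurable_int (L2ip_integrable mO l l').
- exact: measurable_cst.
apply: filterS (ae_cell_unique n0 hV) => x u Ox; congr EFin; apply: big1 => S _.
have [xi|xi] := pselect (cell i.1 x); last first.
  by rewrite /cell_basis on_cell_out// ffunE mul0r.
have [xi'|xi'] := pselect (cell i'.1 x); last first.
  by rewrite mulrC /cell_basis on_cell_out// ffunE mul0r.
rewrite /cell_basis !on_cellE//= /unit_cov.
have e1 := u _ _ xi xi'.
have e2 : i.2 != i'.2 by apply: contraNneq ii' => e2; apply/eqP; case: i i' e1 e2 {l l' xi xi'} => [? ?] [? ?] /= -> ->.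
case: ifP => _; last by rewrite ffunE mul0r.
case: ifP => _; last by rewrite [X in _ * X]ffunE mulr0.
rewrite !ffunE; have [->|_] := eqVneq S i.2; last by rewrite mul0r.
by rewrite (negPf e2) mulr0.
Qed.

(** [coord] divides by these norms so that the L2 product becomes [dot]. For a generator of norm 0
    the quotient is 0 by convention. *)
Let r k i := Num.sqrt (L2ip (cell_basis k i) (cell_basis k i)).
Let coord k (omega : form) i := L2ip omega (cell_basis k i) / r k i.

Lemma L2ip_cell_basis k omega (s : 'I_N * {set 'I_n} -> R) i : P0h k omega ->
  ae_eq mu Omega omega (fun x => \sum_i s i *: cell_basis k i x) ->
  L2ip omega (cell_basis k i) = s i * r k i ^+ 2.
Proof.
move=> Po E; rewrite (L2ip_ae mO (P0h_L2f Po) _ (cell_basis_L2f k i) E); last first.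
  by apply: L2f_sum => // l; exact: cell_basis_L2f.
rewrite L2ip_suml//; [|exact: cell_basis_L2f|exact: cell_basis_L2f].
rewrite (bigD1 i)//= big1 ?addr0; first by rewrite /r sqr_sqrtr// L2ip_ge0.
by move=> l li; rewrite cell_basis_orthogonal// mulr0.
Qed.

Lemma P0h_dot k omega omega' : P0h k omega -> P0h k omega' ->
  L2ip omega omega' = dot (coord k omega) (coord k omega').
Proof.
move=> Po Po'; have [s E] := P0h_span Po; have [s' E'] := P0h_span Po'.
have lf i := cell_basis_L2f k i.
rewrite (L2ip_ae mO (P0h_L2f Po) _ (P0h_L2f Po') E); last exact: L2f_sum.
rewrite L2ip_suml//; last exact: P0h_L2f Po'.
apply: eq_bigr => i _; rewrite /coord (L2ip_cell_basis i Po E) L2ipC (L2ip_cell_basis i Po' E').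
(* Generators of norm 0 contribute 0 on both sides. *)
have [->|r0] := eqVneq (r k i) 0; first by rewrite expr0n /= !mulr0 !mul0r.
by field.
Qed.

(** The projection is found among coordinate vectors; as these come from members of [A], the result
    is an actual member of [A], not merely equal to one almost everywhere. *)
Lemma P0h_projection k (A : set form) omega : A `<=` P0h k -> A (fun=> 0) ->
  (forall t a a', A a -> A a' -> A (fun x => t *: a x + a' x)) -> P0h k omega ->
  exists2 a, A a & forall a', A a' -> L2ip (fun x => (-1) *: a x + omega x) a' = 0.
Proof.
move=> AP A0 Al Po.
have lin t a a' : P0h k a -> P0h k a' ->
    coord k (fun x => t *: a x + a' x) = fun i => t * coord k a i + coord k a' i.
  move=> Pa Pa'; apply/funext => i; rewrite /coord L2ip_linearl//.
  - by rewrite mulrDl mulrA.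
  - exact: P0h_L2f Pa.
  - exact: P0h_L2f Pa'.
  - exact: cell_basis_L2f.
have Slin : lin_closed [set u | exists2 a, A a & u = coord k a].
  split.
    exists (fun=> 0) => //; apply/funext => i.
    by rewrite /coord L2ip0l// mul0r.
  move=> t _ _ [a Aa ->] [a' Aa' ->]; exists (fun x => t *: a x + a' x); first exact: Al.
  by rewrite lin//; exact: AP.
have [_ [a Aa ->] H] := orthogonal_projection (coord k omega) Slin.
exists a => // a' Aa'; rewrite (P0h_dot _ (AP _ Aa')); last by apply: P0h_linear => //; exact: AP.
rewrite lin//; last exact: AP.
rewrite -[RHS](H (coord k a')); last by exists a'.
by apply: eq_bigr => i _; rewrite mulN1r addrC.
Qed.

Lemma P0h_orthogonal0 k omega : P0h k omega ->
  (forall i, L2ip (cell_basis k i) omega = 0) -> ae_eq mu Omega omega (fun=> 0).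
Proof.
move=> Po h; apply: L2ip_eq0 => //; first exact: P0h_L2f Po.
have [s E] := P0h_span Po; have lf i := cell_basis_L2f k i.
rewrite (L2ip_ae mO (P0h_L2f Po) _ (P0h_L2f Po) E); last exact: L2f_sum.
rewrite L2ip_suml//; last exact: P0h_L2f Po.
by rewrite big1// => i _; rewrite h mulr0.
Qed.

End main.

(** * The decomposition *)

Section decomposition.
Context (R : realType) (n : nat) (n0 : (0 < n)%N) (Omega : set 'rV[R]_n).
Local Notation form := (Defs.form R n).
Local Notation mu := (@lebesgue_rV R n).
Hypotheses (oO : open Omega) (bO : bounded_set Omega).
Context (N : nat) (V : 'I_N -> 'I_n.+1 -> 'rV[R]_n).
Hypothesis hV : simplicial_subdivision Omega V.
Local Notation L2ip := (L2ip Omega).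
Local Notation L2f := (L2f Omega).
Local Notation L2form := (L2form Omega).
Local Notation codiff := (codiff Omega).
Local Notation d_h := (d_h Omega V).
Local Notation P0h := (P0h Omega V).
Local Notation piecewise := (piecewise Omega V).
Local Notation Wnc_against := (Wnc_against Omega V).

Let mO : measurable Omega := open_measurable_rV oO.

(** What the duality argument uses of W*_h and W*_h0, in degree m+1. Stability under equality almost
    everywhere is essential: the argument identifies c with - eta only up to null sets. *)
Definition Wstar_like m (D : set form) : Prop :=
  [/\ D `<=` piecewise m.+1 (@P1sm R n m.+1),
      D (fun=> 0),
      forall t eta eta', D eta -> D eta' -> D (fun x => t *: eta x + eta' x) &
      forall eta eta', D eta -> L2form m.+1 eta' -> ae_eq mu Omega eta eta' -> D eta'].

Lemma Wnc_pairing k (D : set form) omega theta eta sigma :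
  Wnc_against k D omega -> D eta -> codiff k.+1 eta sigma -> d_h k omega theta ->
  L2ip theta eta = L2ip omega sigma.
Proof. by move=> [_ h] De hc hd; apply/esym/eqP; rewrite -subr_eq0 (h _ _ _ De hc hd). Qed.

(* Bipolar argument: c is orthogonal to d_h omega for every omega annihilated by all the
   functionals omega |-> <omega, delta eta> - <d_h omega, eta>, hence omega |-> <d_h omega, c>
   is one of them. *)
Lemma Wstar_dual k (D : set form) c : (k < n)%N -> Wstar_like k D ->
  (forall eta, D eta -> exists sigma, codiff k.+1 eta sigma) ->
  P0h k.+1 c ->
  (forall omega theta, Wnc_against k D omega -> d_h k omega theta -> L2ip theta c = 0) ->
  D c /\ codiff k.+1 c (fun=> 0).
Proof.
move=> kn [Dpw D0 Dl Dae] Dc Pc hc.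
(* [inl] indexes piecewise constants, with [d_h] equal to 0; [inr] indexes Koszul forms on single
   cells, whose [d_h] is k+1 times a generator of the constants. *)
pose J := ('I_N * {set 'I_n} + 'I_N * {set 'I_n})%type.
pose e (i : J) : form := match i with
  | inl i => cell_basis V k i
  | inr i => on_cell V i.1 (fun x => koszul x (unit_cov R k.+1 i.2)) end.
pose th (i : J) : form := match i with
  | inl i => fun=> 0
  | inr i => fun x => k.+1%:R *: cell_basis V k.+1 i x end.
have eth i : d_h k (e i) (th i).
  case: i => i; first by apply: P0h_d_h => //; exact: cell_basis_P0h.
  have P : P1m k (fun x => koszul x (unit_cov R k.+1 i.2)).
    exists 0, (unit_cov R k.+1 i.2); split; [exact: of_degree0|exact: of_degree_unit|].
    by apply/funext => x; rewrite add0r.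
  have := d_h_on_cell n0 oO bO hV i.1 P; congr (Defs.d_h _ _ _ _ _).
  apply/funext => x; rewrite /th /cell_basis /on_cell scalerA mulrC -scalerA; congr (_ *: _).
  rewrite (_ : (fun x => _) = fun x => 0 + koszul x (unit_cov R k.+1 i.2)).
    by rewrite (ext_d_P1m _ _ (@of_degree_unit R n k.+1 i.2)).
  by apply/funext => y; rewrite add0r.
have le i : L2f (e i) by have [[]] := eth i.
have lth i : L2f (th i) by have [_ []] := eth i.
pose S := [set u : J -> R | exists eta sigma, [/\ D eta, codiff k.+1 eta sigma &
  u = fun i => L2ip (e i) sigma - L2ip (th i) eta]].
have Slin : lin_closed S.
  split.
    exists (fun=> 0), (fun=> 0); split => //; first exact: codiff0.
    by apply/funext => i; rewrite !(L2ipC Omega _ (fun=> 0)) !L2ip0l// subrr.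
  move=> t _ _ [eta [sigma [De h ->]]] [eta' [sigma' [De' h' ->]]].
  exists (fun x => t *: eta x + eta' x), (fun x => t *: sigma x + sigma' x).
  split; [exact: Dl|exact: codiff_linear|].
  have [[_ l1] [_ l2] _] := h; have [[_ l1'] [_ l2'] _] := h'.
  by apply/funext => i; rewrite !L2ip_linearr//; ring.
have [eta [sigma [De h E]]] : S (fun i => L2ip (th i) c).
  (* A vector t orthogonal to [S] is a combination of the [e i] that satisfies the defining
     condition of [Wnc_against], so the hypothesis on c applies to it. *)
  apply: double_orthogonal => // t tS.
  have hd : d_h k (fun x => \sum_i t i *: e i x) (fun x => \sum_i t i *: th i x).
    exact: d_h_sum.
  have lc := P0h_L2f Pc.
  rewrite -(hc _ _ _ hd); first by rewrite L2ip_suml.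
  split; first exact: (d_h_piecewise hd).
  move=> eta sigma theta De h hth; have [[_ l1] [_ l2] _] := h.
  have [_ [_ lt] _] := hth.
  rewrite (L2ip_ae mO lt _ l1 (d_h_unique oO hV hth hd)); last exact: L2f_sum.
  rewrite !L2ip_suml// -sumrB -[RHS](tS (fun i => L2ip (e i) sigma - L2ip (th i) eta)).
    by apply: eq_bigr => i _; rewrite mulrBr.
  by exists eta, sigma.
have Ei i : L2ip (th i) c = L2ip (e i) sigma - L2ip (th i) eta by exact: (congr1 (fun f => f i) E).
have Ps : P0h k sigma by apply: codiff_P0h h => //; exact: Dpw.
have [leta ls _] := h.
(* The [inl] equations: sigma is itself piecewise constant and orthogonal to every generator. *)
have s0 : ae_eq mu Omega sigma (fun=> 0).
  apply: (P0h_orthogonal0 n0 oO bO hV Ps) => i.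
  have := Ei (inl i); rewrite /= !L2ip0l// subr0 => <-.
  by [].
have h0 : codiff k.+1 eta (fun=> 0).
  by apply: (codiff_ae oO bO h leta _ _ s0); [exact: L2form0|exact: ae_eq_refl].
have Peta : P0h k.+1 eta by apply: kernel_P0h h0 => //; exact: Dpw.
(* The [inr] equations with sigma = 0: eta + c is piecewise constant and orthogonal to every
   generator. *)
have z0 : ae_eq mu Omega (fun x => 1 *: eta x + c x) (fun=> 0).
  have Pz : P0h k.+1 (fun x => 1 *: eta x + c x) by apply: P0h_linear.
  apply: (P0h_orthogonal0 n0 oO bO hV Pz) => i.
  have lb := cell_basis_L2f n0 oO bO hV k.+1 i.
  rewrite L2ip_linearr//; [|exact: leta.2|exact: P0h_L2f Pc].
  have := Ei (inr i); rewrite (L2ip_aer oO (le (inr i)) ls.2 (@L2f0 R n Omega) s0).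
  rewrite (L2ipC _ (e _)) L2ip0l// sub0r /= !L2ip_scalel//; [|exact: leta.2|exact: P0h_L2f Pc].
  move=> H; have k0 : k.+1%:R != 0 :> R by rewrite pnatr_eq0.
  by apply: (mulfI k0); rewrite mulr0 mulrDr mul1r H subrr.
have [lc _] := Pc.
have Dc' : D c.
  have [D1 D2] : D (fun x => (-1) *: eta x + (fun=> 0) x) /\ L2form k.+1 c by split => //; exact: Dl.
  apply: (Dae _ _ D1 D2).
  apply: filterS z0 => x + Ox => /(_ Ox) H.
  by rewrite addr0 scaleN1r; apply/eqP; rewrite eq_sym -addr_eq0 addrC -[eta x]scale1r H.
split => //; have [s hs] := Dc _ Dc'.
have h1 := codiff_linear oO bO (-1) h0 (codiff0 oO k.+1).
apply: (codiff_ae oO bO h1) => //; first exact: L2form0.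
- apply: filterS z0 => x + Ox => /(_ Ox) H.
  by rewrite addr0 scaleN1r; apply/eqP; rewrite eq_sym -addr_eq0 addrC -[eta x]scale1r H.
- by apply: aeW => x _; rewrite scaler0 addr0.
Qed.

(** Two successive projections. Removing the component in [A] leaves a member of the kernel of delta
    by [Wstar_dual]; removing from it the component in [C], itself in that kernel, leaves a member
    of [H]. Both descriptions of harmonic forms amount to piecewise constants orthogonal to [A] and
    to [C]. *)
Lemma hodge_decomposition k (D1 D2 : set form) : (k.+1 < n)%N ->
  Wstar_like k D1 -> Wstar_like k.+1 D2 ->
  (forall eta, D1 eta -> exists sigma, codiff k.+1 eta sigma) ->
  (forall eta sigma, D2 eta -> codiff k.+2 eta sigma -> D1 sigma) ->
  let A := range_in (d_h k) (Wnc_against k D1) in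
  let C := range_in (codiff k.+2) D2 in
  let H := ominus Omega (kernel_in (codiff k.+1) D1) C in
  orth_sum3 Omega (P0h k.+1) A H C /\
  H = ominus Omega (kernel_in (d_h k.+1) (Wnc_against k.+1 D2)) A.
Proof.
move=> kn W1 W2 D1c D21 A C H; have kn' : (k < n)%N by exact: ltnW.
have [D1pw D10 D1l D1ae] := W1; have [D2pw D20 D2l D2ae] := W2.
have AP : A `<=` P0h k.+1 by move=> theta [omega _ hd]; exact: d_h_P0h hd.
have CP : C `<=` P0h k.+1.
  by move=> sigma [eta De hc]; apply: (codiff_P0h n0 oO bO hV _ _ hc) => //; exact: D2pw.
have CK sigma : C sigma -> kernel_in (codiff k.+1) D1 sigma.
  by move=> [eta De hc]; split; [exact: (D21 _ _ De hc)|exact: (codiff_codiff oO hc)].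
have KP : kernel_in (codiff k.+1) D1 `<=` P0h k.+1.
  by move=> eta [De hc]; apply: (kernel_P0h n0 oO bO hV kn' _ hc); exact: D1pw.
have AK theta eta : A theta -> kernel_in (codiff k.+1) D1 eta -> L2ip theta eta = 0.
  move=> [omega Wo hd] [De hc]; rewrite (Wnc_pairing Wo De hc hd).
  by rewrite L2ipC L2ip0l.
(* With [AK], this says that the kernel of delta is exactly the orthogonal complement of [A] among
   piecewise constants. *)
have KA c : P0h k.+1 c -> (forall theta, A theta -> L2ip theta c = 0) ->
    kernel_in (codiff k.+1) D1 c.
  move=> Pc h; apply: (Wstar_dual kn' W1) => // omega theta Wo hd.
  by apply: h; exists omega.
have A0 : A (fun=> 0).
  exists (fun=> 0); last exact: d_h0.
  split; first exact: (d_h_piecewise (@d_h0 R n Omega N V k)).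
  move=> eta sigma theta De hc hth.
  have [_ [_ lt] _] := hth; have [[_ l1] _ _] := hc.
  rewrite L2ip0l// (L2ip_ae mO lt (@L2f0 R n Omega) l1 (d_h_unique oO hV hth (@d_h0 R n Omega N V k))).
  by rewrite L2ip0l// subrr.
have Al t a a' : A a -> A a' -> A (fun x => t *: a x + a' x).
  move=> [om Wo h] [om' Wo' h']; have hl := d_h_linear oO t h h'.
  exists (fun x => t *: om x + om' x) => //.
  split; first exact: (d_h_piecewise hl).
  move=> eta sigma theta De hc hth.
  have [_ [_ lt] _] := hth; have [[_ l1] [_ l2] _] := hc.
  have [[_ m1] [_ m2] _] := h; have [[_ m1'] [_ m2'] _] := h'.
  have [_ [_ m3] _] := hl.
  rewrite (L2ip_ae mO lt m3 l1 (d_h_unique oO hV hth hl)).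
  rewrite !L2ip_linearl// (Wnc_pairing Wo De hc h) (Wnc_pairing Wo' De hc h').
  by rewrite subrr.
have C0 : C (fun=> 0) by exists (fun=> 0) => //; exact: codiff0.
have Cl t a a' : C a -> C a' -> C (fun x => t *: a x + a' x).
  move=> [om Do h] [om' Do' h']; exists (fun x => t *: om x + om' x); first exact: D2l.
  exact: codiff_linear.
split.
  split.
  - apply/seteqP; split=> [omega Po|_ [a [b [c [Aa [Kb _] Cc ->]]]]]; last first.
      have -> : (fun x => a x + b x + c x) = fun x => 1 *: (fun y => 1 *: a y + b y) x + c x.
        by apply/funext => x; rewrite !scale1r.
      by apply: P0h_linear => //; [apply: P0h_linear => //; [exact: AP|exact: KP]|exact: CP].
    have [a Aa ha] := P0h_projection n0 oO bO hV AP A0 Al Po.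
    pose w := fun x => (-1) *: a x + omega x.
    have Pw : P0h k.+1 w by apply: P0h_linear => //; exact: AP.
    have Kw : kernel_in (codiff k.+1) D1 w.
      by apply: KA => // theta At; rewrite L2ipC; exact: ha.
    have [c Cc hC] := P0h_projection n0 oO bO hV CP C0 Cl Pw.
    exists a, (fun x => (-1) *: c x + w x), c; split => //.
      split => //; have [D1c' hc'] := CK _ Cc; have [D1w hw] := Kw.
      split; first exact: D1l.
      have := codiff_linear oO bO (-1) hc' hw; congr (Defs.codiff _ _ _ _).
      by apply/funext => x; rewrite scaler0 addr0.
    by apply/funext => x; apply/ffunP => S; rewrite /w !scaleN1r !ffunE; ring.
  - by move=> a b Aa [Kb _]; exact: AK.
  - by move=> a c Aa /CK; exact: AK.
  - by move=> b c [_ hb] Cc; exact: hb.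
apply/seteqP; split=> b.
(* Since b is piecewise constant, its [d_h] is 0, and the defining condition of [Wnc_against] in
   degree k+1 reduces to orthogonality to [C]. *)
- move=> [Kb hb]; have Pb := KP _ Kb; split.
    split; last exact: P0h_d_h.
    split; first by apply: piecewise_sub Pb; exact: P0_P1m.
    move=> eta sigma theta De hc hth.
    have [_ [_ lt] _] := hth; have [[_ l1] _ _] := hc.
    rewrite (L2ip_ae mO lt (@L2f0 R n Omega) l1 (d_h_unique oO hV hth (P0h_d_h Pb))).
    by rewrite L2ip0l// subr0; apply: hb; exists eta.
  by move=> a Aa; rewrite L2ipC; exact: AK.
(* Conversely, orthogonality to [A] puts b into the kernel of delta, and the pairing with [d_h] b =
   0 gives orthogonality to [C]. *)
- move=> [[Wb hb] ha]; have Pb := d_h_kernel hb; split.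
    by apply: KA => // theta At; rewrite L2ipC; exact: ha.
  move=> sigma [eta De hc]; rewrite -(Wnc_pairing Wb De hc hb).
  by rewrite L2ip0l.
Qed.

Lemma Wstar_like_setI m (P : set form) : (m < n)%N -> P (fun=> 0) ->
  (forall t eta eta', P eta -> P eta' -> P (fun x => t *: eta x + eta' x)) ->
  (forall eta eta', P eta -> L2form m.+1 eta' -> ae_eq mu Omega eta eta' -> P eta') ->
  Wstar_like m (piecewise m.+1 (@P1sm R n m.+1) `&` P).
Proof.
move=> mn P0 Pl Pae; split.
- by move=> eta [].
- split => //; apply: piecewise_sub (@P0h0 R n Omega N V m.+1); move=> p; exact: P0_P1sm.
- move=> t eta eta' [h1 h2] [h1' h2']; split; last exact: Pl.
  by apply: piecewise_linear => // p q; exact: P1sm_linear.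
- move=> eta eta' [h1 h2] l E; split; last exact: Pae h2 l E.
  exact: (piecewise_ae n0 hV l E h1).
Qed.

Lemma Wstar_Wstar_like m : (m < n)%N -> Wstar_like m (Wstar Omega V m.+1).
Proof.
move=> mn; apply: Wstar_like_setI => //.
- by exists (fun=> 0); exact: codiff0.
- by move=> t eta eta'; exact: Hstar_linear.
- by move=> eta eta'; exact: Hstar_ae.
Qed.

Lemma Hstar0_0 m : Hstar0 Omega m (fun=> 0).
Proof.
apply/Hstar0P; exists (fun=> 0); first exact: codiff0.
move=> e e0; exists (fun=> 0), (fun=> 0); split; [|exact: codiff0|].
  split; first by move=> x; exact: of_degree0.
    by move=> S; under eq_fun do rewrite ffunE; exact: smooth_cst.
  by exists set0; split => //; exact: compact0.
rewrite (_ : (fun x => -1 *: 0 + 0) = (fun=> 0)); last first.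
  by apply/funext => x; rewrite scaler0 addr0.
by rewrite L2ip0l// addr0.
Qed.

Lemma Wstar0_Wstar_like m : (m < n)%N -> Wstar_like m (Wstar0 Omega V m.+1).
Proof.
move=> mn; apply: Wstar_like_setI => //.
- exact: Hstar0_0.
- by move=> t eta eta'; exact: Hstar0_linear.
- by move=> eta eta'; exact: Hstar0_ae.
Qed.

Lemma codiff_piecewise k eta sigma : (k.+1 < n)%N ->
  piecewise k.+2 (@P1sm R n k.+2) eta -> codiff k.+2 eta sigma ->
  piecewise k.+1 (@P1sm R n k.+1) sigma.
Proof.
move=> kn pe hc; apply: piecewise_sub (codiff_P0h n0 oO bO hV kn pe hc).
by move=> p; apply: P0_P1sm; exact: ltnW.
Qed.

End decomposition.

Theorem theorem3p14 (R : realType) (n : nat) (hn : (1 <= n)%N)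
    (Omega : set 'rV[R]_n) (hOmega : polyhedral_domain Omega)
    (N : nat) (V : 'I_N -> 'I_n.+1 -> 'rV[R]_n)
    (hV : simplicial_subdivision Omega V)
    (k : nat) (hk : (1 <= k <= n - 1)%N) :
  [/\ orth_sum3 Omega (P0h Omega V k)
        (range_in (d_h Omega V k.-1) (Wnc Omega V k.-1))
        (harm_star0 Omega V k)
        (range_in (codiff Omega k.+1) (Wstar0 Omega V k.+1)),
      harm_star0 Omega V k = harm_nc Omega V k,
      orth_sum3 Omega (P0h Omega V k)
        (range_in (d_h Omega V k.-1) (Wnc0 Omega V k.-1))
        (harm_nc0 Omega V k)
        (range_in (codiff Omega k.+1) (Wstar Omega V k.+1)) &
      harm_nc0 Omega V k = harm_star Omega V k].
Proof.
have [_ oO _ bO _] := hOmega.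
case: k hk => [//|k] /andP[_ kn].
have kn1 : (k.+1 < n)%N by move: kn hn; case: (n) => // m; rewrite subn1.
have kn0 := ltnW kn1.
(* Delta preserves both ingredients of W*_h0: it makes forms piecewise constant, hence again
   piecewise dual Whitney, and it preserves the zero boundary condition. *)
have [S1 E1] := hodge_decomposition hn oO bO hV kn1
  (Wstar0_Wstar_like hn oO bO hV kn0) (Wstar0_Wstar_like hn oO bO hV kn1)
  (fun eta h => Hstar0_Hstar h.2)
  (fun eta sigma De hc => conj (codiff_piecewise hn oO bO hV kn1 De.1 hc)
     (Hstar0_codiff oO bO De.2 hc)).
have [S2 E2] := hodge_decomposition hn oO bO hV kn1
  (Wstar_Wstar_like hn oO bO hV kn0) (Wstar_Wstar_like hn oO bO hV kn1)
  (fun eta h => h.2)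
  (fun eta sigma De hc => conj (codiff_piecewise hn oO bO hV kn1 De.1 hc)
     (Hstar_codiff oO hc)).
split; [exact: S1|exact: E1| |exact: esym E2].
(* The lemma states the decomposition with the kernel of delta, the theorem here with nonconforming
   harmonic forms; the equality of the two converts it. *)
by move: S2; rewrite E2.
Qed.
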